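(* Let $n\geq 1$ and let $\Bbbk$ be a field whose characteristic is not $2$. The quiver of the algebra $\Bbbk\mathrm{COD}_n$ consists of two straightline paths (directed linear graphs $\bullet\to\bullet\to\cdots\to\bullet$, disjoint from each other), each with $n$ vertices. Moreover, $\Bbbk\mathrm{COD}_n$ has a quiver presentation in which the relations say that every composition of two consecutive arrows is zero.
   Context: $[n]=\{1,\dots,n\}$. $\mathrm{OD}_n$ is the monoid (under composition) of all functions $f:[n]\to[n]$ that are order-preserving or order-reversing. $\mathbb{Z}_2$ is the multiplicative group $\{\mathbf 1,-\mathbf 1\}$. $\mathrm{COD}_n$ is the submonoid of $\mathrm{OD}_n\times\mathbb{Z}_2$ consisting of: the pairs $(f,\mathbf 1)$ with $f$ non-constant order-preserving, the pairs $(f,-\mathbf 1)$ with $f$ non-constant order-reversing, and the pairs $(c_z,\mathbf 1)$, $(c_z,-\mathbf 1)$ for every $z\in[n]$, where $c_z$ is the constant function with value $z$. $\Bbbk\mathrm{COD}_n$ is its monoid algebra. Algebras are finite-dimensional and unital. An algebra $A$ is split basic if $A/\mathrm{Rad}\,A\simeq\Bbbk^m$ for some $m$. For a split basic algebra $A$ with complete set of primitive orthogonal idempotents $\{e_1,\dots,e_m\}$, the quiver of $A$ is the directed graph with vertices in bijection with the $e_i$ and with arrows from $e_i$ to $e_j$ in bijection with a basis of $(e_j+\mathrm{Rad}^2A)(\mathrm{Rad}A/\mathrm{Rad}^2A)(e_i+\mathrm{Rad}^2A)$; up to isomorphism this does not depend on the chosen idempotents. Let $\mathscr{L}(A)$ be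 the $\Bbbk$-linear category with objects $e_1,\dots,e_m$, hom-sets $\mathscr{L}(A)(e_i,e_j)=e_jAe_i$ and composition given by the product of $A$. The free $\Bbbk$-linear category on $Q$ has as morphisms the $\Bbbk$-linear combinations of paths (with common endpoints) of $Q$. A quiver presentation of $A$ is a pair $(Q,R)$, with $Q$ the quiver of $A$ and $R$ a relation on the free $\Bbbk$-linear category on $Q$, such that the quotient of that category by the $\Bbbk$-linear congruence generated by $R$ is isomorphic to $\mathscr{L}(A)$. If an algebra $A$ is Morita equivalent to a split basic algebra $B$, the quiver and a quiver presentation of $B$ are also called the quiver and a quiver presentation of $A$. *)

(* Defs.v *)
From HB Require Import structures.
From mathcomp Require Import all_boot all_order all_algebra all_field.
From mathcomp Require Import generic_quotient boolp finmap.
From mathcomp.multinomials Require Import monalg.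

Set Implicit Arguments.
Unset Strict Implicit.
Unset Printing Implicit Defensive.

Import GRing.Theory.
Local Open Scope ring_scope.
Local Open Scope quotient_scope.

#[short(type="finMonoidType")]
HB.structure Definition FinMonoid := {M of Monoid M & Finite M}.

(* Elements are the coefficient functions; the product below is convolution. *)
Definition monoid_alg (k : fieldType) (M : finMonoidType) : Type :=
  {ffun M -> k}.

Section MonoidAlgebra.
Variables (k : fieldType) (M : finMonoidType).
Local Notation A := (monoid_alg k M).
Implicit Types f g h : A.

HB.instance Definition _ := Vector.copy A {ffun M -> k^o}.

Definition monoid_alg_one : A := [ffun x => (x == 1%g)%:R].

Definition monoid_alg_mul f g : A :=
  [ffun x => \sum_(p : M * M | (p.1 * p.2)%g == x) f p.1 * g p.2].

Lemma monoid_algD f g x : (f + g) x = f x + g x.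
Proof. by rewrite ffunE. Qed.

Lemma monoid_algZ (c : k) f x : (c *: f) x = c * f x.
Proof. by rewrite ffunE. Qed.

Lemma monoid_alg_mulE f g x :
  monoid_alg_mul f g x = \sum_y \sum_(z | (y * z)%g == x) f y * g z.
Proof.
by rewrite ffunE (pair_big_dep xpredT (fun y z => (y * z)%g == x)
  (fun y z => f y * g z)).
Qed.

Lemma monoid_alg_mulA : associative monoid_alg_mul.
Proof.
move=> f g h; apply/ffunP=> x; rewrite !monoid_alg_mulE.
transitivity (\sum_a \sum_b \sum_(c | (a * b * c)%g == x) f a * (g b * h c)).
  apply: eq_bigr => a _.
  transitivity (\sum_z \sum_b \sum_(c | ((a * z)%g == x) && ((b * c)%g == z))
                 f a * (g b * h c)).
    rewrite big_mkcond; apply: eq_bigr => z _; case: ifP => _ /=.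
      rewrite monoid_alg_mulE mulr_sumr; apply: eq_bigr => b _.
      by rewrite mulr_sumr.
    by rewrite big1 // => b _; rewrite big_pred0.
  rewrite exchange_big; apply: eq_bigr => b _ /=.
  rewrite (exchange_big_dep (fun c => (a * b * c)%g == x)) /=; last first.
    by move=> z c _ /andP[/eqP<- /eqP<-]; rewrite mulgA.
  apply: eq_bigr => c abc; rewrite (big_pred1 (b * c)%g) // => z /=.
  have [->|ne] := eqVneq z (b * c)%g; first by rewrite mulgA abc.
  by rewrite andbF.
symmetry.
transitivity (\sum_z \sum_a \sum_b \sum_(c | ((z * c)%g == x) && ((a * b)%g == z))
                 f a * (g b * h c)).
  apply: eq_bigr => z _.
  transitivity (\sum_(c | (z * c)%g == x) \sum_a \sum_(b | (a * b)%g == z)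
                 f a * (g b * h c)).
    apply: eq_bigr => c _; rewrite monoid_alg_mulE mulr_suml.
    apply: eq_bigr => a _; rewrite mulr_suml.
    by apply: eq_bigr => b _; rewrite mulrA.
  rewrite exchange_big; apply: eq_bigr => a _ /=.
  by rewrite (exchange_big_dep xpredT).
rewrite exchange_big; apply: eq_bigr => a _ /=.
rewrite exchange_big; apply: eq_bigr => b _ /=.
rewrite (exchange_big_dep (fun c => (a * b * c)%g == x)) /=; last first.
  by move=> z c _ /andP[/eqP<- /eqP<-].
apply: eq_bigr => c abc; rewrite (big_pred1 (a * b)%g) // => z /=.
have [->|ne] := eqVneq z (a * b)%g; first by rewrite abc.
by rewrite andbF.
Qed.

Lemma monoid_alg_mul1 : left_id monoid_alg_one monoid_alg_mul.
Proof.
move=> f; apply/ffunP=> x; rewrite monoid_alg_mulE (bigD1 1%g) //=.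
rewrite (big_pred1 x); last by move=> z; rewrite mul1g.
rewrite ffunE eqxx mul1r big1 ?addr0 // => y /negPf y1.
by rewrite big1 // => z _; rewrite ffunE y1 mul0r.
Qed.

Lemma monoid_alg_mulr1 : right_id monoid_alg_one monoid_alg_mul.
Proof.
move=> f; apply/ffunP=> x; rewrite monoid_alg_mulE.
rewrite (eq_bigr (fun y => if y == x then f y else 0)).
  by rewrite -big_mkcond big_pred1_eq.
move=> y _; rewrite big_mkcond (bigD1 1%g) //= mulg1 ffunE eqxx mulr1.
rewrite big1 ?addr0 // => z /negPf z1.
by case: ifP => // _; rewrite ffunE z1 mulr0.
Qed.

Lemma monoid_alg_mulDl : left_distributive monoid_alg_mul +%R.
Proof.
move=> f g h; apply/ffunP=> x; rewrite !ffunE -big_split; apply: eq_bigr => p _.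
by rewrite ffunE mulrDl.
Qed.

Lemma monoid_alg_mulDr : right_distributive monoid_alg_mul +%R.
Proof.
move=> f g h; apply/ffunP=> x; rewrite !ffunE -big_split; apply: eq_bigr => p _.
by rewrite ffunE mulrDr.
Qed.

Lemma monoid_alg_one_neq0 : monoid_alg_one != 0.
Proof. by apply/eqP=> /ffunP/(_ 1%g)/eqP; rewrite !ffunE eqxx oner_eq0. Qed.

HB.instance Definition _ := GRing.Zmodule_isNzRing.Build A monoid_alg_mulA
  monoid_alg_mul1 monoid_alg_mulr1 monoid_alg_mulDl monoid_alg_mulDr
  monoid_alg_one_neq0.

Lemma monoid_alg_scaleAl (c : k) f g : c *: (f * g) = (c *: f) * g.
Proof.
apply/ffunP=> x; rewrite !ffunE /GRing.scale /= mulr_sumr.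
by apply: eq_bigr => p _; rewrite monoid_algZ mulrA.
Qed.

HB.instance Definition _ := GRing.Lmodule_isLalgebra.Build k A monoid_alg_scaleAl.

Lemma monoid_alg_scaleAr (c : k) f g : c *: (f * g) = f * (c *: g).
Proof.
apply/ffunP=> x; rewrite !ffunE /GRing.scale /= mulr_sumr.
by apply: eq_bigr => p _; rewrite monoid_algZ mulrCA.
Qed.

HB.instance Definition _ := GRing.Lalgebra_isAlgebra.Build k A monoid_alg_scaleAr.
HB.instance Definition _ := Algebra_isFalgebra.Build k A.

End MonoidAlgebra.

Definition transf (n : nat) : Type := {ffun 'I_n -> 'I_n}.

Section Transf.
Variable n : nat.
HB.instance Definition _ := Finite.copy (transf n) {ffun 'I_n -> 'I_n}.
Implicit Types f g : transf n.

Definition transf_one : transf n := [ffun i => i].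

(* As usual for functions, [f * g] is "first [g], then [f]". *)
Definition transf_mul f g : transf n := [ffun i => f (g i)].

Lemma transf_mulA : associative transf_mul.
Proof. by move=> f g h; apply/ffunP=> i; rewrite !ffunE. Qed.
Lemma transf_mul1 : left_id transf_one transf_mul.
Proof. by move=> f; apply/ffunP=> i; rewrite !ffunE. Qed.
Lemma transf_mulr1 : right_id transf_one transf_mul.
Proof. by move=> f; apply/ffunP=> i; rewrite !ffunE. Qed.

HB.instance Definition _ :=
  isMonoid.Build (transf n) transf_mulA transf_mul1 transf_mulr1.

Definition order_preserving f : bool :=
  [forall i : 'I_n, forall j : 'I_n, (i <= j)%N ==> (f i <= f j)%N].
Definition order_reversing f : bool :=
  [forall i : 'I_n, forall j : 'I_n, (i <= j)%N ==> (f j <= f i)%N].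
Definition const_transf (z : 'I_n) : transf n := [ffun _ => z].
Definition is_const f := [exists z, f == const_transf z].

Lemma order_preservingP f :
  reflect {homo f : i j / (i <= j)%N} (order_preserving f).
Proof.
apply: (iffP forallP) => [h i j le|h i].
  by have /forallP/(_ j)/implyP := h i; apply.
by apply/forallP=> j; apply/implyP; apply: h.
Qed.

Lemma order_reversingP f :
  reflect {homo f : i j /~ (i <= j)%N} (order_reversing f).
Proof.
apply: (iffP forallP) => [h i j le|h i].
  by have /forallP/(_ i)/implyP := h j; apply.
by apply/forallP=> j; apply/implyP; apply: h.
Qed.

Lemma is_constP f : reflect (exists z, f = const_transf z) (is_const f).
Proof. by apply: (iffP existsP) => -[z] /eqP; exists z => //; apply/eqP. Qed.

Lemma transf1E i : (1%g : transf n) i = i.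
Proof. by rewrite ffunE. Qed.

Lemma transfME f g i : (f * g)%g i = f (g i).
Proof. by rewrite ffunE. Qed.

Lemma order_preserving1 : order_preserving 1%g.
Proof. by apply/order_preservingP => i j; rewrite !transf1E. Qed.

Lemma order_preservingMpp f g :
  order_preserving f -> order_preserving g -> order_preserving (f * g)%g.
Proof.
move=> /order_preservingP hf /order_preservingP hg.
by apply/order_preservingP => i j /hg/hf; rewrite !transfME.
Qed.

Lemma order_preservingMrr f g :
  order_reversing f -> order_reversing g -> order_preserving (f * g)%g.
Proof.
move=> /order_reversingP hf /order_reversingP hg.
by apply/order_preservingP => i j /hg/hf; rewrite !transfME.
Qed.

Lemma order_reversingMpr f g :
  order_preserving f -> order_reversing g -> order_reversing (f * g)%g.
Proof.
move=> /order_preservingP hf /order_reversingP hg.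
by apply/order_reversingP => i j /hg/hf; rewrite !transfME.
Qed.

Lemma order_reversingMrp f g :
  order_reversing f -> order_preserving g -> order_reversing (f * g)%g.
Proof.
move=> /order_reversingP hf /order_preservingP hg.
by apply/order_reversingP => i j /hg/hf; rewrite !transfME.
Qed.

Lemma is_constMl f g : is_const f -> is_const (f * g)%g.
Proof.
move=> /is_constP[z ->]; apply/is_constP; exists z.
by apply/ffunP=> i; rewrite transfME !ffunE.
Qed.

Lemma is_constMr f g : is_const g -> is_const (f * g)%g.
Proof.
move=> /is_constP[z ->]; apply/is_constP; exists (f z).
by apply/ffunP=> i; rewrite transfME !ffunE.
Qed.

Definition OD_pred : pred (transf n) :=
  fun f => order_preserving f || order_reversing f.

Lemma OD_pred_closed : monoid_closed OD_pred.
Proof.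
split; first by rewrite unfold_in order_preserving1.
move=> f g; rewrite !unfold_in => /orP[] hf /orP[] hg; apply/orP.
- by left; apply: order_preservingMpp.
- by right; apply: order_reversingMpr.
- by right; apply: order_reversingMrp.
- by left; apply: order_preservingMrr.
Qed.

Record OD := MkOD { OD_val :> transf n; OD_valP : OD_pred OD_val }.

HB.instance Definition _ := [isSub for OD_val].
HB.instance Definition _ := [Finite of OD by <:].
HB.instance Definition _ :=
  SubChoice_isSubMonoid.Build (transf n) OD_pred OD OD_pred_closed.

End Transf.

(* [Z2_one] and [Z2_opp] stand for 1 and -1. *)
Variant Z2 : Type := Z2_one | Z2_opp.

Definition Z2_bool (a : Z2) : bool := if a is Z2_opp then true else false.
Definition bool_Z2 (b : bool) : Z2 := if b then Z2_opp else Z2_one.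
Lemma Z2_boolK : cancel Z2_bool bool_Z2. Proof. by case. Qed.

HB.instance Definition _ := Finite.copy Z2 (can_type Z2_boolK).

Definition Z2_mul (a b : Z2) : Z2 :=
  match a, b with
  | Z2_one, _ => b
  | Z2_opp, Z2_one => Z2_opp
  | Z2_opp, Z2_opp => Z2_one
  end.

Lemma Z2_mulA : associative Z2_mul. Proof. by do 3 case. Qed.
Lemma Z2_mul1 : left_id Z2_one Z2_mul. Proof. by []. Qed.
Lemma Z2_mulr1 : right_id Z2_one Z2_mul. Proof. by case. Qed.
Lemma Z2_mulV : left_inverse Z2_one id Z2_mul. Proof. by case. Qed.
Lemma Z2_mulrV : right_inverse Z2_one id Z2_mul. Proof. by case. Qed.

HB.instance Definition _ :=
  isGroup.Build Z2 Z2_mulA Z2_mul1 Z2_mulr1 Z2_mulV Z2_mulrV.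

Section COD.
Variable n : nat.

Definition COD_pred : pred (OD n * Z2) := fun p =>
  [|| [&& ~~ is_const p.1, order_preserving p.1 & p.2 == Z2_one],
      [&& ~~ is_const p.1, order_reversing p.1 & p.2 == Z2_opp]
    | is_const p.1].

Lemma COD_predE p : COD_pred p =
  is_const p.1 || (if p.2 is Z2_one then order_preserving p.1
                   else order_reversing p.1).
Proof.
rewrite /COD_pred; case: p => f [] /=; case: (is_const f) => //=;
by rewrite ?andbT ?andbF ?orbF.
Qed.

Lemma COD_pred_closed : monoid_closed COD_pred.
Proof.
have memE p : (p \in COD_pred) = COD_pred p by [].
split; first by rewrite memE COD_predE order_preserving1 orbT.
move=> [f a] [g b]; rewrite !memE !COD_predE /=.
have [cf _|_ /= hf] := boolP (is_const f).
  by rewrite is_constMl.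
have [cg _|_ /= hg] := boolP (is_const g).
  by rewrite is_constMr.
apply/orP; right; case: a hf; case: b hg => /= hg hf.
- exact: order_preservingMpp.
- exact: order_reversingMpr.
- exact: order_reversingMrp.
- exact: order_preservingMrr.
Qed.

Record COD := MkCOD { COD_val :> OD n * Z2; COD_valP : COD_pred COD_val }.

HB.instance Definition _ := [isSub for COD_val].
HB.instance Definition _ := [Finite of COD by <:].
HB.instance Definition _ :=
  SubChoice_isSubMonoid.Build (OD n * Z2)%type COD_pred COD COD_pred_closed.

End COD.

Record lincat (k : fieldType) := LinCat {
  obj :> Type;
  hom : obj -> obj -> lmodType k;
  idm : forall x, hom x x;
  comp : forall x y z, hom y z -> hom x y -> hom x z;
  comp_linear_l : forall x y z (f : hom x y),
    linear (fun g : hom y z => comp g f);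
  comp_linear_r : forall x y z (g : hom y z),
    linear (fun f : hom x y => comp g f);
  compA : forall x y z t (h : hom z t) (g : hom y z) (f : hom x y),
    comp h (comp g f) = comp (comp h g) f;
  comp1m : forall x y (f : hom x y), comp (idm y) f = f;
  compm1 : forall x y (f : hom x y), comp f (idm x) = f
}.
Arguments hom {k C} x y : rename.
Arguments idm {k C} x : rename.
Arguments comp {k C x y z} g f : rename.
Notation "g \oc f" := (comp g f) (at level 40, left associativity).

Record linfunctor (k : fieldType) (C D : lincat k) := LinFunctor {
  fobj :> C -> D;
  fhom : forall x y : C, hom x y -> hom (fobj x) (fobj y);
  fhom_linear : forall x y, linear (@fhom x y);
  fhom1 : forall x, fhom (idm x) = idm (fobj x);
  fhomM : forall x y z (g : hom y z) (f : hom x y),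
    fhom (g \oc f) = fhom g \oc fhom f
}.
Arguments fhom {k C D} F {x y} f : rename.

Section Functors.
Variable k : fieldType.

Lemma id_functor_linear (C : lincat k) (x y : C) :
  linear (fun f : hom x y => f).
Proof. by []. Qed.

Definition id_functor (C : lincat k) : linfunctor C C :=
  @LinFunctor k C C id (fun x y f => f) (@id_functor_linear C)
    (fun x => erefl) (fun x y z g f => erefl).

Section Composition.
Variables (C D E : lincat k) (G : linfunctor D E) (F : linfunctor C D).
Let GF x y (f : hom x y) : hom (G (F x)) (G (F y)) := fhom G (fhom F f).

Lemma comp_functor_linear x y : linear (@GF x y).
Proof. by move=> a f g; rewrite /GF !fhom_linear. Qed.
Lemma comp_functor1 x : GF (idm x) = idm (G (F x)).
Proof. by rewrite /GF !fhom1. Qed.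
Lemma comp_functorM x y z (g : hom y z) (f : hom x y) :
  GF (g \oc f) = GF g \oc GF f.
Proof. by rewrite /GF !fhomM. Qed.

Definition comp_functor : linfunctor C E :=
  @LinFunctor k C E (fun x => G (F x)) GF
    comp_functor_linear comp_functor1 comp_functorM.
End Composition.

Definition natural_iso (C D : lincat k) (F G : linfunctor C D) : Prop :=
  exists (eta : forall x, hom (F x) (G x)) (eta' : forall x, hom (G x) (F x)),
    [/\ forall x, eta' x \oc eta x = idm (F x),
        forall x, eta x \oc eta' x = idm (G x) &
        forall x y (f : hom x y), eta y \oc fhom F f = fhom G f \oc eta x].

Definition lincat_equiv (C D : lincat k) : Prop :=
  exists (F : linfunctor C D) (G : linfunctor D C),
    natural_iso (comp_functor G F) (id_functor C) /\
    natural_iso (comp_functor F G) (id_functor D).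

(* Isomorphism of categories: bijective on objects and fully faithful. *)
Definition lincat_iso (C D : lincat k) : Prop :=
  exists F : linfunctor C D,
    bijective (fobj F) /\ forall x y : C, bijective (@fhom _ _ _ F x y).

End Functors.

Record lincong (k : fieldType) (V : lmodType k) (E : V -> V -> Prop) : Prop :=
  LinCong {
  lcong_refl : forall u, E u u;
  lcong_sym : forall u v, E u v -> E v u;
  lcong_trans : forall u v w, E u v -> E v w -> E u w;
  lcongD : forall u u' v v', E u u' -> E v v' -> E (u + v) (u' + v');
  lcongZ : forall a u u', E u u' -> E (a *: u) (a *: u')
}.

Section LmodQuotient.
Variables (k : fieldType) (V : lmodType k) (E : V -> V -> Prop).
Hypothesis cE : lincong E.

Definition lquot_rel : rel V := fun u v => `[< E u v >].

Lemma lquot_rel_refl : reflexive lquot_rel.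
Proof. by move=> u; apply/asboolP; apply: lcong_refl. Qed.
Lemma lquot_rel_sym : symmetric lquot_rel.
Proof. by move=> u v; apply/asboolP/asboolP; apply: lcong_sym. Qed.
Lemma lquot_rel_trans : transitive lquot_rel.
Proof. by move=> v u w /asboolP uv /asboolP/(lcong_trans cE uv) ?; apply/asboolP. Qed.

Definition lquot_equiv :=
  EquivRel lquot_rel lquot_rel_refl lquot_rel_sym lquot_rel_trans.

Definition lquot : Type := {eq_quot lquot_equiv}.
HB.instance Definition _ := Choice.on lquot.
HB.instance Definition _ := EqQuotient.on lquot.

Definition lquot_pi (u : V) : lquot := \pi_lquot u.

Lemma lquot_eqP u v : lquot_pi u = lquot_pi v <-> E u v.
Proof.
by split=> [/eqmodP/asboolP|uv] //; apply/eqmodP/asboolP.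
Qed.

Lemma lquot_ind (P : lquot -> Prop) : (forall u, P (lquot_pi u)) -> forall x, P x.
Proof. by move=> h x; rewrite -[x]reprK; apply: h. Qed.

Lemma lquot_repr u : E (repr (lquot_pi u)) u.
Proof. by apply/lquot_eqP; rewrite /lquot_pi reprK. Qed.

Definition lquot_add (x y : lquot) : lquot := lquot_pi (repr x + repr y).
Definition lquot_opp (x : lquot) : lquot := lquot_pi (- repr x).
Definition lquot_scale (a : k) (x : lquot) : lquot := lquot_pi (a *: repr x).

Lemma lquot_addE u v : lquot_add (lquot_pi u) (lquot_pi v) = lquot_pi (u + v).
Proof. by apply/lquot_eqP; apply: (lcongD cE); apply: lquot_repr. Qed.
Lemma lquot_scaleE a u : lquot_scale a (lquot_pi u) = lquot_pi (a *: u).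
Proof. by apply/lquot_eqP; apply: (lcongZ cE); apply: lquot_repr. Qed.
Lemma lquot_oppE u : lquot_opp (lquot_pi u) = lquot_pi (- u).
Proof. by rewrite /lquot_opp -!scaleN1r -!lquot_scaleE /lquot_pi reprK. Qed.

Lemma lquot_addA : associative lquot_add.
Proof.
elim/lquot_ind=> u; elim/lquot_ind=> v; elim/lquot_ind=> w.
by rewrite !lquot_addE addrA.
Qed.
Lemma lquot_addC : commutative lquot_add.
Proof.
by elim/lquot_ind=> u; elim/lquot_ind=> v; rewrite !lquot_addE addrC.
Qed.
Lemma lquot_add0 : left_id (lquot_pi 0) lquot_add.
Proof. by elim/lquot_ind=> u; rewrite lquot_addE add0r. Qed.
Lemma lquot_addN : left_inverse (lquot_pi 0) lquot_opp lquot_add.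
Proof. by elim/lquot_ind=> u; rewrite lquot_oppE lquot_addE addNr. Qed.

HB.instance Definition _ :=
  GRing.isZmodule.Build lquot lquot_addA lquot_addC lquot_add0 lquot_addN.

Lemma lquot_piD u v : lquot_pi (u + v) = lquot_pi u + lquot_pi v.
Proof. by rewrite -lquot_addE. Qed.

Lemma lquot_scaleA a b x : lquot_scale a (lquot_scale b x) = lquot_scale (a * b) x.
Proof. by elim/lquot_ind: x => u; rewrite !lquot_scaleE scalerA. Qed.
Lemma lquot_scale1 : left_id 1 lquot_scale.
Proof. by elim/lquot_ind=> u; rewrite lquot_scaleE scale1r. Qed.
Lemma lquot_scaleDr : right_distributive lquot_scale +%R.
Proof.
move=> a; elim/lquot_ind=> u; elim/lquot_ind=> v.
by rewrite -lquot_piD !lquot_scaleE -lquot_piD scalerDr.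
Qed.
Lemma lquot_scaleDl x : {morph lquot_scale^~ x : a b / a + b}.
Proof.
by elim/lquot_ind: x => u a b; rewrite !lquot_scaleE -lquot_piD scalerDl.
Qed.

HB.instance Definition _ := GRing.Zmodule_isLmodule.Build k lquot
  lquot_scaleA lquot_scale1 lquot_scaleDr lquot_scaleDl.

Lemma lquot_pi_linear : linear lquot_pi.
Proof. by move=> a u v; rewrite lquot_piD -lquot_scaleE. Qed.

End LmodQuotient.

Definition hom_rel (k : fieldType) (C : lincat k) : Type :=
  forall x y : C, hom x y -> hom x y -> Prop.

Section QuotientCategory.
Variables (k : fieldType) (C : lincat k) (R : hom_rel C).

Inductive cong_gen : forall x y : C, hom x y -> hom x y -> Prop :=
| cong_of x y (f g : hom x y) : R f g -> cong_gen f g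
| cong_refl x y (f : hom x y) : cong_gen f f
| cong_sym x y (f g : hom x y) : cong_gen f g -> cong_gen g f
| cong_trans x y (f g h : hom x y) :
    cong_gen f g -> cong_gen g h -> cong_gen f h
| congD x y (f f' g g' : hom x y) :
    cong_gen f f' -> cong_gen g g' -> cong_gen (f + g) (f' + g')
| congZ x y a (f f' : hom x y) : cong_gen f f' -> cong_gen (a *: f) (a *: f')
| congM x y z (g g' : hom y z) (f f' : hom x y) :
    cong_gen g g' -> cong_gen f f' -> cong_gen (g \oc f) (g' \oc f').

Lemma cong_gen_lincong x y : lincong (@cong_gen x y).
Proof.
split; [exact: cong_refl|exact: cong_sym|exact: cong_trans|exact: congD|].
exact: congZ.
Qed.

Definition quot_hom (x y : C) : lmodType k := lquot (cong_gen_lincong x y).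

Definition to_quot (x y : C) (f : hom x y) : quot_hom x y := lquot_pi _ f.
Arguments to_quot {x y} f.

Definition quot_comp (x y z : C) (g : quot_hom y z) (f : quot_hom x y) :
  quot_hom x z := to_quot (repr g \oc repr f).

Lemma quot_compE x y z (g : hom y z) (f : hom x y) :
  quot_comp (to_quot g) (to_quot f) = to_quot (g \oc f).
Proof. by apply/lquot_eqP; apply: congM; apply: lquot_repr. Qed.

Lemma to_quot_linear x y : linear (@to_quot x y).
Proof. exact: lquot_pi_linear. Qed.

Lemma to_quot_ind x y (P : quot_hom x y -> Prop) :
  (forall f, P (to_quot f)) -> forall f, P f.
Proof. exact: lquot_ind. Qed.

Lemma quot_comp_linear_l x y z (f : quot_hom x y) :
  linear (fun g : quot_hom y z => quot_comp g f).
Proof.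
elim/to_quot_ind: f => f a; elim/to_quot_ind => g; elim/to_quot_ind => h.
by rewrite -to_quot_linear !quot_compE -to_quot_linear comp_linear_l.
Qed.

Lemma quot_comp_linear_r x y z (g : quot_hom y z) :
  linear (fun f : quot_hom x y => quot_comp g f).
Proof.
elim/to_quot_ind: g => g a; elim/to_quot_ind => f; elim/to_quot_ind => h.
by rewrite -to_quot_linear !quot_compE -to_quot_linear comp_linear_r.
Qed.

Lemma quot_compA x y z t
    (h : quot_hom z t) (g : quot_hom y z) (f : quot_hom x y) :
  quot_comp h (quot_comp g f) = quot_comp (quot_comp h g) f.
Proof.
elim/to_quot_ind: h => h; elim/to_quot_ind: g => g; elim/to_quot_ind: f => f.
by rewrite !quot_compE compA.
Qed.

Lemma quot_comp1m x y (f : quot_hom x y) : quot_comp (to_quot (idm y)) f = f.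
Proof. by elim/to_quot_ind: f => f; rewrite quot_compE comp1m. Qed.

Lemma quot_compm1 x y (f : quot_hom x y) : quot_comp f (to_quot (idm x)) = f.
Proof. by elim/to_quot_ind: f => f; rewrite quot_compE compm1. Qed.

Definition quot_cat : lincat k :=
  @LinCat k C quot_hom (fun x => to_quot (idm x)) quot_comp
    quot_comp_linear_l quot_comp_linear_r quot_compA quot_comp1m quot_compm1.

End QuotientCategory.

Definition modhom (k : fieldType) (A : algType k) (M N : lmodType A) : Type :=
  {linear M -> N}.

Section ModuleHom.
Variables (k : fieldType) (A : algType k).

Section Hom.
Variables M N : lmodType A.
Local Notation H := (modhom M N).
Implicit Types f g h : H.

HB.instance Definition _ := gen_eqMixin H.
HB.instance Definition _ := gen_choiceMixin H.

Definition modhom_fun (f : H) : M -> N := (f : {linear M -> N}).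

Lemma modhom_ext f g : modhom_fun f =1 modhom_fun g -> f = g.
Proof.
case: f => f [[cf] [lf]]; case: g => g [[cg] [lg]] /= /funext fg.
move: cf lf cg lg; rewrite /modhom_fun /= in fg; rewrite {}fg => cf lf cg lg.
by rewrite (Prop_irrelevance cf cg) (Prop_irrelevance lf lg).
Qed.

Definition mk_modhom (f : M -> N) (lf : linear f) : H :=
  HB.pack_for {linear M -> N} f (GRing.isLinear.Build A M N *:%R f lf).

Lemma mk_modhomE (f : M -> N) (lf : linear f) :
  modhom_fun (mk_modhom lf) = f.
Proof. by []. Qed.

Lemma modhom_linear f : linear (modhom_fun f).
Proof. exact: (@linearP A M N *:%R (f : {linear M -> N})). Qed.

Let mhD f u v : modhom_fun f (u + v) = modhom_fun f u + modhom_fun f v.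
Proof. exact: (raddfD (f : {linear M -> N})). Qed.
Let mhZ f a u : modhom_fun f (a *: u) = a *: modhom_fun f u.
Proof. exact: (linearZ_LR (f : {linear M -> N})). Qed.

Lemma modhom0_subproof : linear (fun _ : M => 0 : N).
Proof. by move=> a u v; rewrite scaler0 addr0. Qed.

Lemma modhomN_subproof f : linear (fun m => - modhom_fun f m).
Proof. by move=> a u v; rewrite mhD mhZ opprD scalerN. Qed.

Lemma modhomD_subproof f g : linear (fun m => modhom_fun f m + modhom_fun g m).
Proof. by move=> a u v; rewrite !mhD !mhZ scalerDr addrACA. Qed.

(* A scalar [c : k] acts on an [A]-module through [c%:A], which is central. *)
Lemma modhomZ_subproof (c : k) f : linear (fun m => c%:A *: modhom_fun f m).
Proof.
move=> a u v; rewrite mhD mhZ scalerDr !scalerA.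
by rewrite -scalerAl mul1r -[in RHS]scalerAr mulr1.
Qed.

Definition modhom0 : H := mk_modhom modhom0_subproof.
Definition modhomN f : H := mk_modhom (modhomN_subproof f).
Definition modhomD f g : H := mk_modhom (modhomD_subproof f g).
Definition modhomZ c f : H := mk_modhom (modhomZ_subproof c f).

Let modhomZ_fun c f m : modhom_fun (modhomZ c f) m = c%:A *: modhom_fun f m.
Proof. by []. Qed.

Lemma modhomDA : associative modhomD.
Proof. by move=> f g h; apply: modhom_ext => m; apply: addrA. Qed.
Lemma modhomDC : commutative modhomD.
Proof. by move=> f g; apply: modhom_ext => m; apply: addrC. Qed.
Lemma modhom0D : left_id modhom0 modhomD.
Proof. by move=> f; apply: modhom_ext => m; apply: add0r. Qed.
Lemma modhomND : left_inverse modhom0 modhomN modhomD.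
Proof. by move=> f; apply: modhom_ext => m; apply: addNr. Qed.

HB.instance Definition _ :=
  GRing.isZmodule.Build H modhomDA modhomDC modhom0D modhomND.

Lemma modhomZA a b f : modhomZ a (modhomZ b f) = modhomZ (a * b) f.
Proof.
by apply: modhom_ext => m; rewrite !modhomZ_fun scalerA -scalerAl mul1r scalerA.
Qed.
Lemma modhomZ1 : left_id 1 modhomZ.
Proof. by move=> f; apply: modhom_ext => m; rewrite modhomZ_fun !scale1r. Qed.
Lemma modhomZDr : right_distributive modhomZ +%R.
Proof. by move=> a f g; apply: modhom_ext => m; apply: scalerDr. Qed.
Lemma modhomZDl f : {morph modhomZ^~ f : a b / a + b}.
Proof.
move=> a b; apply: modhom_ext => m; rewrite modhomZ_fun scalerDl.
exact: scalerDl.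
Qed.

HB.instance Definition _ :=
  GRing.Zmodule_isLmodule.Build k H modhomZA modhomZ1 modhomZDr modhomZDl.

Lemma modhomDE f g m : modhom_fun (f + g) m = modhom_fun f m + modhom_fun g m.
Proof. by []. Qed.
Lemma modhomZE (c : k) f m : modhom_fun (c *: f) m = c%:A *: modhom_fun f m.
Proof. by []. Qed.

End Hom.

Lemma modhom1_subproof (M : lmodType A) : linear (fun m : M => m).
Proof. by []. Qed.

Lemma modhomM_subproof (M N P : lmodType A) (g : modhom N P) (f : modhom M N) :
  linear (fun m => modhom_fun g (modhom_fun f m)).
Proof. by move=> a u v; rewrite !modhom_linear. Qed.

Definition modhom1 (M : lmodType A) : modhom M M :=
  mk_modhom (@modhom1_subproof M).
Definition modhom_comp (M N P : lmodType A) (g : modhom N P) (f : modhom M N) :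
  modhom M P := mk_modhom (modhomM_subproof g f).

Lemma modhom_comp_linear_l M N P (f : modhom M N) :
  linear (fun g : modhom N P => modhom_comp g f).
Proof. by move=> a g h; apply: modhom_ext. Qed.

Lemma modhom_comp_linear_r M N P (g : modhom N P) :
  linear (fun f : modhom M N => modhom_comp g f).
Proof.
move=> a f h; apply: modhom_ext => m; rewrite modhomDE modhomZE /=.
exact: (modhom_linear g).
Qed.

Lemma modhom_compA M N P Q
    (h : modhom P Q) (g : modhom N P) (f : modhom M N) :
  modhom_comp h (modhom_comp g f) = modhom_comp (modhom_comp h g) f.
Proof. exact: modhom_ext. Qed.
Lemma modhom_comp1m M N (f : modhom M N) : modhom_comp (modhom1 N) f = f.
Proof. exact: modhom_ext. Qed.
Lemma modhom_compm1 M N (f : modhom M N) : modhom_comp f (modhom1 M) = f.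
Proof. exact: modhom_ext. Qed.

Definition module_cat : lincat k :=
  @LinCat k (lmodType A) (fun M N => modhom M N : lmodType k) modhom1 modhom_comp
    modhom_comp_linear_l modhom_comp_linear_r
    modhom_compA modhom_comp1m modhom_compm1.

End ModuleHom.

(* [k]-linear equivalence of the categories of left modules. *)
Definition morita_equivalent (k : fieldType) (A B : algType k) : Prop :=
  lincat_equiv (module_cat A) (module_cat B).

Section Radical.
Variables (k : fieldType) (A : falgType k).
Implicit Types L J : {vspace A}.

(* Left ideals of the ring [A] are automatically [k]-subspaces. *)
Definition left_ideal L : Prop := (fullv * L <= L)%VS.

Definition maximal_left_ideal L : Prop :=
  [/\ left_ideal L, L <> fullv &
      forall L', left_ideal L' -> (L <= L')%VS -> L' = L \/ L' = fullv].

Lemma radical_exists : exists J : {vspace A},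
  forall x, x \in J <-> (forall L, maximal_left_ideal L -> x \in L).
Proof.
suff H n J : (\dim J < n)%N ->
    (forall x, (forall L, maximal_left_ideal L -> x \in L) -> x \in J) ->
  exists J : {vspace A},
    forall x, x \in J <-> (forall L, maximal_left_ideal L -> x \in L).
  by apply: (H (\dim {:A}).+1 fullv) => // x _; rewrite memvf.
elim: n J => // n IHn J; rewrite ltnS => leJ capJ.
have [sJ|] := EM (forall L, maximal_left_ideal L -> (J <= L)%VS).
  exists J => x; split=> [xJ L /sJ/subvP|]; [exact | exact: capJ].
move=> /existsNP[L /not_implyP[mL nJL]]; apply: (IHn (J :&: L)%VS).
  apply: leq_trans leJ; rewrite ltnNge; apply: contra_notN nJL => leJL.
  have /eqP <- : (J :&: L == J)%VS by rewrite eqEdim capvSl.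
  exact: capvSr.
by move=> x xL; rewrite memv_cap capJ //=; apply: xL.
Qed.

(* The Jacobson radical, characterised by [RadP]. *)
Definition Rad : {vspace A} := projT1 (cid radical_exists).

Lemma RadP x : x \in Rad <-> (forall L, maximal_left_ideal L -> x \in L).
Proof. exact: (projT2 (cid radical_exists)). Qed.

(* [A / Rad A] is isomorphic to [k ^ m], the isomorphism being given as a
   surjective algebra morphism with kernel [Rad A]. *)
Definition split_basic : Prop :=
  exists (m : nat) (p : {lrmorphism A -> {ffun 'I_m -> k^o}}),
    (forall y, exists x, p x = y) /\ (forall x, p x = 0 <-> x \in Rad).

Definition idempotent (x : A) : Prop := x * x = x.

Definition primitive_idempotent (x : A) : Prop :=
  [/\ idempotent x, x <> 0 &
      forall a b, idempotent a -> idempotent b -> a * b = 0 -> b * a = 0 ->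
        x = a + b -> a = 0 \/ b = 0].

Record complete_idempotents (V : finType) (e : V -> A) : Prop := {
  compl_primitive : forall i, primitive_idempotent (e i);
  compl_orthogonal : forall i j, i != j -> e i * e j = 0;
  compl_sum : \sum_i e i = 1
}.

Definition corner (x y : A) : {vspace A} := (<[x]> * {:A} * <[y]>)%VS.

Lemma cornerP x y a : reflect (exists b, a = x * b * y) (a \in corner x y).
Proof.
apply: (iffP idP) => [|[b ->]]; last by rewrite !memv_mul ?memv_line ?memvf.
have sub : (corner x y <= limg (amulr y \o amull x))%VS.
  apply/prodvP => u v xu /vlineP[c ->].
  have sub1 : (<[x]> * {:A} <= limg (amull x))%VS.
    apply/prodvP => p q /vlineP[d ->] _; apply/memv_imgP; exists (d *: q); rewrite ?memvf //.
    by rewrite lfunE /= -scalerAl scalerAr.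
  have /memv_imgP[b _ ->] := subvP sub1 _ xu.
  apply/memv_imgP; exists (c *: b); rewrite ?memvf //.
  by rewrite comp_lfunE !lfunE /= -!scalerAr -scalerAl.
move=> /(subvP sub)/memv_imgP[b _ ->]; exists b.
by rewrite comp_lfunE !lfunE.
Qed.

Lemma corner_mul x y z a b :
  a \in corner x y -> b \in corner y z -> a * b \in corner x z.
Proof.
move=> /cornerP[a' ->] /cornerP[b' ->]; apply/cornerP.
by exists (a' * y * (y * b')); rewrite !mulrA.
Qed.

End Radical.

Section IdempotentCategory.
Variables (k : fieldType) (A : falgType k) (V : finType) (e : V -> A).
Hypothesis ce : complete_idempotents e.

(* The hom-set from [e i] to [e j] is [e j A e i]; objects are represented by
   the indices of the (pairwise distinct) idempotents. *)
Definition idem_hom (i j : V) : lmodType k := subvs_of (corner (e j) (e i)).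

Definition idem_comp (i j l : V) (g : idem_hom j l) (f : idem_hom i j) :
  idem_hom i l := Subvs (corner_mul (subvsP g) (subvsP f)).

Lemma idem_id_subproof i : e i \in corner (e i) (e i).
Proof.
have [ei _ _] := compl_primitive ce i.
by apply/cornerP; exists 1; rewrite mulr1 ei.
Qed.

Definition idem_id (i : V) : idem_hom i i := Subvs (idem_id_subproof i).

Lemma idem_comp_linear_l i j l (f : idem_hom i j) :
  linear (fun g : idem_hom j l => idem_comp g f).
Proof. by move=> a g h; apply: val_inj; rewrite /= mulrDl scalerAl. Qed.

Lemma idem_comp_linear_r i j l (g : idem_hom j l) :
  linear (fun f : idem_hom i j => idem_comp g f).
Proof. by move=> a f h; apply: val_inj; rewrite /= mulrDr scalerAr. Qed.

Lemma idem_compA i j l m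
    (h : idem_hom l m) (g : idem_hom j l) (f : idem_hom i j) :
  idem_comp h (idem_comp g f) = idem_comp (idem_comp h g) f.
Proof. by apply: val_inj; rewrite /= mulrA. Qed.

Lemma idem_comp1m i j (f : idem_hom i j) : idem_comp (idem_id j) f = f.
Proof.
apply: val_inj => /=; have /cornerP[b ->] := subvsP f.
by have [ej _ _] := compl_primitive ce j; rewrite !mulrA ej.
Qed.

Lemma idem_compm1 i j (f : idem_hom i j) : idem_comp f (idem_id i) = f.
Proof.
apply: val_inj => /=; have /cornerP[b ->] := subvsP f.
by have [ei _ _] := compl_primitive ce i; rewrite -!mulrA ei.
Qed.

Definition idem_cat : lincat k :=
  @LinCat k V idem_hom idem_id idem_comp idem_comp_linear_l idem_comp_linear_r
    idem_compA idem_comp1m idem_compm1.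

End IdempotentCategory.

Record quiver := Quiver {
  vertex :> finType;
  arrow : finType;
  src : arrow -> vertex;
  tgt : arrow -> vertex
}.
Arguments src {q} a.
Arguments tgt {q} a.

(* Arrows are listed in the order in which they are traversed, so the list of a
   composite [q \oc p] is [p ++ q]. *)
Fixpoint walk (Q : quiver) (x : Q) (p : seq (arrow Q)) (y : Q) : bool :=
  if p is a :: p' then (src a == x) && walk (tgt a) p' y else x == y.

Record qpath (Q : quiver) (x y : Q) :=
  QPath { qpath_seq :> seq (arrow Q); qpathP : walk x qpath_seq y }.
HB.instance Definition _ (Q : quiver) (x y : Q) :=
  [isSub for @qpath_seq Q x y].
HB.instance Definition _ (Q : quiver) (x y : Q) :=
  [Choice of qpath x y by <:].

Section Paths.
Variable Q : quiver.

Lemma walk_cat (x y z : Q) p q : walk x p y -> walk y q z -> walk x (p ++ q) z.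
Proof.
elim: p x => [|a p IHp] x /=; first by move=> /eqP ->.
by move=> /andP[-> wp] wq /=; apply: IHp.
Qed.

Definition qpath_id (x : Q) : qpath x x :=
  @QPath Q x x [::] (eqxx x).

Definition qpath_comp (x y z : Q) (q : qpath y z) (p : qpath x y) : qpath x z :=
  QPath (walk_cat (qpathP p) (qpathP q)).

Lemma qpath_arrow_subproof (x y : Q) a :
  src a = x -> tgt a = y -> walk x [:: a] y.
Proof. by move=> <- <- /=; rewrite !eqxx. Qed.

Definition qpath_arrow (x y : Q) (a : arrow Q) (ax : src a = x) (ay : tgt a = y) :
  qpath x y := QPath (qpath_arrow_subproof ax ay).
End Paths.

Section LinearExtension.
Variables (k : fieldType) (K : choiceType) (V : lmodType k) (h : K -> V).
Implicit Types u v : {malg k[K]}.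

Definition lin_ext u : V := \sum_(p <- msupp u) u@_p *: h p.

Lemma lin_extEw u (d : {fset K}) :
  {subset msupp u <= d} -> lin_ext u = \sum_(p <- d) u@_p *: h p.
Proof.
move=> ud; rewrite /lin_ext.
have sud : (msupp u `<=` d)%fset by apply/fsubsetP.
rewrite (big_fset_incl _ sud) // => p _ pu.
by rewrite mcoeff_outdom ?scale0r.
Qed.

Lemma lin_ext_linear : linear lin_ext.
Proof.
move=> a u v; pose d := (msupp (a *: u + v) `|` msupp u `|` msupp v)%fset.
rewrite !(@lin_extEw _ d); try by move=> p pd; rewrite !inE pd ?orbT.
rewrite scaler_sumr -big_split; apply: eq_bigr => p _ /=.
by rewrite mcoeffD mcoeffZ scalerDl scalerA.
Qed.

Lemma lin_ext_unit p : lin_ext << p >> = h p.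
Proof.
rewrite (@lin_extEw _ [fset p]%fset) ?big_seq_fset1 ?mcoeffUU ?scale1r //.
by move=> q; rewrite msuppU oner_eq0.
Qed.

End LinearExtension.

Lemma malg_lin_ind (k : fieldType) (K : choiceType) (V : lmodType k)
    (f g : {malg k[K]} -> V) :
  linear f -> linear g -> (forall p, f << p >> = g << p >>) -> f =1 g.
Proof.
move=> lf lg fg u.
have f0 : f 0 = 0 by have := lf (-1) 0 0; rewrite scaler0 addr0 scaleN1r addNr.
have g0 : g 0 = 0 by have := lg (-1) 0 0; rewrite scaler0 addr0 scaleN1r addNr.
have ZU : forall p (c : k), << c *g p >> = c *: (<< p >> : {malg k[K]}).
  by move=> p c; apply/malgP => q; rewrite mcoeffZ !mcoeffU mulrnAr mulr1.
rewrite [u]monalgE; elim: (msupp u : seq K) => [|p s IHs].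
  by rewrite big_nil f0 g0.
by rewrite big_cons ZU lf lg IHs fg.
Qed.

Section FreeCategory.
Variables (k : fieldType) (Q : quiver).

Definition free_hom (x y : Q) : lmodType k := {malg k[qpath x y]}.

Definition path_hom (x y : Q) (p : qpath x y) : free_hom x y := << p >>.

Definition free_comp (x y z : Q) (g : free_hom y z) (f : free_hom x y) :
  free_hom x z := lin_ext (fun q => lin_ext (fun p => path_hom (qpath_comp q p)) f) g.

Lemma free_comp_path x y z (q : qpath y z) (p : qpath x y) :
  free_comp (path_hom q) (path_hom p) = path_hom (qpath_comp q p).
Proof. by rewrite /free_comp !lin_ext_unit. Qed.

Lemma free_comp_linear_l x y z (f : free_hom x y) :
  linear (fun g : free_hom y z => free_comp g f).
Proof. exact: lin_ext_linear. Qed.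

Lemma free_comp_linear_r x y z (g : free_hom y z) :
  linear (fun f : free_hom x y => free_comp g f).
Proof.
move=> a f f'; rewrite /free_comp /lin_ext scaler_sumr -big_split.
apply: eq_bigr => q _; rewrite /= -!/(lin_ext _ _) lin_ext_linear scalerDr.
by rewrite !scalerA mulrC.
Qed.

Lemma free_compA x y z t
    (h : free_hom z t) (g : free_hom y z) (f : free_hom x y) :
  free_comp h (free_comp g f) = free_comp (free_comp h g) f.
Proof.
apply: (@malg_lin_ind k _ _ (fun h => free_comp h (free_comp g f))
  (fun h => free_comp (free_comp h g) f)) => [||r].
- exact: free_comp_linear_l.
- by move=> a u v; rewrite !free_comp_linear_l.
apply: (@malg_lin_ind k _ _ (fun g => free_comp << r >> (free_comp g f))
  (fun g => free_comp (free_comp << r >> g) f)) => [||q].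
- by move=> a u v; rewrite free_comp_linear_l free_comp_linear_r.
- by move=> a u v; rewrite free_comp_linear_r free_comp_linear_l.
apply: (@malg_lin_ind k _ _ (fun f => free_comp << r >> (free_comp << q >> f))
  (fun f => free_comp (free_comp << r >> << q >>) f)) => [||p].
- by move=> a u v; rewrite !free_comp_linear_r.
- by move=> a u v; rewrite !free_comp_linear_r.
rewrite -!/(path_hom _) !free_comp_path; congr path_hom.
by apply: val_inj; rewrite /= catA.
Qed.

Lemma free_comp1m x y (f : free_hom x y) :
  free_comp (path_hom (qpath_id y)) f = f.
Proof.
apply: (@malg_lin_ind k _ _ (fun f => free_comp (path_hom (qpath_id y)) f) id)
  => [||p].
- exact: free_comp_linear_r.
- by [].
rewrite -/(path_hom _) free_comp_path; congr path_hom.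
by apply: val_inj; rewrite /= cats0.
Qed.

Lemma free_compm1 x y (f : free_hom x y) :
  free_comp f (path_hom (qpath_id x)) = f.
Proof.
apply: (@malg_lin_ind k _ _ (fun f => free_comp f (path_hom (qpath_id x))) id)
  => [||p].
- exact: free_comp_linear_l.
- by [].
by rewrite -/(path_hom _) free_comp_path; congr path_hom; apply: val_inj.
Qed.

Definition free_cat : lincat k :=
  @LinCat k Q free_hom (fun x => path_hom (qpath_id x)) free_comp
    free_comp_linear_l free_comp_linear_r free_compA free_comp1m free_compm1.

Variant consecutive_zero : forall x y : free_cat, hom x y -> hom x y -> Prop :=
| ConsecutiveZero (x y z : Q) (a b : arrow Q)
    (ax : src a = x) (ay : tgt a = y) (yb : src b = y) (bz : tgt b = z) :
    @consecutive_zero x z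
      (free_comp (path_hom (qpath_arrow yb bz)) (path_hom (qpath_arrow ax ay)))
      0.

End FreeCategory.

Definition line_quiver (m : nat) : quiver :=
  @Quiver 'I_m {u : 'I_m * 'I_m | u.2 == u.1.+1 :> nat}
    (fun u => (val u).1) (fun u => (val u).2).

Definition quiver_sum (Q Q' : quiver) : quiver :=
  @Quiver (Q + Q')%type (arrow Q + arrow Q')%type
    (fun a => match a with inl b => inl (src b) | inr b => inr (src b) end)
    (fun a => match a with inl b => inl (tgt b) | inr b => inr (tgt b) end).

Section QuiverOfAlgebra.
Variable k : fieldType.

(* The vertices are in bijection with the idempotents through [e].
   Inside [B / Rad^2 B], the subspace
   (e_j + Rad^2 B) (Rad B / Rad^2 B) (e_i + Rad^2 B) is the image of
   e_j (Rad B) e_i, that is (e_j (Rad B) e_i + Rad^2 B) / Rad^2 B. *)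
Definition quiver_wrt (B : falgType k) (Q : quiver) (e : Q -> B) : Prop :=
  forall i j : Q,
    #|[pred a : arrow Q | (src a == i) && (tgt a == j)]| =
    (\dim (<[e j]> * Rad B * <[e i]> + Rad B ^+ 2)%VS
     - \dim (Rad B ^+ 2)%VS)%N.

Definition is_quiver_of (A : falgType k) (Q : quiver) : Prop :=
  exists B : falgType k,
    [/\ split_basic B, morita_equivalent A B &
        exists e : Q -> B, complete_idempotents e /\ quiver_wrt e].

Definition is_presentation_of (A : falgType k) (Q : quiver)
    (R : hom_rel (free_cat k Q)) : Prop :=
  exists B : falgType k,
    [/\ split_basic B, morita_equivalent A B &
        exists (e : Q -> B) (ce : complete_idempotents e),
          quiver_wrt e /\ lincat_iso (quot_cat R) (idem_cat ce)].

End QuiverOfAlgebra.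

(* Main.v *)
Require Import Defs.
From HB Require Import structures.
From mathcomp Require Import all_boot all_order all_algebra all_field.
From mathcomp Require Import boolp finmap zify.
From mathcomp.multinomials Require Import monalg.

(** Let [A] be the monoid algebra of [COD n] and [B] the path algebra of two disjoint
    lines with [n] vertices, modulo all paths of length two.  The algebra [B] is split
    basic, its vertices give a complete set of primitive orthogonal idempotents,
    and both the quiver and the presentation can be read off from it
    ([sqzero_quiver_wrt], [sqzero_presentation]); this holds for every finite quiver
    with a vertex.  The theorem thus says that [A] and [B] are Morita equivalent.

    For order-preserving maps this is the Dold-Kan correspondence, and the proof below
    is a matrix form of it.  An element [m] of the monoid acts contravariantly on
    the [n.+1] gaps [0, ..., n] around the [n] points ([pull]).  This action preserves
    the pair of outer gaps [0] and [n].  Let [m] send a set of gaps to its image,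
    or to zero if it is not injective on that set.  For sets [P], [Q] of inner gaps, an
    entry at [(P, Q)] then makes sense in two cases.  If [#|P| = #|Q|], it records
    whether [P] is mapped to [Q].  If [#|P| = #|Q|.+1], it records whether [P] is mapped
    to [Q] together with one of the two outer gaps, counted with suitable signs.  Since
    outer gaps go to outer gaps, the entries of a product are given by the
    multiplication rule of [B] ([entryM]): entries of the first kind are coefficients at
    vertices, those of the second kind are coefficients at arrows, and a set with [d]
    elements belongs to the vertex [d] of a line.  The sign of a reversing map may be
    read through either character of the group of signs, which gives the two lines.

    So [A] is mapped to a corner of a matrix algebra over [B] ([mat_hom]).  This map
    is bijective onto the corner.  Surjectivity is explicit: an alternating sum over
    the vertices of a cube of order-preserving maps is a matrix unit, up to units at
    arrows, or twice a unit at an arrow ([hypercubeE], [hypercube_ord0E]); multiplying by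
    the reversal separates the two lines.  Both steps divide by [2].  Injectivity
    follows because [COD n] has at most as many elements as there are matrix units
    ([code_inj]).  The corner is full, as every vertex occurs on its diagonal, and an
    algebra isomorphic to a full corner of a matrix algebra over [B] is Morita
    equivalent to [B] ([morita_full_corner]). *)

Set Implicit Arguments.
Unset Strict Implicit.
Unset Printing Implicit Defensive.

Import GRing.Theory.
Local Open Scope ring_scope.
Local Notation hom := Defs.hom.

(** * The radical square zero algebra of a quiver *)

(** The path algebra of [Q] modulo the paths of length two.  The first component
    holds the coefficients at the trivial paths, the second those at the arrows.
    The vertex [x0] witnesses [1 <> 0]; it is a parameter of the type so that
    the ring structure can be inferred. *)
Definition sqzero_alg (k : fieldType) (Q : quiver) (x0 : Q) : Type :=
  ({ffun Q -> k^o} * {ffun arrow Q -> k^o})%type.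

Section SquareZeroAlgebra.
Variables (k : fieldType) (Q : quiver) (x0 : Q).
Local Notation B := (sqzero_alg k x0).
Implicit Types f g h : B.

HB.instance Definition _ := Vector.copy B
  ({ffun Q -> k^o} * {ffun arrow Q -> k^o})%type.

Lemma sqzeroP f g : f.1 =1 g.1 -> f.2 =1 g.2 -> f = g.
Proof.
by case: f g => [f f'] [g g'] /= fg fg'; congr pair; apply/ffunP.
Qed.

Lemma sqzeroD1 f g v : (f + g).1 v = f.1 v + g.1 v.
Proof. by rewrite ffunE. Qed.
Lemma sqzeroD2 f g a : (f + g).2 a = f.2 a + g.2 a.
Proof. by rewrite ffunE. Qed.
Lemma sqzeroZ1 (c : k) f v : (c *: f).1 v = c * f.1 v.
Proof. by rewrite ffunE. Qed.
Lemma sqzeroZ2 (c : k) f a : (c *: f).2 a = c * f.2 a.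
Proof. by rewrite ffunE. Qed.
Lemma sqzero01 v : (0 : B).1 v = 0.
Proof. by rewrite ffunE. Qed.
Lemma sqzero02 a : (0 : B).2 a = 0.
Proof. by rewrite ffunE. Qed.

Definition sqzero_one : B := ([ffun=> 1], 0).
Definition sqzero_mul f g : B :=
  ([ffun v => f.1 v * g.1 v],
   [ffun a => f.1 (tgt a) * g.2 a + f.2 a * g.1 (src a)]).

Lemma sqzero_mulA : associative sqzero_mul.
Proof.
move=> f g h; apply: sqzeroP => i; rewrite !ffunE ?mulrA //.
by rewrite mulrDr mulrDl !mulrA addrA.
Qed.
Lemma sqzero_mul1 : left_id sqzero_one sqzero_mul.
Proof. by move=> f; apply: sqzeroP => i; rewrite !ffunE ?mul1r // mul0r addr0. Qed.
Lemma sqzero_mulr1 : right_id sqzero_one sqzero_mul.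
Proof. by move=> f; apply: sqzeroP => i; rewrite !ffunE ?mulr1 // mulr0 add0r. Qed.
Lemma sqzero_mulDl : left_distributive sqzero_mul +%R.
Proof.
move=> f g h; apply: sqzeroP => i; rewrite !ffunE mulrDl //.
by rewrite mulrDl addrACA.
Qed.
Lemma sqzero_mulDr : right_distributive sqzero_mul +%R.
Proof.
move=> f g h; apply: sqzeroP => i; rewrite !ffunE mulrDr //.
by rewrite mulrDr addrACA.
Qed.
Lemma sqzero_one_neq0 : sqzero_one != 0.
Proof. by apply/eqP=> -[] /ffunP/(_ x0)/eqP; rewrite !ffunE oner_eq0. Qed.

HB.instance Definition _ := GRing.Zmodule_isNzRing.Build B sqzero_mulA
  sqzero_mul1 sqzero_mulr1 sqzero_mulDl sqzero_mulDr sqzero_one_neq0.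

Lemma sqzeroM1 f g v : (f * g).1 v = f.1 v * g.1 v.
Proof. by rewrite ffunE. Qed.
Lemma sqzeroM2 f g a : (f * g).2 a = f.1 (tgt a) * g.2 a + f.2 a * g.1 (src a).
Proof. by rewrite ffunE. Qed.
Lemma sqzero11 v : (1 : B).1 v = 1.
Proof. by rewrite ffunE. Qed.
Lemma sqzero12 a : (1 : B).2 a = 0.
Proof. by rewrite ffunE. Qed.

Lemma sqzero_scaleAl (c : k) f g : c *: (f * g) = (c *: f) * g.
Proof.
apply: sqzeroP => i; rewrite ?(sqzeroM1, sqzeroM2, sqzeroZ1, sqzeroZ2) ?mulrA //.
by rewrite mulrDr !mulrA.
Qed.

HB.instance Definition _ := GRing.Lmodule_isLalgebra.Build k B sqzero_scaleAl.

Lemma sqzero_scaleAr (c : k) f g : c *: (f * g) = f * (c *: g).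
Proof.
apply: sqzeroP => i; rewrite ?(sqzeroM1, sqzeroM2, sqzeroZ1, sqzeroZ2).
  by rewrite mulrCA.
by rewrite mulrDr mulrCA; congr (_ + _); rewrite mulrCA.
Qed.

HB.instance Definition _ := GRing.Lalgebra_isAlgebra.Build k B sqzero_scaleAr.
HB.instance Definition _ := Algebra_isFalgebra.Build k B.

Lemma sqzero_sum1 (I : Type) (r : seq I) (P : pred I) (F : I -> B) v :
  (\sum_(i <- r | P i) F i).1 v = \sum_(i <- r | P i) (F i).1 v.
Proof.
by apply: (big_morph (fun f : B => f.1 v)) => [f g|]; rewrite ?sqzeroD1 ?sqzero01.
Qed.
Lemma sqzero_sum2 (I : Type) (r : seq I) (P : pred I) (F : I -> B) a :
  (\sum_(i <- r | P i) F i).2 a = \sum_(i <- r | P i) (F i).2 a.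
Proof.
by apply: (big_morph (fun f : B => f.2 a)) => [f g|]; rewrite ?sqzeroD2 ?sqzero02.
Qed.

Definition sqzeroE := (sqzeroM1, sqzeroM2, sqzeroZ1, sqzeroZ2, sqzeroD1, sqzeroD2,
  sqzero01, sqzero02, sqzero11, sqzero12, sqzero_sum1, sqzero_sum2).

Lemma rad_square_zero f g : f.1 = 0 -> g.1 = 0 -> f * g = 0.
Proof.
by move=> f0 g0; apply: sqzeroP => i; rewrite !sqzeroE f0 g0 !ffunE ?mul0r ?mulr0 ?addr0.
Qed.

Lemma left_idealP (A : falgType k) (L : {vspace A}) x y :
  left_ideal L -> y \in L -> x * y \in L.
Proof. by move=> /subvP lL yL; apply: lL; rewrite memv_mul // memvf. Qed.

Fact vertex_coord_linear v : linear (fun f : B => f.1 v : k^o).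
Proof. by move=> c f g; rewrite !sqzeroE. Qed.
Definition vertex_coord v : {linear B -> k^o} :=
  HB.pack (fun f : B => f.1 v : k^o)
    (GRing.isLinear.Build k B k^o *:%R _ (vertex_coord_linear v)).
Definition vertex_ideal v : {vspace B} := lker (linfun (vertex_coord v)).

Lemma mem_vertex_ideal v f : (f \in vertex_ideal v) = (f.1 v == 0).
Proof. by rewrite memv_ker lfunE. Qed.

Lemma vertex_ideal_maximal v : maximal_left_ideal (vertex_ideal v).
Proof.
split.
- apply/prodvP => f g _; rewrite !mem_vertex_ideal sqzeroM1 => /eqP ->.
  by rewrite mulr0.
- move=> /vspaceP/(_ 1); rewrite memvf mem_vertex_ideal sqzero11.
  by rewrite oner_eq0.
move=> L lL sL; have [LL|/subvPn[f fL]] := boolP (L <= vertex_ideal v)%VS.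
  by left; apply/eqP; rewrite eqEsubv LL.
rewrite mem_vertex_ideal => fv; right; apply/vspaceP => g; rewrite memvf.
rewrite -[g](subrK ((g.1 v / f.1 v) *: f)) memvD ?memvZ //.
apply: (subvP sL); rewrite mem_vertex_ideal -scaleNr !sqzeroE.
by rewrite mulNr divfK ?subrr.
Qed.

(** The elements without vertex part form a square-zero ideal.  If a maximal left
    ideal [L] missed such an [f], then [1 = l + g] with [l] in [L] and [g] in
    that ideal, and [1 + g] would be a left inverse of [l].  Conversely the
    vanishing of the coefficient at one vertex defines a maximal left ideal. *)
Lemma mem_Rad_sqzero f : (f \in Rad B) <-> f.1 = 0.
Proof.
split=> [/RadP Rf|f0].
  apply/ffunP => v; rewrite ffunE; apply/eqP; rewrite -mem_vertex_ideal.
  exact/Rf/vertex_ideal_maximal.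
apply/RadP => L [lL nL maxL].
have {}/maxL : left_ideal (L + fullv * <[f]>)%VS.
  rewrite /left_ideal prodvDr prodvA; apply: addvS => //.
  by apply: prodvSl; rewrite subvf.
case/(_ (addvSl _ _)) => [LL|L1].
  rewrite -LL; apply: (subvP (addvSr _ _)).
  by have := memv_mul (memvf (1 : B)) (memv_line f); rewrite mul1r.
have /memv_addP[l lL' [g]] : 1 \in (L + fullv * <[f]>)%VS by rewrite L1 memvf.
move=> gf E; have {gf} g0 : g.1 = 0.
  apply/ffunP => v; rewrite [RHS]ffunE; apply/eqP; rewrite -mem_vertex_ideal.
  have [lv _ _] := vertex_ideal_maximal v.
  apply: (subvP (subv_trans _ lv)) gf; apply: prodvSr.
  by rewrite -memvE mem_vertex_ideal f0 ffunE.
case: nL; apply/vspaceP => h; rewrite memvf.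
suff L1' : 1 \in L by rewrite -[h]mulr1 left_idealP.
suff <- : (1 + g) * l = 1. by rewrite left_idealP.
have -> : l = 1 - g by rewrite E addrK.
by rewrite mulrBr mulr1 mulrDl mul1r (rad_square_zero g0 g0) addr0 addrK.
Qed.

Definition vertex_idem (v : Q) : B := ([ffun w => (w == v)%:R], 0).

Lemma vertex_idem1 v w : (vertex_idem v).1 w = (w == v)%:R.
Proof. by rewrite ffunE. Qed.
Lemma vertex_idem2 v a : (vertex_idem v).2 a = 0.
Proof. by rewrite ffunE. Qed.

Definition arrow_elt (a : arrow Q) : B := (0, [ffun b => (b == a)%:R]).

Lemma arrow_elt1 a v : (arrow_elt a).1 v = 0.
Proof. by rewrite ffunE. Qed.
Lemma arrow_elt2 a b : (arrow_elt a).2 b = (b == a)%:R.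
Proof. by rewrite ffunE. Qed.

Definition sqzero_idemE :=
  (vertex_idem1, vertex_idem2, arrow_elt1, arrow_elt2, sqzeroE).

Lemma idempotent_eq0 f : Defs.idempotent f -> f.1 = 0 -> f = 0.
Proof. by move=> ff f0; rewrite -ff rad_square_zero. Qed.

Lemma vertex_idemM v w : vertex_idem v * vertex_idem w = (v == w)%:R *: vertex_idem v.
Proof.
apply: sqzeroP => i; rewrite !sqzero_idemE ?mulr0 ?mul0r ?addr0 //.
by have [->|] := eqVneq i v; rewrite ?mulr1 ?mul1r // mul0r mulr0.
Qed.

(** Primitivity: if [vertex_idem v = f + g] with [f], [g] orthogonal idempotents,
    then one of [f], [g] has no vertex part at all, and an idempotent in the
    square-zero ideal is [0]. *)
Lemma vertex_idem_complete : complete_idempotents vertex_idem.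
Proof.
split=> [v|v w /negPf vw|]; last 1 first.
- apply: sqzeroP => i; last first.
    rewrite sqzero_sum2 big1=> [|v _]; last by rewrite vertex_idem2.
    by rewrite sqzero12.
  rewrite !sqzeroE (bigD1 i) //= vertex_idem1 eqxx big1 ?addr0 // => v /negPf vi.
  by rewrite vertex_idem1 eq_sym vi.
- split; first by rewrite /Defs.idempotent vertex_idemM eqxx scale1r.
    move/(congr1 (fun f : B => f.1 v)); rewrite vertex_idem1 eqxx sqzero01.
    exact/eqP/oner_neq0.
  move=> f g ff gg fg _ E.
  have E1 w : f.1 w * g.1 w = 0 by rewrite -sqzeroM1 fg sqzero01.
  have E2 w : f.1 w + g.1 w = (w == v)%:R by rewrite -sqzeroD1 -E vertex_idem1.
  have idem (h : B) w : Defs.idempotent h -> h.1 w * h.1 w = h.1 w.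
    by move=> hh; rewrite -sqzeroM1 hh.
  have off w : w != v -> f.1 w = 0 /\ g.1 w = 0.
    move=> /negPf wv; have := E2 w; rewrite wv => /eqP; rewrite addr_eq0 => /eqP fgw.
    have g0 : g.1 w = 0.
      by have := E1 w; rewrite fgw mulNr idem // => /eqP; rewrite oppr_eq0 => /eqP.
    by rewrite fgw g0 oppr0.
  have /eqP := E1 v; rewrite mulf_eq0 => /orP[] /eqP h0; [left|right];
    apply: idempotent_eq0 => //; apply/ffunP => w; rewrite [RHS]ffunE;
    by have [->//|/off[]] := eqVneq w v.
- by rewrite vertex_idemM vw scale0r.
Qed.

Fact vertex_part_multiplicative :
  monoid_morphism (fun f : B =>
    [ffun i : 'I_#|Q| => f.1 (enum_val i)] : {ffun 'I_#|Q| -> k^o}).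
Proof.
split=> [|f g]; apply/ffunP=> i; rewrite !ffunE //.
Qed.
Fact vertex_part_linear :
  linear (fun f : B => [ffun i : 'I_#|Q| => f.1 (enum_val i)] : {ffun 'I_#|Q| -> k^o}).
Proof. by move=> c f g; apply/ffunP=> i; rewrite !ffunE. Qed.

Definition vertex_part : {lrmorphism B -> {ffun 'I_#|Q| -> k^o}} :=
  HB.pack (fun f : B => [ffun i : 'I_#|Q| => f.1 (enum_val i)])
   (GRing.isLinear.Build k B {ffun 'I_#|Q| -> k^o} *:%R _ vertex_part_linear)
   (GRing.isMonoidMorphism.Build B {ffun 'I_#|Q| -> k^o} _ vertex_part_multiplicative).

Lemma sqzero_split_basic : split_basic B.
Proof.
exists #|Q|, vertex_part; split=> [y|f].
  exists ([ffun v => y (enum_rank v)], 0); apply/ffunP=> i.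
  by rewrite !ffunE enum_valK.
rewrite mem_Rad_sqzero; split=> [/ffunP f0|f0]; apply/ffunP=> i.
  by have := f0 (enum_rank i); rewrite !ffunE enum_rankK.
by rewrite !ffunE f0 ffunE.
Qed.

Lemma Rad_sqzero2 : (Rad B ^+ 2 = 0)%VS.
Proof.
apply/eqP; rewrite -subv0; apply/prodvP => f g.
by rewrite !mem_Rad_sqzero => f0 g0; rewrite rad_square_zero ?mem0v.
Qed.

Section Corner.
Variables v w : Q.

Definition parallel (a : arrow Q) := (src a == v) && (tgt a == w).

Lemma vertex_idem_cornerE f : vertex_idem w * f * vertex_idem v =
  ((v == w)%:R *: [ffun i => (i == v)%:R * f.1 i],
   [ffun a => (parallel a)%:R * f.2 a]).
Proof.
apply: sqzeroP => i; rewrite !sqzero_idemE ?ffunE.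
  rewrite /GRing.scale /= mulrC mulrA; have [->|] := eqVneq i v; last by rewrite !mul0r mulr0.
  by rewrite !mul1r.
rewrite mulr0 mul0r add0r addr0 /parallel; case: (src i == v) => /=.
  by rewrite mulr1.
by rewrite mulr0 mul0r.
Qed.

(** The arrows from [v] to [w] parametrise the corner of the radical that the
    definition of the quiver measures. *)
Definition arrow_ext (x : {ffun {a | parallel a} -> k^o}) : B :=
  (0, [ffun a => if insub a is Some b then x b else 0]).

Fact arrow_ext_linear : linear arrow_ext.
Proof.
move=> c x y; apply: sqzeroP => i; rewrite !sqzeroE /= ?ffunE.
  by rewrite mulr0 addr0.
by case: insubP => [b _ _|_]; rewrite ?ffunE // mulr0 addr0.
Qed.

Definition arrow_extl : {linear {ffun {a | parallel a} -> k^o} -> B} :=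
  HB.pack arrow_ext (GRing.isLinear.Build k _ B *:%R _ arrow_ext_linear).

Lemma arrow_extE x a : (arrow_ext x).2 (val a) = x a.
Proof. by rewrite ffunE valK. Qed.

Lemma corner_Rad_sqzero :
  (<[vertex_idem w]> * Rad B * <[vertex_idem v]>)%VS = limg (linfun arrow_extl).
Proof.
apply/eqP; rewrite eqEsubv; apply/andP; split; last first.
  apply/subvP => _ /memv_imgP[x _ ->]; rewrite lfunE /=.
  have -> : arrow_ext x = vertex_idem w * arrow_ext x * vertex_idem v.
    rewrite vertex_idem_cornerE; apply: sqzeroP => i; rewrite !ffunE ?mulr0 //.
      by rewrite scaler0.
    by case: insubP => [b -> _|_]; rewrite ?mul1r ?mulr0.
  rewrite !memv_mul ?memv_line //; apply/mem_Rad_sqzero; exact: erefl.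
rewrite -prodvA; apply/prodvP => _ g /vlineP[c ->].
have -> : (Rad B * <[vertex_idem v]> = limg (amulr (vertex_idem v) \o projv (Rad B))%VF)%VS.
  apply/eqP; rewrite eqEsubv; apply/andP; split.
    apply/prodvP => h _ hR /vlineP[d ->]; apply/memv_imgP.
    exists (d *: h); rewrite ?memvf // comp_lfunE lfunE /= projv_id ?memvZ //.
    by rewrite -scalerAr scalerAl.
  apply/subvP => _ /memv_imgP[h _ ->]; rewrite comp_lfunE lfunE /=.
  by rewrite memv_mul ?memv_line ?memv_proj.
move=> /memv_imgP[h _ ->]; rewrite comp_lfunE lfunE /=.
move: (projv (Rad B) h) (memv_proj (Rad B) h) => {}h /mem_Rad_sqzero h0.
rewrite mulrA -scalerAl -scalerAl; apply: memvZ; apply/memv_imgP.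
exists [ffun a => h.2 (val a)]; first by rewrite memvf.
rewrite (lfunE arrow_extl) /= vertex_idem_cornerE.
apply: sqzeroP => i /=; first by rewrite h0 !ffunE mulr0 scaler0.
rewrite !ffunE.
case: insubP => [b -> <-|/negPf ->]; rewrite ?ffunE ?mul1r ?mul0r //.
Qed.

Lemma arrow_extl_ker0 : lker (linfun arrow_extl) == 0%VS.
Proof.
apply/lker0P => x y; rewrite !lfunE => xy; apply/ffunP => a.
by move/(congr1 (fun f : B => f.2 (val a))): xy; rewrite !arrow_extE.
Qed.

Lemma dim_corner_Rad_sqzero :
  \dim (<[vertex_idem w]> * Rad B * <[vertex_idem v]>)%VS = #|parallel|.
Proof.
rewrite corner_Rad_sqzero limg_dim_eq; last by rewrite (eqP arrow_extl_ker0) capv0.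
by rewrite dimvf /dim /= muln1 card_sig.
Qed.
End Corner.

Lemma sqzero_quiver_wrt : quiver_wrt vertex_idem.
Proof.
by move=> v w; rewrite Rad_sqzero2 addv0 dimv0 subn0 dim_corner_Rad_sqzero.
Qed.

End SquareZeroAlgebra.

(** * Its presentation by the quiver *)

Section SquareZeroPresentation.
Variables (k : fieldType) (Q : quiver) (x0 : Q).
Local Notation B := (sqzero_alg k x0).
Local Notation e := (@vertex_idem k Q x0).
Local Notation arr := (@arrow_elt k Q x0).
Local Notation R := (@consecutive_zero k Q).

(** The class of a path in the path algebra modulo paths of length two. *)
Definition path_val (x : Q) (s : seq (arrow Q)) : B :=
  match s with [::] => e x | [:: a] => arr a | _ => 0 end.

Lemma path_val_corner x y (p : qpath x y) :
  path_val x p \in corner (e y) (e x).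
Proof.
apply/cornerP; exists (path_val x p); rewrite vertex_idem_cornerE.
case: p => -[|a [|b s]] /=.
- move/eqP->; apply: sqzeroP => i; rewrite !ffunE ?mulr0 // eqxx scale1r.
  by case: eqP; rewrite ?mulr1 ?mulr0.
- rewrite /parallel => /andP[/eqP sa /eqP ta]; apply: sqzeroP => i; rewrite !ffunE.
    by rewrite mulr0 scaler0.
  by case: eqP => [->|]; rewrite ?mulr0 // sa ta !eqxx mulr1.
- by move=> _; apply: sqzeroP => i; rewrite !ffunE ?mulr0 ?scaler0.
Qed.

Lemma path_val_cat x y z (p : qpath x y) (q : qpath y z) :
  path_val x (qpath_comp q p) = path_val y q * path_val x p.
Proof.
have := path_val_corner q; have := path_val_corner p.
case: p => -[|a [|b s]] /= wp; case: q => -[|c [|d t]] /= wq;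
  rewrite ?mulr0 ?mul0r ?cats0 //.
- by rewrite (eqP wp) vertex_idemM eqxx scale1r.
- rewrite (eqP wp) => _ /cornerP[b ->].
  by rewrite -[RHS]mulrA vertex_idemM eqxx scale1r.
- rewrite -(eqP wq) => /cornerP[b ->] _.
  by rewrite !mulrA vertex_idemM eqxx scale1r.
- by rewrite rad_square_zero.
Qed.

Definition path_hom_val (x y : Q) (p : qpath x y) : idem_hom e x y :=
  Subvs (path_val_corner p).

Definition eval_hom (x y : Q) (f : free_hom k x y) : idem_hom e x y :=
  lin_ext (@path_hom_val x y) f.

Lemma eval_hom_linear x y : linear (@eval_hom x y).
Proof. exact: lin_ext_linear. Qed.

Lemma eval_hom_path x y (p : qpath x y) : eval_hom (path_hom k p) = path_hom_val p.
Proof. exact: lin_ext_unit. Qed.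

Let ce : complete_idempotents e := vertex_idem_complete k x0.

Lemma eval_hom_comp x y z (g : free_hom k y z) (f : free_hom k x y) :
  eval_hom (free_comp g f) = idem_comp (eval_hom g) (eval_hom f).
Proof.
apply: (@malg_lin_ind k _ _ (fun g => eval_hom (free_comp g f))
  (fun g => idem_comp (eval_hom g) (eval_hom f))) => [||q].
- by move=> a u v; rewrite free_comp_linear_l eval_hom_linear.
- by move=> a u v; rewrite eval_hom_linear idem_comp_linear_l.
apply: (@malg_lin_ind k _ _ (fun f => eval_hom (free_comp << q >> f))
  (fun f => idem_comp (eval_hom << q >>) (eval_hom f))) => [||p].
- by move=> a u v; rewrite free_comp_linear_r eval_hom_linear.
- by move=> a u v; rewrite eval_hom_linear idem_comp_linear_r.
rewrite -!/(path_hom _ _) free_comp_path !eval_hom_path; apply: val_inj.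
exact: path_val_cat.
Qed.

Lemma eval_hom0 x y : eval_hom (0 : free_hom k x y) = 0.
Proof.
rewrite -[X in eval_hom X](subrr 0) -scaleN1r addrC eval_hom_linear.
by rewrite scaleN1r addNr.
Qed.

Lemma eval_homD x y (f g : free_hom k x y) :
  eval_hom (f + g) = eval_hom f + eval_hom g.
Proof. by have := @eval_hom_linear x y 1 f g; rewrite !scale1r. Qed.

Lemma eval_homZ x y c (f : free_hom k x y) : eval_hom (c *: f) = c *: eval_hom f.
Proof. by have := @eval_hom_linear x y c f 0; rewrite eval_hom0 !addr0. Qed.

Lemma eval_hom_cong (x y : free_cat k Q) (f g : hom x y) :
  cong_gen R f g -> eval_hom f = eval_hom g.
Proof.
elim=> {x y f g}.
- move=> x y f g; case=> x' y' z a b ax ay yb bz; rewrite eval_hom0.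
  rewrite (@eval_hom_comp x' y' z) !eval_hom_path.
  by apply: val_inj; rewrite /= rad_square_zero.
- by [].
- by move=> x y f g _ ->.
- by move=> x y f g h _ -> _ ->.
- move=> x y f f' g g' _ E _ E'.
  by rewrite [LHS](@eval_homD x y) [RHS](@eval_homD x y) E E'.
- move=> x y a f f' _ E.
  by rewrite [LHS](@eval_homZ x y) [RHS](@eval_homZ x y) E.
- move=> x y z g g' f f' _ E _ E'.
  by rewrite [LHS](@eval_hom_comp x y z) [RHS](@eval_hom_comp x y z) E E'.
Qed.

Local Notation C := (quot_cat R).

Definition quot_eval (x y : C) (f : hom x y) : idem_hom e x y := eval_hom (repr f).

Lemma quot_evalE x y (f : free_hom k x y) : quot_eval (to_quot R f) = eval_hom f.
Proof. by apply: eval_hom_cong; apply: lquot_repr. Qed.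

Lemma quot_eval_linear x y : linear (@quot_eval x y).
Proof.
move=> a; elim/to_quot_ind=> f; elim/to_quot_ind=> g.
by rewrite -to_quot_linear !quot_evalE eval_hom_linear.
Qed.

Lemma quot_eval1 (x : C) : quot_eval (idm x) = idem_id ce x.
Proof. by rewrite quot_evalE eval_hom_path; apply: val_inj. Qed.

Lemma quot_evalM (x y z : C) (g : hom y z) (f : hom x y) :
  quot_eval (g \oc f) = idem_comp (quot_eval g) (quot_eval f).
Proof.
elim/to_quot_ind: g => g; elim/to_quot_ind: f => f.
by rewrite [_ \oc _]quot_compE !quot_evalE eval_hom_comp.
Qed.

Definition eval_functor : linfunctor C (idem_cat ce) :=
  @LinFunctor k C (idem_cat ce) id quot_eval quot_eval_linear quot_eval1 quot_evalM.


Lemma long_path_cong x y (p : qpath x y) :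
  (1 < size p)%N -> cong_gen (C := free_cat k Q) R (path_hom k p) 0.
Proof.
case: p => -[|a [|b s]] //= wp _.
have [/eqP sa /andP[/eqP sb ws]] := andP wp.
pose q : qpath (tgt b) y := QPath ws.
pose pb := @qpath_arrow Q (tgt a) (tgt b) b sb erefl.
pose pa := @qpath_arrow Q x (tgt a) a sa erefl.
have -> : path_hom k (@QPath Q x y [:: a, b & s] wp) =
    free_comp (path_hom k q) (free_comp (path_hom k pb) (path_hom k pa)).
  by rewrite !free_comp_path; congr path_hom; apply: val_inj.
have -> : (0 : free_hom k x y) = free_comp (path_hom k q) (0 : free_hom k x (tgt b)).
  by rewrite -[X in free_comp _ X](subrr 0) -scaleN1r addrC free_comp_linear_r scaleN1r addNr.
apply: (@congM k (free_cat k Q)); first exact: cong_refl.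
by apply: cong_of; apply: ConsecutiveZero.
Qed.

Lemma eval_hom_sum x y (f : free_hom k x y) :
  val (eval_hom f) = \sum_(p <- msupp f) f@_p *: path_val x p.
Proof.
by rewrite /eval_hom /lin_ext
  (big_morph (fun z : idem_hom e x y => val z) (id1 := 0) (op1 := +%R)).
Qed.

Lemma free_hom_sum x y (f : free_hom k x y) :
  f = \sum_(p <- msupp f) f@_p *: @path_hom k Q x y p.
Proof.
apply: (@malg_lin_ind k _ _ id (lin_ext (@path_hom k Q x y))) => //.
  exact: lin_ext_linear.
by move=> p; rewrite lin_ext_unit.
Qed.

(** The trivial paths and the arrows have linearly independent values, so that a
    combination of paths with value [0] involves only paths of length at least
    two, all of which are congruent to [0]. *)
Lemma eval_hom_eq0 x y (f : free_hom k x y) :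
  eval_hom f = 0 -> cong_gen (C := free_cat k Q) R f 0.
Proof.
move=> /(congr1 val); rewrite eval_hom_sum => f0.
have coef1 v (p : qpath x y) : (path_val x p).1 v = (nilp p && (v == x))%:R.
  by case: p => -[|a [|b s]] /= _; rewrite !sqzero_idemE.
have coef2 a (p : qpath x y) : (path_val x p).2 a = (qpath_seq p == [:: a])%:R.
  case: p => -[|b [|c s]] /= _; rewrite !sqzero_idemE //.
    by rewrite eqseq_cons andbT eq_sym.
  by rewrite !eqseq_cons andbF.
have long p : p \in msupp f -> (1 < size p)%N.
  move=> pf; have : f@_p != 0 by rewrite mcoeff_neq0.
  have single (P : pred (qpath x y)) : P p ->
      (forall q, P q -> q = p) -> \sum_(q <- msupp f) f@_q * (P q)%:R = f@_p.
    move=> Pp uP; rewrite (big_fsetD1 p) //= Pp mulr1 big1_fset ?addr0 // => q.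
    rewrite !inE => /andP[/eqP qp _] _; case Pq: (P q); last by rewrite mulr0.
    by case: qp; apply: uP.
  case Ep: (qpath_seq p) => [|b [|c s]] // nz.
    have nilP q : nilp (qpath_seq q) -> q = p.
      by move=> /nilP q0; apply: val_inj; rewrite /= q0 Ep.
    case/eqP: nz; rewrite -(single (fun q => nilp (qpath_seq q))) ?Ep //.
    move: (congr1 (fun g : B => g.1 x) f0).
    rewrite sqzero_sum1 sqzero01 => {2}<-; apply: eq_bigr => q _.
    by rewrite sqzeroZ1 coef1 eqxx andbT.
  have arrP q : qpath_seq q == [:: b] -> q = p.
    by move=> /eqP qa; apply: val_inj; rewrite /= qa Ep.
  case/eqP: nz; rewrite -(single (fun q => qpath_seq q == [:: b])) ?Ep //.
  move: (congr1 (fun g : B => g.2 b) f0).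
  rewrite sqzero_sum2 sqzero02 => {2}<-; apply: eq_bigr => q _.
  by rewrite sqzeroZ2 coef2.
rewrite [X in cong_gen _ X](free_hom_sum f) big_seq.
elim/big_ind: _ => [|u v cu cv|p /long lp]; first exact: cong_refl.
  by rewrite -[0]addr0; apply: congD.
by rewrite -[0](scaler0 _ f@_p); apply/congZ/long_path_cong.
Qed.

(** Totalised over all sequences of arrows, so that sums over arrows need not
    carry proofs about end points. *)
Definition unit_path x y (s : seq (arrow Q)) : free_hom k x y :=
  if insub s is Some p then path_hom k p else 0.

Lemma quot_eval_bij (x y : C) : bijective (@quot_eval x y).
Proof.
have inj0 (f : quot_hom R x y) : quot_eval f = 0 -> f = 0.
  elim/to_quot_ind: f => f; rewrite quot_evalE => /eval_hom_eq0 f0.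
  exact/lquot_eqP.
have inj : injective (@quot_eval x y).
  move=> f g fg; apply/eqP; rewrite -subr_eq0; apply/eqP/inj0.
  by rewrite -scaleN1r addrC quot_eval_linear fg scaleN1r addNr.
suff surj (z : idem_hom e x y) : exists f : quot_hom R x y, quot_eval f = z.
  exists (fun z => projT1 (cid (surj z))) => [f|z].
    by apply: inj; rewrite (projT2 (cid (surj _))).
  exact: (projT2 (cid (surj z))).
have eval0 : eval_hom (0 : free_hom k x y) = 0 by exact: eval_hom0.
have evalS (I : finType) (F : I -> free_hom k x y) :
    val (eval_hom (\sum_i F i)) = \sum_i val (eval_hom (F i)).
  by rewrite (big_morph (fun g => val (eval_hom g)) (id1 := 0) (op1 := +%R)) // => [f g|];
    rewrite ?eval_homD ?eval0.
have evalU s : val (eval_hom (unit_path x y s)) =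
    if walk x s y then path_val x s else 0.
  rewrite /unit_path; case: insubP => [p -> <-|/negPf ->]; last by rewrite eval0.
  by rewrite eval_hom_path.
exists (to_quot R ((val z).1 x *: unit_path x y [::]
  + \sum_a (val z).2 a *: unit_path x y [:: a])).
rewrite quot_evalE; apply: val_inj; rewrite eval_homD eval_homZ /= evalS evalU /=.
have zE : val z = ((x == y)%:R *: [ffun v => (v == x)%:R * (val z).1 v],
    [ffun a => (parallel x y a)%:R * (val z).2 a]).
  have /cornerP[b zb] := subvsP z; rewrite -vertex_idem_cornerE.
  have -> : val z = e y * b * e x by exact: zb.
  by rewrite !mulrA vertex_idemM -!mulrA vertex_idemM !eqxx !scale1r.
rewrite [RHS]zE; apply: sqzeroP => i.
  rewrite sqzeroD1 sqzero_sum1 big1 => [|a _].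
    rewrite addr0 sqzeroZ1 /= !ffunE; have [_|_] := eqVneq x y; last first.
      by rewrite sqzero01 mulr0 /GRing.scale /= mul0r.
    rewrite vertex_idem1 scale1r mulrC.
    by have [->//|] := eqVneq i x; rewrite !mul0r.
  rewrite eval_homZ /= sqzeroZ1 evalU /=.
  have -> : (if (src a == x) && (tgt a == y) then arr a else 0 : B).1 i = 0.
    by case: ifP => _; [exact: arrow_elt1|exact: sqzero01].
  by rewrite mulr0.
rewrite sqzeroD2 sqzero_sum2 sqzeroZ2 (bigD1 i) //= big1 => [|a ai].
  rewrite addr0 eval_homZ /= evalU /= sqzeroZ2 ffunE /parallel.
  have -> : (if x == y then e x else 0 : B).2 i = 0.
    by case: ifP; rewrite ?vertex_idem2 ?sqzero02.
  rewrite mulr0 add0r; case: ifP => _; last by rewrite sqzero02 mulr0 mul0r.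
  by rewrite arrow_elt2 eqxx mulr1 mul1r.
rewrite eval_homZ /= sqzeroZ2 evalU; case: ifP => _; last by rewrite sqzero02 mulr0.
by rewrite /= (@arrow_elt2 k Q x0) eq_sym (negPf ai) mulr0.
Qed.

Lemma sqzero_presentation : lincat_iso C (idem_cat ce).
Proof.
exists eval_functor; split; first by exists id.
by move=> x y; exact: quot_eval_bij.
Qed.

End SquareZeroPresentation.

(** * Restriction of scalars along a matrix representation *)

(** A multiplicative linear map into matrices over [B].  It need not preserve [1]:
    the image of [1] is an idempotent matrix [e], and the target is really the
    corner [e M_J(B) e]. *)
Record mxhom (k : fieldType) (A B : algType k) (J : finType) := MxHom {
  mxhom_fun :> A -> J -> J -> B;
  mxhom_linear : forall i j, linear (fun a => mxhom_fun a i j);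
  mxhomM : forall a b i j,
    mxhom_fun (a * b) i j = \sum_l mxhom_fun a i l * mxhom_fun b l j
}.

Section Transport.
Variables (k : fieldType) (A B : algType k) (J : finType).
Variable rho : mxhom A B J.

Lemma mxhomD a b i j : rho (a + b) i j = rho a i j + rho b i j.
Proof. by have := mxhom_linear rho i j 1 a b; rewrite !scale1r. Qed.
Lemma mxhom0 i j : rho 0 i j = 0.
Proof. by apply: (addIr (rho 0 i j)); rewrite -mxhomD !add0r. Qed.
Lemma mxhomZ c a i j : rho (c *: a) i j = c *: rho a i j.
Proof. by have := mxhom_linear rho i j c a 0; rewrite mxhom0 !addr0. Qed.

Section Module.
Variable N : lmodType B.

Definition mx_act (a : A) (v : {ffun J -> N}) : {ffun J -> N} :=
  [ffun i => \sum_j rho a i j *: v j].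

Lemma mx_actE a v i : mx_act a v i = \sum_j rho a i j *: v j.
Proof. by rewrite ffunE. Qed.

Lemma mx_actDr a u v : mx_act a (u + v) = mx_act a u + mx_act a v.
Proof.
apply/ffunP => i; rewrite !ffunE -big_split; apply: eq_bigr => j _.
by rewrite ffunE scalerDr.
Qed.
Lemma mx_actDl a b v : mx_act (a + b) v = mx_act a v + mx_act b v.
Proof.
apply/ffunP => i; rewrite !ffunE -big_split; apply: eq_bigr => j _.
by rewrite mxhomD scalerDl.
Qed.
Lemma mx_actA a b v : mx_act a (mx_act b v) = mx_act (a * b) v.
Proof.
apply/ffunP => i; rewrite !ffunE.
transitivity (\sum_j \sum_l (rho a i j * rho b j l) *: v l).
  apply: eq_bigr => j _; rewrite ffunE scaler_sumr; apply: eq_bigr => l _.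
  by rewrite scalerA.
rewrite exchange_big; apply: eq_bigr => l _ /=.
by rewrite mxhomM scaler_suml.
Qed.

Definition mx_unital_pred : pred {ffun J -> N} := fun v => mx_act 1 v == v.

Lemma mx_unital_closed : zmod_closed mx_unital_pred.
Proof.
have act0 : mx_act 1 0 = 0.
  by apply: (addIr (mx_act 1 0)); rewrite -mx_actDr !add0r.
split; first by rewrite unfold_in act0.
move=> u v; rewrite !unfold_in => /eqP u1 /eqP v1.
have v1' : mx_act 1 (- v) = - v.
  by apply/eqP; rewrite -addr_eq0 -{2}v1 -mx_actDr addNr act0.
by rewrite mx_actDr u1 v1'.
Qed.

HB.instance Definition _ := GRing.isZmodClosed.Build {ffun J -> N}
  mx_unital_pred mx_unital_closed.

(** Restriction of scalars along [rho].  Since [rho 1] may be a proper idempotent,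
    [N ^ J] has to be cut down to the part on which [1] acts as the identity. *)
Record transport := Transport {
  transport_val :> {ffun J -> N}; transportP : mx_unital_pred transport_val }.
HB.instance Definition _ := [isSub for transport_val].
HB.instance Definition _ := [Choice of transport by <:].
HB.instance Definition _ := [SubChoice_isSubZmodule of transport by <:].

Lemma transport1 (v : transport) : mx_act 1 v = v.
Proof. exact/eqP/transportP. Qed.

Fact transport_scale_subproof a (v : transport) : mx_unital_pred (mx_act a v).
Proof. by rewrite /mx_unital_pred mx_actA mul1r. Qed.
Definition transport_scale a v : transport :=
  Transport (transport_scale_subproof a v).

Fact transport_scaleA a b v :
  transport_scale a (transport_scale b v) = transport_scale (a * b) v.
Proof. by apply: val_inj; rewrite /= mx_actA. Qed.
Fact transport_scale1 : left_id 1 transport_scale.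
Proof. by move=> v; apply: val_inj; rewrite /= transport1. Qed.
Fact transport_scaleDr : right_distributive transport_scale +%R.
Proof. by move=> a u v; apply: val_inj; rewrite /= mx_actDr. Qed.
Fact transport_scaleDl v : {morph transport_scale^~ v : a b / a + b}.
Proof. by move=> a b; apply: val_inj; rewrite /= mx_actDl. Qed.

HB.instance Definition _ := GRing.Zmodule_isLmodule.Build A transport
  transport_scaleA transport_scale1 transport_scaleDr transport_scaleDl.

Lemma transportD (u v : transport) i : (u + v : transport) i = u i + v i.
Proof. exact: (ffunE (fun j => u j + v j) i). Qed.

Lemma transport_scaleE a (v : transport) i :
  (a *: v : transport) i = \sum_j rho a i j *: v j.
Proof. exact: mx_actE. Qed.

End Module.

Section Map.
Variables (M N : lmodType B) (f : modhom M N).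

Lemma modhomD_fun u v : modhom_fun f (u + v) = modhom_fun f u + modhom_fun f v.
Proof. by have := modhom_linear f 1 u v; rewrite !scale1r. Qed.
Lemma modhom0_fun : modhom_fun f 0 = 0.
Proof. by apply: (addIr (modhom_fun f 0)); rewrite -modhomD_fun !add0r. Qed.
Lemma modhomZ_fun b u : modhom_fun f (b *: u) = b *: modhom_fun f u.
Proof. by have := modhom_linear f b u 0; rewrite modhom0_fun !addr0. Qed.
Lemma modhom_sum (I : Type) (r : seq I) (P : pred I) (F : I -> M) :
  modhom_fun f (\sum_(i <- r | P i) F i) = \sum_(i <- r | P i) modhom_fun f (F i).
Proof. by apply: big_morph; [exact: modhomD_fun | exact: modhom0_fun]. Qed.

Lemma mx_act_map a (v : {ffun J -> M}) :
  mx_act a [ffun j => modhom_fun f (v j)] = [ffun j => modhom_fun f (mx_act a v j)].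
Proof.
apply/ffunP => i; rewrite !ffunE modhom_sum; apply: eq_bigr => j _.
by rewrite ffunE modhomZ_fun.
Qed.

Fact transport_map_subproof (v : transport M) :
  mx_unital_pred [ffun j => modhom_fun f (v j)].
Proof. by rewrite /mx_unital_pred mx_act_map transport1. Qed.
Definition transport_map_fun (v : transport M) : transport N :=
  Transport (transport_map_subproof v).

Fact transport_map_linear : linear transport_map_fun.
Proof.
move=> a u v; apply: val_inj.
transitivity (mx_act a [ffun j => modhom_fun f (u j)] + [ffun j => modhom_fun f (v j)]);
  last by [].
rewrite mx_act_map; apply/ffunP => j; rewrite !ffunE. by rewrite modhomD_fun.
Qed.
Definition transport_map : modhom (transport M) (transport N) :=
  mk_modhom transport_map_linear.

Lemma transport_mapE v j : modhom_fun transport_map v j = modhom_fun f (v j).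
Proof. by rewrite mk_modhomE /= ffunE. Qed.
End Map.

Lemma transportP_ext (N : lmodType B) (u v : transport N) : u =1 v -> u = v.
Proof. by move=> uv; apply: val_inj; apply/ffunP. Qed.

Fact transport_functor_linear (M N : lmodType B) : linear (@transport_map M N).
Proof.
move=> c f g; apply: modhom_ext => v; apply: transportP_ext => i.
rewrite transport_mapE modhomDE modhomZE.
transitivity ((c%:A *: modhom_fun (transport_map f) v
               + modhom_fun (transport_map g) v : transport N) i); last by [].
rewrite transportD transport_mapE; congr (_ + _).
rewrite transport_scaleE.
have -> : v i = \sum_j rho 1 i j *: v j by rewrite -mx_actE transport1.
rewrite modhom_sum scaler_sumr; apply: eq_bigr => j _.
by rewrite modhomZ_fun transport_mapE scalerA mxhomZ -scalerAl mul1r.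
Qed.
Fact transport_functor1 (N : lmodType B) :
  transport_map (modhom1 N) = modhom1 (transport N).
Proof.
by apply: modhom_ext => v; apply: transportP_ext => i; rewrite transport_mapE.
Qed.
Fact transport_functorM (M N P : lmodType B) (g : modhom N P) (f : modhom M N) :
  transport_map (modhom_comp g f) = modhom_comp (transport_map g) (transport_map f).
Proof.
apply: modhom_ext => v; apply: transportP_ext => i.
by rewrite transport_mapE [RHS]transport_mapE transport_mapE.
Qed.

Definition transport_functor : linfunctor (module_cat B) (module_cat A) :=
  @LinFunctor k (module_cat B) (module_cat A) transport transport_map
    transport_functor_linear transport_functor1 transport_functorM.

End Transport.

(** * Morita equivalence with a full corner *)

(** The inverse of a bijective module morphism is again one; it spares the
    linearity of the inverses in the natural isomorphisms below. *)
Lemma can2_modhom (k : fieldType) (A : algType k) (M N : lmodType A)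
    (f : modhom M N) (g : N -> M) :
  cancel g (modhom_fun f) -> cancel (modhom_fun f) g -> linear g.
Proof.
move=> gK fK a u v; apply: (can_inj fK).
by rewrite modhomD_fun modhomZ_fun !gK.
Qed.

Lemma natural_isoI (k : fieldType) (A : algType k)
    (F G : linfunctor (module_cat A) (module_cat A))
    (eta : forall M : lmodType A, F M -> G M)
    (eta' : forall M : lmodType A, G M -> F M) :
  (forall M, linear (eta M)) ->
  (forall M, cancel (eta M) (eta' M)) -> (forall M, cancel (eta' M) (eta M)) ->
  (forall M N (f : modhom M N) v,
    eta N (modhom_fun (fhom F f) v) = modhom_fun (fhom G f) (eta M v)) ->
  natural_iso F G.
Proof.
move=> el etaK eta'K nat; pose et M := mk_modhom (el M).
pose et' M := mk_modhom (@can2_modhom k A _ _ (et M) (eta' M) (eta'K M) (etaK M)).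
exists et, et'; split=> [M|M|M N f]; apply: modhom_ext => v.
- exact: etaK.
- exact: eta'K.
- exact: nat.
Qed.

Section MoritaContext.
Variables (k : fieldType) (A B : algType k) (J : finType).
Variables (rho : mxhom A B J) (iota : mxhom B A unit).
Variables (x y : J -> A) (p q : J -> B).
Local Notation io b := (iota b tt tt).
(* [iota] identifies [B] with the corner of [A] cut out by the idempotent
   [iota 1]; the [x j] and [y j] show that this corner is full, and [p j], [q j]
   are the parts of [x j], [y j] that live inside it. *)
Hypothesis io_inj : injective (fun b => io b).
Hypothesis io_rho : forall a i j, io (rho a i j) = y i * a * x j.
Hypothesis xy1 : \sum_j x j * y j = 1.
Hypothesis io1y : forall j, io 1 * y j = y j.
Hypothesis io_p : forall j, io (p j) = io 1 * x j.
Hypothesis io_q : forall j, io (q j) = y j * io 1.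

Let ioM b c : io (b * c) = io b * io c.
Proof. by rewrite mxhomM (big_pred1 tt) // => -[]. Qed.

Let io_sum (I : finType) (F : I -> B) : io (\sum_i F i) = \sum_i io (F i).
Proof.
by apply: (big_morph (fun b => io b)) => [b c|]; rewrite ?mxhomD ?mxhom0.
Qed.

Let scale_unit (M : lmodType A) (b : B) (w : transport iota M) :
  (b *: w : transport iota M) tt = io b *: w tt.
Proof. by rewrite transport_scaleE (big_pred1 tt) // => -[]. Qed.

Let sum_transport (M : lmodType A) (I : finType) (F : I -> transport iota M) i :
  (\sum_j F j) i = \sum_j F j i.
Proof.
apply: (big_morph (fun w : transport iota M => w i)) => [u v|].
  exact: transportD.
exact: (ffunE (fun=> 0) i).
Qed.

Section BackOnA.
Variable M : lmodType A.
Local Notation TT := (transport rho (transport iota M)).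

(** The evaluation map from [A e] tensored with [e M] to [M], written in the
    coordinates given by the [x j]. *)
Definition collectA (v : TT) : M := \sum_j x j *: v j tt.

Fact spreadA_subproof1 m j : mx_unital_pred iota ([ffun=> y j *: m] : {ffun unit -> M}).
Proof.
apply/eqP/ffunP => -[]; rewrite !ffunE (big_pred1 tt) => [|[]] //.
by rewrite ffunE scalerA io1y.
Qed.
Definition spreadA1 m j : transport iota M := Transport (spreadA_subproof1 m j).

Fact spreadA_subproof2 m :
  mx_unital_pred rho ([ffun j => spreadA1 m j] : {ffun J -> transport iota M}).
Proof.
apply/eqP/ffunP => i; rewrite !ffunE; apply: transportP_ext => -[].
rewrite sum_transport /= ffunE -[m in RHS]scale1r -[in RHS]xy1 scaler_suml.
rewrite scaler_sumr; apply: eq_bigr => j _.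
by rewrite scale_unit ffunE /= ffunE io_rho !scalerA mulr1 !mulrA.
Qed.
Definition spreadA m : TT := Transport (spreadA_subproof2 m).

Lemma spreadAE m j : spreadA m j tt = y j *: m.
Proof. by rewrite /= ffunE /= ffunE. Qed.

Lemma TT_scaleE a (v : TT) i : (a *: v : TT) i tt = \sum_j (y i * a * x j) *: v j tt.
Proof.
rewrite transport_scaleE sum_transport; apply: eq_bigr => j _.
by rewrite scale_unit io_rho.
Qed.

Lemma collectA_linear : linear collectA.
Proof.
move=> a u v; rewrite /collectA.
transitivity (\sum_j (x j *: (a *: u : TT) j tt + x j *: v j tt)).
  by apply: eq_bigr => j _; rewrite !transportD scalerDr.
rewrite big_split; congr (_ + _).
transitivity (\sum_j (x j * y j) *: \sum_l (a * x l) *: u l tt).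
  apply: eq_bigr => j _; rewrite TT_scaleE !scaler_sumr; apply: eq_bigr => l _.
  by rewrite !scalerA !mulrA.
by rewrite -scaler_suml xy1 scale1r scaler_sumr; apply: eq_bigr => l _; rewrite scalerA.
Qed.

Lemma spreadAK : cancel spreadA collectA.
Proof.
move=> m; rewrite /collectA -[RHS]scale1r -xy1 scaler_suml.
by apply: eq_bigr => j _; rewrite spreadAE scalerA.
Qed.

Lemma collectAK : cancel collectA spreadA.
Proof.
move=> v; apply: transportP_ext => i; apply: transportP_ext => -[].
rewrite spreadAE -[v in RHS]scale1r TT_scaleE mulr1 scaler_sumr.
by apply: eq_bigr => j _; rewrite scalerA.
Qed.
End BackOnA.

Section BackOnB.
Variable N : lmodType B.
Local Notation TT := (transport iota (transport rho N)).

(** The same map on the side of [B], where only the corner part [p j] of [x j]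
    acts. *)
Definition collectB (w : TT) : N := \sum_j p j *: w tt j.

Fact spreadB_subproof1 n : mx_unital_pred rho ([ffun j => q j *: n] : {ffun J -> N}).
Proof.
apply/eqP/ffunP => i; rewrite !ffunE.
under eq_bigr do rewrite ffunE scalerA.
rewrite -scaler_suml; congr (_ *: _); apply: io_inj; rewrite io_sum io_q.
under eq_bigr do rewrite ioM io_rho io_q mulr1 mulrA -[y i * _ * _]mulrA.
by rewrite -mulr_suml -mulr_sumr xy1 mulr1.
Qed.
Definition spreadB1 n : transport rho N := Transport (spreadB_subproof1 n).

Fact spreadB_subproof2 n :
  mx_unital_pred iota ([ffun=> spreadB1 n] : {ffun unit -> transport rho N}).
Proof.
apply/eqP/ffunP => -[]; rewrite !ffunE (big_pred1 tt) => [|[]] //.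
rewrite ffunE; apply: transportP_ext => i; rewrite transport_scaleE /= ffunE.
under eq_bigr do rewrite ffunE scalerA.
rewrite -scaler_suml; congr (_ *: _); apply: io_inj; rewrite io_sum io_q.
under eq_bigr do rewrite ioM io_rho io_q mulrA -[y i * _ * _ * _]mulrA.
by rewrite -mulr_suml -mulr_sumr xy1 mulr1 -mulrA -ioM mulr1.
Qed.
Definition spreadB n : TT := Transport (spreadB_subproof2 n).

Lemma spreadBE n j : spreadB n tt j = q j *: n.
Proof. by rewrite /= ffunE /= ffunE. Qed.

Lemma TT_scaleB b (w : TT) i : (b *: w : TT) tt i = \sum_j rho (io b) i j *: w tt j.
Proof. by rewrite transport_scaleE (big_pred1 tt) => [|[]] //; rewrite transport_scaleE. Qed.

Lemma collectB_linear : linear collectB.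
Proof.
move=> b u v; rewrite /collectB.
transitivity (\sum_j (p j *: (b *: u : TT) tt j + p j *: v tt j)).
  by apply: eq_bigr => j _; rewrite !transportD scalerDr.
rewrite big_split; congr (_ + _).
transitivity (\sum_j \sum_l (p j * rho (io b) j l) *: u tt l).
  apply: eq_bigr => j _; rewrite TT_scaleB scaler_sumr; apply: eq_bigr => l _.
  by rewrite scalerA.
rewrite exchange_big scaler_sumr; apply: eq_bigr => l _ /=.
rewrite -scaler_suml scalerA; congr (_ *: _); apply: io_inj; rewrite io_sum ioM io_p.
transitivity (\sum_i io 1 * (x i * y i) * (io b * x l)).
  by apply: eq_bigr => i _; rewrite ioM io_rho io_p !mulrA.
by rewrite -mulr_suml -mulr_sumr xy1 mulr1 !mulrA -!ioM mul1r mulr1.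
Qed.

Lemma spreadBK : cancel spreadB collectB.
Proof.
move=> n; rewrite /collectB -[RHS]scale1r.
under eq_bigr do rewrite spreadBE scalerA.
rewrite -scaler_suml; congr (_ *: _); apply: io_inj; rewrite io_sum.
under eq_bigr do rewrite ioM io_p io_q mulrA -[_ * y _]mulrA.
by rewrite -mulr_suml -mulr_sumr xy1 mulr1 -ioM mulr1.
Qed.

Lemma collectBK : cancel collectB spreadB.
Proof.
move=> w; apply: transportP_ext => -[]; apply: transportP_ext => i.
rewrite spreadBE -[w in RHS]scale1r TT_scaleB scaler_sumr.
apply: eq_bigr => j _; rewrite scalerA; congr (_ *: _); apply: io_inj.
by rewrite ioM io_p io_q io_rho mulrA -[_ * io 1 * io 1]mulrA -ioM mulr1.
Qed.
End BackOnB.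

(** Restriction of scalars along [iota] is [M |-> e M], and along [rho] it is
    [N |-> A e] tensored with [N]; collecting and spreading are
    mutually inverse and give the natural isomorphisms. *)
Theorem morita_context : morita_equivalent A B.
Proof.
exists (transport_functor iota), (transport_functor rho); split.
- apply: (@natural_isoI k A
    (comp_functor (transport_functor rho) (transport_functor iota))
    (id_functor _) collectA spreadA).
  + exact: collectA_linear.
  + exact: collectAK.
  + exact: spreadAK.
  move=> M N f v; rewrite [RHS]modhom_sum; apply: eq_bigr => j _.
  by rewrite modhomZ_fun !transport_mapE.
- apply: (@natural_isoI k B
    (comp_functor (transport_functor iota) (transport_functor rho))
    (id_functor _) collectB spreadB).
  + exact: collectB_linear.
  + exact: collectBK.
  + exact: spreadBK.
  move=> M N f v; rewrite [RHS]modhom_sum; apply: eq_bigr => j _.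
  by rewrite modhomZ_fun !transport_mapE.
Qed.

End MoritaContext.

Section FullCorner.
Variables (k : fieldType) (A B : algType k) (J : finType).
Variables (rho : mxhom A B J) (eps U W : J -> B).
Hypothesis rho1 : forall i j, rho 1 i j = if i == j then eps i else 0.
Hypothesis rho_inj : forall a b, (forall i j, rho a i j = rho b i j) -> a = b.
Hypothesis rho_surj : forall X : J -> J -> B,
  (forall i j, eps i * X i j * eps j = X i j) ->
  exists a, forall i j, rho a i j = X i j.
Hypothesis UW : \sum_j U j * W j = 1.
Hypothesis Ueps : forall j, U j * eps j = U j.
Hypothesis epsW : forall j, eps j * W j = W j.

Let eps_idem i : eps i * eps i = eps i.
Proof.
have := mxhomM rho 1 1 i i; rewrite mul1r (bigD1 i) //= !rho1 eqxx => E; rewrite [RHS]E.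
by rewrite big1 ?addr0 // => l /negPf li; rewrite !rho1 eq_sym li mul0r.
Qed.

Let sum_row (F : J -> B) i : \sum_l (if i == l then F l else 0) = F i.
Proof. by rewrite -big_mkcond (big_pred1 i) // => l; rewrite eq_sym. Qed.

Let eps_rho a i j : eps i * rho a i j = rho a i j.
Proof.
rewrite -[a in RHS]mul1r mxhomM -(sum_row (fun l => eps l * rho a l j)).
apply: eq_bigr => l _; rewrite rho1; case: eqP => [->//|_]; by rewrite mul0r.
Qed.
Let rho_eps a i j : rho a i j * eps j = rho a i j.
Proof.
rewrite -[a in RHS]mulr1 mxhomM -(sum_row (fun l => rho a i l * eps l) j).
apply: eq_bigr => l _; rewrite rho1 eq_sym.
by case: eqP => [->//|_]; rewrite mulr0.
Qed.

Let inv_ex (X : J -> J -> B) :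
  exists a, forall i j, rho a i j = eps i * X i j * eps j.
Proof. by apply: rho_surj => i j; rewrite !mulrA eps_idem -!mulrA eps_idem. Qed.
Let inv X : A := projT1 (cid (inv_ex X)).
Let invE X i j : rho (inv X) i j = eps i * X i j * eps j.
Proof. exact: (projT2 (cid (inv_ex X))). Qed.

Let io b := inv (fun i j => W i * b * U j).
Let ioE b i j : rho (io b) i j = W i * b * U j.
Proof. by rewrite invE !mulrA epsW -mulrA Ueps. Qed.

Let io_linear : forall i j : unit, linear (fun b => io b).
Proof.
move=> _ _ c b b'; apply: rho_inj => i j.
by rewrite mxhomD mxhomZ !ioE mulrDr mulrDl -scalerAr -scalerAl.
Qed.
Let ioM b c : io (b * c) = io b * io c.
Proof.
apply: rho_inj => i j; rewrite mxhomM ioE.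
transitivity (\sum_l W i * b * (U l * W l) * (c * U j)).
  by rewrite -mulr_suml -mulr_sumr UW mulr1 !mulrA.
by apply: eq_bigr => l _; rewrite !ioE !mulrA.
Qed.
Let io_mxhomM b c (i j : unit) : io (b * c) = \sum_(l : unit) io b * io c.
Proof. by rewrite ioM (big_pred1 tt) // => -[]. Qed.
Let iota := @MxHom k B A unit (fun b _ _ => io b) io_linear io_mxhomM.

Let x j := inv (fun i l => if j == i then U l else 0).
Let xE j i l : rho (x j) i l = if j == i then eps j * U l else 0.
Proof.
rewrite invE; case: eqP => [->|_]; rewrite ?mulr0 ?mul0r //.
by rewrite -mulrA Ueps.
Qed.
Let y j := inv (fun i l => if j == l then W i else 0).
Let yE j i l : rho (y j) i l = if j == l then W i * eps j else 0.
Proof. by rewrite invE; case: eqP => [->|_]; rewrite ?epsW // mulr0 mul0r. Qed.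

Let rho_y j a i l : rho (y j * a) i l = W i * rho a j l.
Proof.
rewrite mxhomM -[rho a j l]eps_rho mulrA -(sum_row (fun m => W i * eps j * rho a m l)).
by apply: eq_bigr => m _; rewrite yE; case: eqP => // _; rewrite mul0r.
Qed.
Let rho_x j a i l : rho (a * x j) i l = rho a i j * U l.
Proof.
rewrite mxhomM -[rho a i j]rho_eps -mulrA -(sum_row (fun m => rho a i m * (eps j * U l)) j).
by apply: eq_bigr => m _; rewrite xE; case: eqP => // _; rewrite mulr0.
Qed.

(** An algebra isomorphic to a full corner [e M_J(B) e], with [e] diagonal, is Morita
    equivalent to [B].  The context is read off from the inverse of [rho]:
    [iota b] is the matrix [W i * b * U j], the row vector [U] placed in row [j]
    gives [x j], and the column vector [W] placed in column [j] gives [y j]. *)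
Theorem morita_full_corner : morita_equivalent A B.
Proof.
have rho_io1x j i l : rho (io 1 * x j) i l = W i * U j * U l.
  by rewrite rho_x ioE mulr1.
have rho_yio1 j i l : rho (y j * io 1) i l = W i * W j * U l.
  by rewrite rho_y ioE mulr1 mulrA.
apply: (@morita_context k A B J rho iota x y U W) => /=.
- move=> b c bc; rewrite -[b]mul1r -[b]mulr1 -[c]mul1r -[c]mulr1 -UW.
  rewrite !mulr_suml; apply: eq_bigr => i _; rewrite !mulr_sumr.
  apply: eq_bigr => j _; rewrite -!mulrA; congr (_ * _).
  have E : W i * b * U j = W i * c * U j by rewrite -!ioE (bc : io b = io c).
  by rewrite !mulrA E.
- by move=> a i j; apply: rho_inj => p q; rewrite ioE rho_x rho_y.
- apply: rho_inj => i j; rewrite rho1.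
  transitivity (\sum_l rho (x l * y l) i j).
    by rewrite (big_morph (fun a => rho a i j) (id1 := 0) (op1 := +%R)) // => [a b|];
      rewrite ?mxhomD ?mxhom0.
  have E l : rho (x l * y l) i j = if i == l then (if i == j then eps i else 0) else 0.
    rewrite mxhomM; have [->|ne] := eqVneq i l; last first.
      by rewrite big1 // => m _; rewrite xE eq_sym (negPf ne) mul0r.
    transitivity (\sum_m if l == j then eps l * (U m * W m) * eps l else 0).
      by apply: eq_bigr => m _; rewrite xE yE eqxx; case: eqP; rewrite ?mulr0 // !mulrA.
    case: eqP => _; last by rewrite big1.
    by rewrite -mulr_suml -mulr_sumr UW mulr1 eps_idem.
  by rewrite (eq_bigr _ (fun l _ => E l)) sum_row.
- move=> j; apply: rho_inj => i l; rewrite mxhomM yE.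
  transitivity (\sum_m W i * (U m * W m) * (if j == l then eps j else 0)).
    by apply: eq_bigr => m _; rewrite ioE yE mulr1; case: eqP => _; rewrite ?mulr0 // !mulrA.
  by rewrite -mulr_suml -mulr_sumr UW mulr1; case: eqP; rewrite ?mulr0.
- move=> j; apply: rho_inj => i l; rewrite ioE rho_io1x. done.
- move=> j; apply: rho_inj => i l; rewrite ioE rho_yio1. done.
Qed.

End FullCorner.

(** * The action on gaps *)

Lemma card_ltn_ord (n k : nat) : (k <= n)%N -> #|[pred x : 'I_n | (x < k)%N]| = k.
Proof.
move=> kn; rewrite -sum1_card.
by rewrite -(big_ord_widen n (fun=> 1%N) kn) sum1_card card_ord.
Qed.

(** Reading off a cut from its size is what turns monotone maps into counting
    functions and back. *)
Lemma initial_segment (n : nat) (P : pred 'I_n) :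
  (forall x y : 'I_n, (x <= y)%N -> P y -> P x) ->
  forall z : 'I_n, P z = (z < #|P|)%N.
Proof.
move=> dP z; apply/idP/idP => [Pz|].
  rewrite -(card_ltn_ord (ltn_ord z)); apply: subset_leq_card.
  by apply/subsetP => x; rewrite !inE ltnS => /dP; apply.
apply: contraLR => nPz; rewrite -leqNgt.
rewrite -[leqRHS](card_ltn_ord (ltnW (ltn_ord z))); apply: subset_leq_card.
apply/subsetP => x Px; rewrite inE ltnNge; apply: contra nPz => zx.
exact: dP zx Px.
Qed.

Section Pull.
Variable n : nat.
Implicit Types m : COD n.

(** The sign has to be taken from the pair: a constant map carries both signs. *)
Definition reversing m : bool := Z2_bool (COD_val m).2.
Definition cod_fun m (x : 'I_n) : 'I_n := OD_val (COD_val m).1 x.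

Lemma reversingM m m' : reversing (m * m')%g = reversing m (+) reversing m'.
Proof. by rewrite /reversing /=; case: (_.2) => /=; case: (_.2). Qed.
Lemma reversing1 : reversing 1%g = false.
Proof. by []. Qed.
Lemma cod_funM m m' x : cod_fun (m * m')%g x = cod_fun m (cod_fun m' x).
Proof. by rewrite /cod_fun /= ffunE. Qed.
Lemma cod_fun1 x : cod_fun 1%g x = x.
Proof. exact: transf1E. Qed.

Lemma cod_fun_mono m (x y : 'I_n) : (x <= y)%N ->
  if reversing m then (cod_fun m y <= cod_fun m x)%N
  else (cod_fun m x <= cod_fun m y)%N.
Proof.
rewrite /reversing /cod_fun; case: m => -[f a] /=; rewrite COD_predE /=.
case/orP => [/is_constP[z ->]|]; first by rewrite !ffunE if_same.
by case: a => [/order_preservingP|/order_reversingP] h /h.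
Qed.

Lemma COD_ext m m' : reversing m = reversing m' -> cod_fun m =1 cod_fun m' -> m = m'.
Proof.
rewrite /reversing /cod_fun; case: m m' => [[f a] p] [[g b] q] /= ab fg.
apply: val_inj => /=; congr pair; first by apply: val_inj; apply/ffunP.
by rewrite -[a]Z2_boolK ab Z2_boolK.
Qed.

(** Think of [y] in [0 .. n] as the gap just below the value [y].  A monotone [f]
    pulls this gap back to the gap between the points sent below [y] and the
    others; a reversing element has these two classes in the opposite order. *)
Definition pull_pred m (y : nat) : pred 'I_n :=
  fun x => (cod_fun m x < y)%N (+) reversing m.

Lemma pull_subproof m y : (#|pull_pred m y| < n.+1)%N.
Proof. by rewrite ltnS -[leqRHS]card_ord max_card. Qed.
Definition pull m (y : 'I_n.+1) : 'I_n.+1 := Ordinal (pull_subproof m y).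

(** [pull m] is adjoint to [m]; hence it turns products around and maps each of the
    two outer gaps [0] and [n] to an outer gap. *)
Lemma pull_galois m (z : 'I_n) (y : 'I_n.+1) :
  (cod_fun m z < y)%N = (z < pull m y)%N (+) reversing m.
Proof.
rewrite /= -(@initial_segment _ (pull_pred m y)).
  by rewrite /pull_pred addbK.
move=> x x' /(cod_fun_mono m); rewrite /pull_pred; case: reversing => le.
  by rewrite !addbT -!leqNgt => /leq_trans; apply.
by rewrite !addbF; apply: leq_ltn_trans.
Qed.

Lemma pullM m m' y : pull (m * m')%g y = pull m' (pull m y).
Proof.
apply: val_inj => /=; apply: eq_card => x; rewrite -!topredE /= /pull_pred.
by rewrite cod_funM reversingM pull_galois -addbA addKb.
Qed.

Lemma pull1 y : pull 1%g y = y.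
Proof.
apply: val_inj => /=; rewrite -[RHS](@card_ltn_ord n); last by rewrite -ltnS.
by apply: eq_card => x; rewrite -!topredE /= /pull_pred cod_fun1 reversing1 addbF.
Qed.

Lemma pull0 m : pull m ord0 = if reversing m then ord_max else ord0.
Proof.
apply: val_inj => /=; case E: reversing => /=.
  by rewrite -[RHS]card_ord; apply: eq_card => x; rewrite -!topredE /= /pull_pred E.
by apply: eq_card0 => x; rewrite -!topredE /= /pull_pred E.
Qed.

Lemma pull_max m : pull m ord_max = if reversing m then ord0 else ord_max.
Proof.
apply: val_inj => /=; case E: reversing => /=.
  by apply: eq_card0 => x; rewrite -!topredE /= /pull_pred E ltn_ord.
by rewrite -[RHS]card_ord; apply: eq_card => x; rewrite -!topredE /= /pull_pred E ltn_ord.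
Qed.

End Pull.

(** * Matrix entries of the elements of the monoid *)

Section Coefficients.
Variables (k : fieldType) (n : nat).
Implicit Types (m : COD n) (P Q V W : {set 'I_n.+1}) (b : bool).

(** The sign with which a reversing element acts on sets of [d] gaps, for the
    character [b] of the group of signs.  The exponent is chosen so that
    consecutive signs differ by [(-1) ^+ d.+1]; this matches the exchange of the
    two outer gaps in [bordered]. *)
Definition weight b m (d : nat) : k :=
  if reversing m then (-1) ^+ (b + 'C(d.+1, 2)) else 1.

Lemma weightM b m m' d : weight b (m * m')%g d = weight b m d * weight b m' d.
Proof.
rewrite /weight reversingM; do 2 case: reversing => /=; rewrite ?mul1r ?mulr1 //.
by rewrite -expr2 sqrr_sign.
Qed.

Lemma weightS b m d :
  weight b m d.+1 = (if reversing m then (-1) ^+ d.+1 else 1) * weight b m d.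
Proof.
rewrite /weight; case: reversing; last by rewrite mulr1.
by rewrite binS bin1 addnA exprD mulrC.
Qed.

(** Images of sets of gaps, where a set is killed if the map is not injective on
    it.  This is a right action by [actM]. *)
Definition act b m P V : k :=
  if (#|V| == #|P|) && (pull m @: P == V) then weight b m #|P| else 0.

Lemma actM b m m' P V :
  act b (m * m')%g P V = \sum_W act b m P W * act b m' W V.
Proof.
rewrite (bigD1 (pull m @: P)) //= big1 ?addr0 => [|W /negPf neW]; last first.
  by rewrite /act [_ == W]eq_sym neW andbF mul0r.
rewrite /act eqxx andbT.
have -> : pull (m * m')%g @: P = pull m' @: (pull m @: P).
  by rewrite -imset_comp; apply: eq_imset => y; rewrite pullM.
have [E|ne] := eqVneq #|pull m @: P| #|P|.
  by rewrite E weightM; case: andP => _; rewrite ?mulr0.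
rewrite mul0r; case: andP => // -[/eqP VP /eqP im].
have := leq_imset_card (pull m') (mem (pull m @: P)).
have := leq_imset_card (pull m) (mem P); rewrite im VP => l1 l2.
by case/eqP: ne; apply/eqP; rewrite eqn_leq l1 l2.
Qed.

Lemma act1 b P V : act b 1%g P V = (P == V)%:R.
Proof.
rewrite /act /weight reversing1.
have -> : pull (1%g : COD n) @: P = P.
  by rewrite -[RHS]imset_id; apply: eq_imset => y; rewrite pull1.
by case: (eqVneq P V) => [->|]; rewrite ?eqxx // andbF.
Qed.

Lemma act_notin b m P V x : x \in P -> pull m x \notin V -> act b m P V = 0.
Proof.
move=> xP; rewrite /act; case: andP => // -[_ /eqP <-].
by rewrite imset_f.
Qed.

Lemma act_setU1 b m x V Q : x \notin V -> pull m x \notin Q ->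
  act b m (x |: V) (pull m x |: Q) =
  (if reversing m then (-1) ^+ #|V|.+1 else 1) * act b m V Q.
Proof.
move=> xV mxQ; rewrite /act !cardsU1 xV mxQ eqSS imsetU1 weightS.
have -> : (#|Q| == #|V|) && (pull m x |: pull m @: V == pull m x |: Q)
  = (#|Q| == #|V|) && (pull m @: V == Q).
  have [QV|//] := eqVneq #|Q| #|V|.
  apply/eqP/eqP => [E|->//]; have mxV : pull m x \notin pull m @: V.
    apply/negP => mxV; have := leq_imset_card (pull m) (mem V).
    suff -> : pull m @: V = pull m x |: Q by rewrite cardsU1 mxQ QV ltnn.
    by rewrite -E; apply/esym/setUidPr; rewrite sub1set.
  by rewrite -(setU1K mxV) E setU1K.
by case: ifP => _; rewrite ?mulr0.
Qed.

Definition inner P : bool := (ord0 \notin P) && (ord_max \notin P).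

Lemma act_inner b m P Q : inner Q -> ~~ inner P -> act b m P Q = 0.
Proof.
move=> /andP[Q0 Qn]; rewrite /inner negb_and !negbK => /orP[] Px.
  by apply: (act_notin b Px); rewrite pull0; case: ifP.
by apply: (act_notin b Px); rewrite pull_max; case: ifP.
Qed.

Lemma act_card b m P Q : #|Q| != #|P| -> act b m P Q = 0.
Proof. by move=> /negPf QP; rewrite /act QP. Qed.

(** Modulo the sets with both outer gaps, [ord0 |: Q] and [ord_max |: Q] represent,
    up to a sign, the same arrow.  Using both symmetrically keeps
    reversal, which swaps the outer gaps, from mixing entries. *)
Definition bordered b m P Q : k :=
  act b m P (ord0 |: Q) + (-1) ^+ #|Q|.+1 * act b m P (ord_max |: Q).

Definition entry b m P Q : k :=
  if #|P| == #|Q| then act b m P Q else bordered b m P Q.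


Lemma sum_setU1 (p : 'I_n.+1) (C : pred {set 'I_n.+1}) (F : {set 'I_n.+1} -> k) :
  \sum_(W : {set 'I_n.+1} | (p \in W) && C W) F W =
  \sum_(V : {set 'I_n.+1} | (p \notin V) && C (p |: V)) F (p |: V).
Proof.
rewrite (reindex_onto (fun V => p |: V) (fun W => W :\ p)) /= => [|W]; last first.
  by case/andP=> pW _; rewrite setD1K.
apply: eq_bigl => V; rewrite setU11 /=.
have [pV|pV] := boolP (p \in V); last by rewrite setU1K ?eqxx ?andbT.
rewrite andbC; apply/negbTE; rewrite negb_and; apply/orP; left.
by apply: contraTneq pV => <-; rewrite !inE eqxx.
Qed.

Lemma sum_by_ends (F : {set 'I_n.+1} -> k) : (0 < n)%N ->
  (forall W : {set 'I_n.+1}, ord0 \in W -> ord_max \in W -> F W = 0) ->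
  \sum_W F W =
  \sum_(V | inner V) (F V + (F (ord0 |: V) + F (ord_max |: V))).
Proof.
move=> n_gt0 F0.
have ends : ord0 != ord_max :> 'I_n.+1 by rewrite -val_eqE /= eq_sym -lt0n.
have -> : \sum_W F W = \sum_(W | inner W) F W
    + (\sum_(W : {set 'I_n.+1} | (ord0 \in W) && (ord_max \notin W)) F W
       + \sum_(W : {set 'I_n.+1} | (ord_max \in W) && (ord0 \notin W)) F W).
  rewrite [\sum_(W | inner W) _]big_mkcond [\sum_(W | _ && (_ \notin _)) _]big_mkcond.
  rewrite [\sum_(W | (ord_max \in _) && _) _]big_mkcond -!big_split /=.
  apply: eq_bigr => W _; rewrite /inner.
  have [W0|W0] := boolP (ord0 \in W); have [Wn|Wn] := boolP (ord_max \in W) => /=.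
  - by rewrite F0 // !addr0.
  - by rewrite addr0 add0r.
  - by rewrite !add0r.
  - by rewrite !addr0.
rewrite !big_split /=; congr (_ + (_ + _)); rewrite sum_setU1; apply: eq_bigl => V.
  by rewrite /inner !inE eq_sym (negPf ends).
by rewrite /inner !inE (negPf ends) andbC.
Qed.

(** If [m] is reversing, it sends [ord0] to [ord_max], so the other summand of
    [bordered] contributes, and its sign cancels the one of [weightS]. *)
Lemma bordered_ord0 b m V Q : (0 < n)%N -> inner V -> inner Q ->
  bordered b m (ord0 |: V) Q = act b m V Q.
Proof.
move=> n_gt0 /andP[V0 Vn] /andP[Q0 Qn].
have ends : ord0 != ord_max :> 'I_n.+1 by rewrite -val_eqE /= eq_sym -lt0n.
have := @act_setU1 b m ord0 V Q V0; rewrite /bordered pull0.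
have := @act_notin b m (ord0 |: V) _ ord0 (setU11 _ _); rewrite pull0.
have [QV|ne] := eqVneq #|Q| #|V|; case: reversing => zero eq; rewrite ?QV.
- rewrite zero ?eq // ?inE ?negb_or 1?eq_sym ?ends //.
  by rewrite add0r mulrA -expr2 sqrr_sign mul1r.
- rewrite eq // zero ?inE ?negb_or ?ends //.
  by rewrite mulr0 addr0 mul1r.
- by rewrite zero ?eq // ?inE ?negb_or 1?eq_sym ?ends // act_card // !mulr0 addr0.
- by rewrite eq // zero ?inE ?negb_or ?ends // act_card // !mulr0 addr0.
Qed.

Lemma bordered_max b m V Q : (0 < n)%N -> inner V -> inner Q ->
  bordered b m (ord_max |: V) Q = (-1) ^+ #|Q|.+1 * act b m V Q.
Proof.
move=> n_gt0 /andP[V0 Vn] /andP[Q0 Qn].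
have ends : ord0 != ord_max :> 'I_n.+1 by rewrite -val_eqE /= eq_sym -lt0n.
have := @act_setU1 b m ord_max V Q Vn; rewrite /bordered pull_max.
have := @act_notin b m (ord_max |: V) _ ord_max (setU11 _ _); rewrite pull_max.
have [QV|ne] := eqVneq #|Q| #|V|; case: reversing => zero eq; rewrite ?QV.
- by rewrite eq // zero ?inE ?negb_or ?ends // mulr0 addr0.
- by rewrite zero ?eq // ?inE ?negb_or 1?eq_sym ?ends // add0r mul1r.
- by rewrite eq // zero ?inE ?negb_or ?ends // act_card // !mulr0 addr0.
- by rewrite zero ?eq // ?inE ?negb_or 1?eq_sym ?ends // act_card // !mulr0 addr0.
Qed.

Lemma bordered_both b m W Q : (0 < n)%N -> inner Q ->
  ord0 \in W -> ord_max \in W -> bordered b m W Q = 0.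
Proof.
move=> n_gt0 /andP[Q0 Qn] W0 Wn.
have ends : ord0 != ord_max :> 'I_n.+1 by rewrite -val_eqE /= eq_sym -lt0n.
have := @act_notin b m W _ ord0 W0; have := @act_notin b m W _ ord_max Wn.
rewrite /bordered pull0 pull_max; case: reversing => zn z0.
  rewrite z0 ?zn ?mulr0 ?addr0 // !inE negb_or ?Q0 ?Qn ?andbT //.
  by rewrite eq_sym.
rewrite zn ?z0 ?mulr0 ?addr0 // !inE negb_or ?Q0 ?Qn ?andbT //.
by rewrite eq_sym.
Qed.

(** The positions at which the matrices below may be nonzero: the sizes of [P] and
    [Q] are the ends of a path of length at most one. *)
Definition linked P Q : bool :=
  [&& inner P, inner Q & (#|P| == #|Q|) || (#|P| == #|Q|.+1)].

(** The intermediate set in a nonzero term of [actM] contains at most one outer gap,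
    because outer gaps stay outer.  If it contains one, [m] has crossed the arrow;
    if it contains none, the arrow, if any, is left to [m']. *)
Lemma entryM b m m' P Q : (0 < n)%N -> linked P Q ->
  entry b (m * m')%g P Q =
  \sum_(V | inner V && ((#|V| == #|P|) || (#|V| == #|Q|)))
    entry b m P V * entry b m' V Q.
Proof.
move=> n_gt0 /and3P[Pi Qi /orP[/eqP PQ|/eqP PQ]].
  rewrite {1}/entry PQ eqxx actM [RHS]big_mkcond; apply: eq_bigr => V _ /=.
  rewrite orbb; have [QV|QV] := eqVneq #|V| #|Q|; last first.
    by rewrite andbF (act_card b m') ?mulr0 // eq_sym.
  rewrite andbT; case: ifPn => Vi; first by rewrite /entry PQ QV eqxx.
  by rewrite (act_inner b m' Qi Vi) mulr0.
have neq : (#|Q|.+1 == #|Q|) = false by rewrite eqn_leq ltnn.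
have neq' : (#|Q| == #|Q|.+1) = false by rewrite eq_sym.
rewrite {1}/entry PQ neq /bordered !actM mulr_sumr -big_split /=.
transitivity (\sum_W act b m P W * bordered b m' W Q).
  by apply: eq_bigr => W _; rewrite /bordered mulrDr; congr (_ + _); rewrite mulrCA.
rewrite (sum_by_ends n_gt0) => [|W W0 Wn]; last first.
  by rewrite (bordered_both b m' n_gt0 Qi W0 Wn) mulr0.
rewrite big_mkcond [RHS]big_mkcond; apply: eq_bigr => V _; case: ifP => //= Vi.
rewrite bordered_ord0 // bordered_max // mulrCA mulrA -mulrDl.
have [VP|VP] := eqVneq #|V| #|Q|.+1 => /=.
  rewrite /entry VP PQ eqxx neq (act_card b m' (P := V)) ?mulr0 ?addr0 //.
  by rewrite VP neq'.
rewrite (act_card b m (P := P)) ?PQ // mul0r add0r.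
have [VQ|VQ] := eqVneq #|V| #|Q|; last by rewrite (act_card b m' (P := V)) ?mulr0 // eq_sym.
by rewrite /entry VQ PQ neq eqxx /bordered VQ.
Qed.

Lemma entry1 b P Q : linked P Q -> entry b 1%g P Q = (P == Q)%:R.
Proof.
move=> /and3P[/andP[P0 Pn] _ PQ]; rewrite /entry /bordered !act1.
have [E|ne] := eqVneq #|P| #|Q|; first by [].
have -> : (P == Q) = false by apply: contraNF ne => /eqP ->.
have nP x : x \notin P -> (P == x |: Q) = false.
  by move=> xP; apply: contraNF xP => /eqP ->; rewrite setU11.
by rewrite !nP // mulr0 addr0.
Qed.

End Coefficients.

(** * Maps with a prescribed action on gaps *)

Section Realize.
Variable n : nat.
Hypothesis n_gt0 : (0 < n)%N.
Variable phi : 'I_n.+1 -> nat.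

Let wide (y : 'I_n) : 'I_n.+1 := widen_ord (leqnSn n) y.

(** Inverse of [pull]: the value at [x] is the number of inner gaps [y] with
    [phi y <= x].  The point [0] is added to the counted set, and taken off
    again by the predecessor, to make it an initial segment of ['I_n]. *)
Definition realize_pred (x : nat) : pred 'I_n :=
  fun y => (y == 0 :> nat) || (phi (wide y) <= x)%N.

Fact realize_subproof x : (#|realize_pred x|.-1 < n)%N.
Proof.
by have := max_card (realize_pred x); rewrite card_ord; case: #|_|.
Qed.

Definition realize_fun : transf n := [ffun x : 'I_n => Ordinal (realize_subproof x)].

Fact realize_mono : order_preserving realize_fun.
Proof.
apply/order_preservingP => x x' xx'; rewrite !ffunE /= -!subn1 leq_sub2r //.
apply: subset_leq_card; apply/subsetP => y; rewrite -!topredE /= /realize_pred.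
by case/orP=> [->//|/leq_trans->] //; rewrite orbT.
Qed.

Fact realize_OD : OD_pred realize_fun.
Proof. by rewrite /OD_pred realize_mono. Qed.
Fact realize_COD : COD_pred (MkOD realize_OD, Z2_one).
Proof. by rewrite COD_predE /= realize_mono orbT. Qed.

Definition realize : COD n := MkCOD realize_COD.

Lemma realize_reversing : reversing realize = false.
Proof. by []. Qed.

Lemma pull_realize (y : 'I_n.+1) :
  (forall y y' : 'I_n.+1, (y <= y')%N -> (phi y <= phi y')%N) ->
  (0 < y < n)%N -> (phi y <= n)%N -> pull realize y = phi y :> nat.
Proof.
move=> phi_mono /andP[y0 yn] phiy /=; rewrite -[RHS](@card_ltn_ord n) //.
apply: eq_card => x; rewrite !inE -!topredE /= /pull_pred realize_reversing addbF.
rewrite /cod_fun /= ffunE /=.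
have dP (z z' : 'I_n) : (z <= z')%N -> realize_pred x z' -> realize_pred x z.
  rewrite /realize_pred => zz' /orP[/eqP z0|le]; first by rewrite (_ : z == 0 :> nat) //; lia.
  by rewrite (leq_trans _ le) ?orbT // phi_mono.
have c0 : (0 < #|realize_pred x|)%N.
  by rewrite -(initial_segment dP (Ordinal n_gt0)) /realize_pred eqxx.
have := initial_segment dP (Ordinal yn); rewrite {1}/realize_pred /= gtn_eqF //=.
have -> : wide (Ordinal yn) = y by apply: val_inj.
by move: c0; case: #|_| => // c _; rewrite ltnS /= => E; apply/idP/idP; lia.
Qed.

End Realize.

(** * Alternating sums of toggled maps *)

Section Hypercube.
Variables (k : fieldType) (n : nat).
Hypothesis n_gt0 : (0 < n)%N.
Variables D U : {set 'I_n.+1}.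
Hypothesis U0 : ord0 \notin U.
Hypothesis cardU : #|U| = #|D|.
Implicit Types (P V Q Z : {set 'I_n.+1}) (y : 'I_n.+1).

(** Let [t_1 < ... < t_e] list [D] and [u_1 < ... < u_e] list [U], with [u_0 = 0].  For a
    subset [Z] of [D], [toggle Z] sends [t_i] to [u_i], or to [u_(i-1)] if [t_i] is in
    [Z], and every gap strictly between [t_i] and [t_(i+1)] to [u_i].  It is
    monotone for each [Z]. *)
Definition rank y : nat := #|[set t in D | (t <= y)%N]|.
Definition level (i : nat) : 'I_n.+1 := nth ord0 (ord0 :: enum U) i.
Definition toggle Z y : 'I_n.+1 := level (rank y - (y \in Z)).

Lemma level_lt i j : (i < j <= #|U|)%N -> (level i < level j)%N.
Proof.
move=> /andP[ij jU].
have inc : sorted ltn (map val (enum U)).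
  rewrite -[enum _](eq_filter (mem_enum _)).
  rewrite -(eq_filter (mem_map val_inj _)) -filter_map.
  by rewrite (sorted_filter ltn_trans) // unlock val_ord_enum iota_ltn_sorted.
have srt : sorted ltn (map val (ord0 :: enum U)).
  rewrite /= path_min_sorted //; apply/allP => _ /mapP[u uU ->] /=.
  rewrite lt0n; apply: contraNneq U0 => u0; rewrite mem_enum in uU.
  by rewrite (_ : ord0 = u) //; apply: val_inj.
have sz : size (ord0 :: enum U) = #|U|.+1 by rewrite /= -cardE.
have iU : (i < #|U|.+1)%N by rewrite ltnS (leq_trans (ltnW ij)).
have E l : (l < #|U|.+1)%N -> level l = nth 0%N (map val (ord0 :: enum U)) l :> nat.
  by move=> lU; rewrite (nth_map ord0) ?sz.
rewrite !E //; apply: (sorted_ltn_nth ltn_trans 0%N srt) => //;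
  by rewrite inE size_map sz.
Qed.

Lemma level_mem i : (0 < i <= #|U|)%N -> level i \in U.
Proof.
case: i => // i /andP[_ iU]; rewrite /level /= -mem_enum mem_nth //.
by rewrite -cardE.
Qed.

Lemma level_memU i : (i <= #|U|)%N -> level i \in ord0 |: U.
Proof.
case: i => [_|i iU]; first by rewrite /level /= setU11.
by rewrite !inE level_mem ?orbT.
Qed.

Lemma rank_le y : (rank y <= #|U|)%N.
Proof. by rewrite cardU subset_leq_card //; apply/subsetP => t /[!inE]/andP[]. Qed.

Lemma rank_mono y y' : (y <= y')%N -> (rank y <= rank y')%N.
Proof.
move=> yy'; apply/subset_leq_card/subsetP => t /[!inE]/andP[-> /=].
by move/leq_trans; apply.
Qed.

Lemma rank_lt y y' : y' \in D -> (y < y')%N -> (rank y < rank y')%N.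
Proof.
move=> y'D yy'; apply: proper_card; apply/properP; split.
  by apply/subsetP => t /[!inE]/andP[-> /=] ty; rewrite (leq_trans ty) // ltnW.
by exists y'; rewrite !inE y'D ?leqnn // -ltnNge.
Qed.

Lemma rank_gt0 y : y \in D -> (0 < rank y)%N.
Proof. by move=> yD; apply/card_gt0P; exists y; rewrite !inE yD leqnn. Qed.

Lemma level_le i j : (i <= j <= #|U|)%N -> (level i <= level j)%N.
Proof.
by case/andP; rewrite leq_eqVlt => /orP[/eqP->//|ij jU]; rewrite ltnW // level_lt ?ij.
Qed.

Lemma toggle_mono Z y y' : Z \subset D -> (y <= y')%N -> (toggle Z y <= toggle Z y')%N.
Proof.
move=> ZD yy'; have rU := rank_le y'; apply: level_le.
have r := rank_mono yy'.
apply/andP; split; last by rewrite (leq_trans (leq_subr _ _)).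
have [y'Z|y'Z] := boolP (y' \in Z); last by rewrite subn0 (leq_trans (leq_subr _ _)).
move: yy'; rewrite leq_eqVlt => /orP[/eqP/val_inj->|lt]; first by rewrite y'Z.
have := rank_lt (subsetP ZD _ y'Z) lt; case: (y \in Z); lia.
Qed.

Definition toggled Z : COD n := realize n_gt0 (fun y => toggle Z y).

Lemma inner_gap P y : inner P -> y \in P -> (0 < y < n)%N.
Proof.
move=> /andP[P0 Pn] yP; rewrite lt0n ltn_neqAle -ltnS ltn_ord andbT.
apply/andP; split; apply/eqP => E.
  by move: P0; rewrite (_ : ord0 = y) ?yP //; apply: val_inj.
by move: Pn; rewrite (_ : ord_max = y) ?yP //; apply: val_inj.
Qed.

Lemma pull_toggled Z P : Z \subset D -> inner P -> {in P, pull (toggled Z) =1 toggle Z}.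
Proof.
move=> ZD Pi y yP; apply: val_inj; apply: pull_realize.
- by move=> z z'; apply: toggle_mono.
- exact: inner_gap yP.
- by rewrite -ltnS ltn_ord.
Qed.

(** Toggles preserve order, so that both characters give the same entries and one
    of them can be fixed. *)
Definition hypercube (P V : {set 'I_n.+1}) : k :=
  \sum_(Z : {set 'I_n.+1} | Z \subset D) (-1) ^+ #|Z| * act k false (toggled Z) P V.

Lemma act_toggled b Z P V : Z \subset D -> inner P ->
  act k b (toggled Z) P V = ((#|V| == #|P|) && (toggle Z @: P == V))%:R.
Proof.
move=> ZD Pi; rewrite /act /weight realize_reversing.
rewrite (eq_in_imset (pull_toggled ZD Pi)); by case: ifP.
Qed.

Lemma toggle_memU Z y : toggle Z y \in ord0 |: U.
Proof. by rewrite level_memU // (leq_trans (leq_subr _ _)) // rank_le. Qed.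

Lemma toggle_set0_inj : {in D &, injective (toggle set0)}.
Proof.
move=> y y' yD y'D; rewrite /toggle !inE !subn0 => E; apply/eqP; move: E.
apply: contra_eqT; rewrite -val_eqE neq_ltn => /orP[lt|lt]; rewrite -val_eqE neq_ltn.
  by rewrite level_lt // rank_lt ?rank_le.
by rewrite orbC level_lt // rank_lt ?rank_le.
Qed.

Lemma toggle_full_inj : {in D &, injective (toggle D)}.
Proof.
move=> y y' yD y'D; rewrite /toggle yD y'D => E; apply/eqP; move: E.
have := rank_gt0 yD; have := rank_gt0 y'D; have := rank_le y; have := rank_le y'.
move=> ? ? ? ?; apply: contra_eqT.
rewrite -val_eqE neq_ltn => /orP[lt|lt]; rewrite -val_eqE neq_ltn.
  by rewrite level_lt //; have := rank_lt y'D lt; lia.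
by rewrite orbC level_lt //; have := rank_lt yD lt; lia.
Qed.

(** Two comparable toggles with the same image of [D] are equal, because the sum of
    the values over [D] drops whenever a point is added to [Z]. *)
Lemma toggle_uniq Z Z' : Z \subset Z' -> Z' \subset D ->
  #|toggle Z @: D| = #|D| -> toggle Z @: D = toggle Z' @: D -> Z = Z'.
Proof.
move=> ZZ' Z'D cZ E; have ZD := subset_trans ZZ' Z'D.
have injZ : {in D &, injective (toggle Z)} by apply/imset_injP/eqP.
have injZ' : {in D &, injective (toggle Z')} by apply/imset_injP; rewrite -E cZ.
have : (\sum_(y in D) toggle Z' y <= \sum_(y in D) toggle Z y
        ?= iff [forall (y | y \in D), (y \in Z) == (y \in Z')])%N.
  apply: leqif_sum => y yD; rewrite /toggle.
  have [yZ|yZ] := boolP (y \in Z); first by rewrite (subsetP ZZ' _ yZ); apply/leqif_refl.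
  have [yZ'|yZ'] := boolP (y \in Z'); last exact/leqif_refl.
  apply/leqifP => /=; rewrite level_lt // subn0 rank_le andbT subn1 prednK //.
  exact: rank_gt0.
case=> _; rewrite -(big_imset (fun w : 'I_n.+1 => val w) injZ).
rewrite -(big_imset (fun w : 'I_n.+1 => val w) injZ') E eqxx => /esym/forall_inP same.
apply/setP => y; have [/same/eqP//|yD] := boolP (y \in D).
by rewrite (contraNF (subsetP ZD y) yD) (contraNF (subsetP Z'D y) yD).
Qed.

Lemma toggle_set0_img : toggle set0 @: D = U.
Proof.
apply/eqP; rewrite eqEcard (card_in_imset toggle_set0_inj) cardU leqnn andbT.
apply/subsetP => _ /imsetP[y yD ->]; rewrite /toggle inE subn0 level_mem //.
by rewrite rank_gt0 ?rank_le.
Qed.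

Lemma entry_hypercube b P Q : linked P Q ->
  \sum_(Z : {set 'I_n.+1} | Z \subset D) (-1) ^+ #|Z| * entry k b (toggled Z) P Q =
  if #|P| == #|Q| then hypercube P Q
  else hypercube P (ord0 |: Q) + (-1) ^+ #|Q|.+1 * hypercube P (ord_max |: Q).
Proof.
move=> /and3P[Pi _ _].
have E V : \sum_(Z : {set 'I_n.+1} | Z \subset D) (-1) ^+ #|Z| * act k b (toggled Z) P V
    = hypercube P V.
  by apply: eq_bigr => Z ZD; rewrite !act_toggled.
rewrite /entry; case: eqP => _; first exact: E.
rewrite -!E mulr_sumr -big_split; apply: eq_bigr => Z _ /=.
by rewrite mulrDr; congr (_ + _); rewrite mulrCA.
Qed.

Hypothesis inD : inner D.
Hypothesis two_neq0 : (2%:R : k) != 0.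

(** A point [t] of [D] outside [P] can be toggled without changing the images of
    [P], so the terms cancel in pairs. *)
Lemma hypercube_unseen P V : inner P -> ~~ (D \subset P) -> hypercube P V = 0.
Proof.
move=> Pi /subsetPn[t tD tP].
pose flip Z := if t \in Z then Z :\ t else t |: Z.
have flipK : involutive flip.
  move=> Z; rewrite /flip; have [tZ|tZ] := boolP (t \in Z); last by rewrite setU11 setU1K.
  by rewrite setD11 setD1K.
have flipD Z : (flip Z \subset D) = (Z \subset D).
  rewrite /flip; case: ifP => tZ; last by rewrite subUset sub1set tD.
  apply/idP/idP => [sZ|]; last exact: subset_trans (subD1set _ _).
  by rewrite -(setD1K tZ) subUset sub1set tD.
have : hypercube P V = - hypercube P V.
  rewrite {1}/hypercube (reindex_inj (inv_inj flipK)) /=.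
  rewrite (eq_bigl _ _ flipD) /hypercube -sumrN; apply: eq_bigr => Z ZD.
  rewrite !act_toggled ?flipD //.
  have -> : toggle (flip Z) @: P = toggle Z @: P.
    apply: eq_in_imset => y yP; rewrite /toggle; congr (level (_ - _)).
    have yt : y != t by apply: contraNneq tP => <-.
    by rewrite /flip; case: ifP; rewrite !inE (negPf yt).
  rewrite -mulNr; congr (_ * _); rewrite /flip; case: ifP => tZ.
    by rewrite (cardsD1 t Z) tZ exprS mulN1r opprK.
  by rewrite cardsU1 tZ exprS mulN1r.
move/eqP; rewrite -addr_eq0 -mulr2n -mulr_natl mulf_eq0 (negPf two_neq0).
by move/eqP.
Qed.


Lemma hypercube_sum1 V Z0 : Z0 \subset D -> #|V| = #|D| ->
  (forall Z, Z \subset D -> toggle Z @: D = V -> Z = Z0) ->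
  toggle Z0 @: D = V -> hypercube D V = (-1) ^+ #|Z0|.
Proof.
move=> Z0D VD uniq_Z img; rewrite /hypercube (bigD1 Z0) //= big1 => [|Z /andP[ZD ne]].
  by rewrite act_toggled // img VD !eqxx mulr1 addr0.
rewrite act_toggled //; case: andP => [[_ /eqP/(uniq_Z _ ZD) E]|]; last by rewrite mulr0.
by rewrite E eqxx in ne.
Qed.

Lemma hypercube_eq0 P V (c : bool) : inner P ->
  (forall Z, Z \subset D -> D \subset P -> #|V| = #|P| -> toggle Z @: P = V -> c) ->
  ~~ c -> hypercube P V = 0.
Proof.
move=> Pi cP nc; have [DP|DP] := boolP (D \subset P); last by rewrite hypercube_unseen.
rewrite /hypercube big1 // => Z ZD; rewrite act_toggled //.
case: andP => [[/eqP VP /eqP img]|]; last by rewrite mulr0.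
by rewrite (cP Z) in nc.
Qed.

Lemma toggle_imgS Z P : toggle Z @: P \subset ord0 |: U.
Proof. by apply/subsetP => _ /imsetP[y _ ->]; apply: toggle_memU. Qed.

(** In a term that survives, [P] contains [D] by [hypercube_unseen], and it is mapped
    injectively into [U], which has the size of [D].  So [P = D] and [V = U], and
    the empty [Z] is the only one that maps [D] onto [U]. *)
Lemma hypercubeE P V : inner P -> ord0 \notin V ->
  hypercube P V = ((P == D) && (V == U))%:R.
Proof.
move=> Pi V0; have [/andP[/eqP-> /eqP->]|nPV] := boolP ((P == D) && (V == U)).
  rewrite (@hypercube_sum1 U set0) ?sub0set ?cards0 ?toggle_set0_img //.
  move=> Z ZD img; apply/esym/toggle_uniq; rewrite ?sub0set ?img //;
    by rewrite toggle_set0_img.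
apply: hypercube_eq0 nPV => // Z ZD DP VP img.
have VU : V \subset U.
  apply/subsetP => v vV; have := subsetP (toggle_imgS Z P) v; rewrite img => /(_ vV).
  by rewrite !inE => /orP[/eqP v0|//]; rewrite -v0 vV in V0.
have VUc := subset_leq_card VU; have DPc := subset_leq_card DP.
rewrite eq_sym eqEcard DP eqEcard VU cardU -VP VP.
by rewrite DPc andbT -VP -cardU VUc.
Qed.

(** If the largest element of [U] is the outer gap, then toggling all of [D] maps
    it onto [U] with that gap replaced by [ord0], and no other [Z] does. *)
Lemma hypercube_ord0E P V : inner P -> ord_max \in U -> ord0 \in V -> ord_max \notin V ->
  hypercube P V = (-1) ^+ #|D| * ((P == D) && (V == ord0 |: U :\ ord_max))%:R.
Proof.
move=> Pi Un V0 Vn; have U0n : ord0 \notin U :\ ord_max by rewrite !inE negb_and U0 orbT.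
have cU : #|ord0 |: U :\ ord_max| = #|D|.
  by rewrite cardsU1 U0n -cardU [in RHS](cardsD1 ord_max) Un.
have full_img : toggle D @: D = ord0 |: U :\ ord_max.
  apply/eqP; rewrite eqEcard (card_in_imset toggle_full_inj) cU leqnn andbT.
  apply/subsetP => _ /imsetP[y yD ->]; have := toggle_memU D y.
  rewrite !inE => /orP[->//|->]; rewrite andbT; apply/orP; right.
  have lt : (toggle D y < level (rank y))%N.
    by rewrite /toggle yD subn1 level_lt // rank_le andbT prednK // rank_gt0.
  by rewrite -val_eqE neq_ltn /= (leq_trans lt) // -ltnS ltn_ord.
have [/andP[/eqP-> /eqP->]|nPV] := boolP ((P == D) && (V == ord0 |: U :\ ord_max)).
  rewrite mulr1 (@hypercube_sum1 _ D) // => Z ZD img.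
  by apply: toggle_uniq; rewrite ?img.
rewrite mulr0; apply: hypercube_eq0 nPV => // Z ZD DP VP img.
have VU : V \subset ord0 |: U :\ ord_max.
  apply/subsetP => v vV; have := subsetP (toggle_imgS Z P) v; rewrite img => /(_ vV).
  rewrite !inE => /orP[->//|->]; rewrite andbT orbC.
  by rewrite (contraNneq _ Vn) // => <-.
have VUc := subset_leq_card VU; have DPc := subset_leq_card DP.
by rewrite eq_sym eqEcard DP eqEcard VU cU VP DPc andbT -VP -cU VUc.
Qed.

End Hypercube.

(** * All matrix units are attained *)

Section MonoidAlgebraExtension.
Variables (k : fieldType) (M : finMonoidType).
Local Notation A := (monoid_alg k M).

Definition basis_elt (x : M) : A := [ffun y => (y == x)%:R].

Lemma monoid_alg_sumM (V : lmodType k) (c : M -> V) (f g : A) :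
  \sum_x (f * g) x *: c x = \sum_x \sum_y (f x * g y) *: c (x * y)%g.
Proof.
transitivity (\sum_x \sum_y \sum_(z | (y * z)%g == x) (f y * g z) *: c (y * z)%g).
  apply: eq_bigr => x _; rewrite [(f * g) x]monoid_alg_mulE scaler_suml.
  apply: eq_bigr => y _; rewrite scaler_suml; apply: eq_bigr => z /eqP yz.
  by rewrite yz.
rewrite exchange_big; apply: eq_bigr => y _ /=.
rewrite (exchange_big_dep xpredT) //=; apply: eq_bigr => z _.
by rewrite (big_pred1 (y * z)%g) // => x; rewrite eq_sym.
Qed.

Lemma sum_basis_elt (V : lmodType k) (c : M -> V) (x : M) :
  \sum_y basis_elt x y *: c y = c x.
Proof.
rewrite (bigD1 x) //= ffunE eqxx scale1r big1 ?addr0 // => y /negPf yx.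
by rewrite ffunE yx scale0r.
Qed.

Lemma monoid_alg_oneE : (1 : A) = basis_elt 1%g.
Proof. by []. Qed.

End MonoidAlgebraExtension.

Section Surjectivity.
Variables (k : fieldType) (n : nat).
Hypothesis n_gt0 : (0 < n)%N.
Hypothesis two_neq0 : (2%:R : k) != 0.
Local Notation A := (monoid_alg k (COD n)).
Implicit Types (b : bool) (P Q : {set 'I_n.+1}) (a : A).

Definition entryA b a P Q : k := \sum_m a m * entry k b m P Q.

Lemma entryA_linear b P Q : linear (fun a => entryA b a P Q : k^o).
Proof.
move=> c f g; rewrite /entryA /GRing.scale /= mulr_sumr -big_split.
by apply: eq_bigr => m _; rewrite monoid_algD monoid_algZ mulrDl mulrA.
Qed.

Lemma entryAD b P Q a a' : entryA b (a + a') P Q = entryA b a P Q + entryA b a' P Q.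
Proof. by have := entryA_linear b P Q 1 a a'; rewrite !scale1r. Qed.
Lemma entryA0 b P Q : entryA b 0 P Q = 0.
Proof. by rewrite /entryA big1 // => m _; rewrite ffunE mul0r. Qed.
Lemma entryAZ b P Q (c : k) a : entryA b (c *: a) P Q = c * entryA b a P Q.
Proof. by have := entryA_linear b P Q c a 0; rewrite !addr0 entryA0 addr0. Qed.

Lemma entryA_basis b m P Q : entryA b (basis_elt k m) P Q = entry k b m P Q.
Proof. exact: (sum_basis_elt (fun m => entry k b m P Q : k^o)). Qed.

Lemma entryAM b a a' P Q : linked P Q ->
  entryA b (a * a') P Q =
  \sum_(V | inner V && ((#|V| == #|P|) || (#|V| == #|Q|)))
    entryA b a P V * entryA b a' V Q.
Proof.
move=> PQ; rewrite [LHS](monoid_alg_sumM (fun m => entry k b m P Q : k^o)).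
transitivity (\sum_(V | inner V && ((#|V| == #|P|) || (#|V| == #|Q|)))
    \sum_m \sum_m' a m * a' m' * (entry k b m P V * entry k b m' V Q)).
  rewrite [RHS]exchange_big; apply: eq_bigr => m _ /=.
  rewrite [RHS]exchange_big; apply: eq_bigr => m' _ /=.
  by rewrite entryM // /GRing.scale /= mulr_sumr.
apply: eq_bigr => V _; rewrite /entryA mulr_suml; apply: eq_bigr => m _.
by rewrite mulr_sumr; apply: eq_bigr => m' _; rewrite mulrACA.
Qed.

(** Only linked positions are compared: the other ones do not reach the matrices. *)
Definition attained (c : bool -> {set 'I_n.+1} -> {set 'I_n.+1} -> k) : Prop :=
  exists a, forall b P Q, linked P Q -> entryA b a P Q = c b P Q.

Lemma attained_ext c d : attained c ->
  (forall b P Q, linked P Q -> c b P Q = d b P Q) -> attained d.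
Proof. by move=> [a ac] cd; exists a => b P Q PQ; rewrite ac ?cd. Qed.

Lemma attained_lin (x : k) c d : attained c -> attained d ->
  attained (fun b P Q => x * c b P Q + d b P Q).
Proof.
move=> [a ac] [a' a'd]; exists (x *: a + a') => b P Q PQ.
by rewrite entryAD entryAZ ac ?a'd.
Qed.

Lemma attained0 : attained (fun _ _ _ => 0).
Proof. by exists 0 => b P Q _; rewrite entryA0. Qed.

Lemma attained_sum (I : Type) (r : seq I) (C : pred I) (x : I -> k)
    (c : I -> bool -> {set 'I_n.+1} -> {set 'I_n.+1} -> k) :
  (forall i, C i -> attained (c i)) ->
  attained (fun b P Q => \sum_(i <- r | C i) x i * c i b P Q).
Proof.
move=> ac; elim: r => [|i r [a IH]].
  by exists 0 => b P Q PQ; rewrite entryA0 big_nil.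
have [Ci|nCi] := boolP (C i); last first.
  by exists a => b P Q PQ; rewrite IH // big_cons (negPf nCi).
have [a' a'c] := ac i Ci; exists (x i *: a' + a) => b P Q PQ.
by rewrite entryAD entryAZ a'c // IH // big_cons Ci.
Qed.

Definition unit_at (P0 Q0 : {set 'I_n.+1}) (b : bool) P Q : k := ((P == P0) && (Q == Q0))%:R.

Lemma attained_hypercube (D U : {set 'I_n.+1}) : 
  attained (fun b P Q => \sum_(Z : {set 'I_n.+1} | Z \subset D)
    (-1) ^+ #|Z| * entry k b (toggled n_gt0 D U Z) P Q).
Proof.
apply: attained_sum => Z _; exists (basis_elt k (toggled n_gt0 D U Z)).
by move=> b P Q _; rewrite entryA_basis.
Qed.

(** The hypercube from [P0] to [ord_max |: Q0] meets [bordered] twice, with no toggles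
    and with all toggles, and with equal signs.  It is therefore [2] times the
    unit, up to sign, and [2] is invertible. *)
Lemma attained_arrow_unit P0 Q0 : linked P0 Q0 -> #|P0| = #|Q0|.+1 ->
  attained (unit_at P0 Q0).
Proof.
move=> /and3P[P0i /andP[Q00 Q0n] _] PQ0; pose U := ord_max |: Q0.
have ends : ord0 != ord_max :> 'I_n.+1 by rewrite -val_eqE /= eq_sym -lt0n.
have Un : ord_max \in U by rewrite setU11.
have U0 : ord0 \notin U by rewrite !inE negb_or ends.
have cU : #|U| = #|P0| by rewrite cardsU1 Q0n PQ0.
have UQ : U :\ ord_max = Q0 by rewrite setU1K.
pose s : k := (-1) ^+ #|P0|; have ss : s * s = 1 by rewrite -expr2 sqrr_sign.
have := attained_lin (2%:R^-1 * s) (attained_hypercube P0 U) attained0.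
move=> h; apply: (attained_ext h) => b P Q PQ; rewrite addr0.
rewrite (entry_hypercube k n_gt0 U0 cU b PQ).
have [Pi Qi _] := and3P PQ; have [Qo Qn] := andP Qi.
case: eqP => [cPQ|cPQ].
  rewrite (hypercubeE n_gt0 U0 cU P0i two_neq0) // /unit_at.
  have -> : (Q == U) = false by apply: contraNF Qn => /eqP ->.
  have [PP|//] := eqVneq P P0; last by rewrite !andbF mulr0.
  have [QQ|] := eqVneq Q Q0; last by rewrite !andbF mulr0.
  by move: PQ0; rewrite -PP -QQ cPQ => /eqP; rewrite eqn_leq ltnn andbF.
rewrite (hypercube_ord0E n_gt0 U0 cU P0i two_neq0) ?setU11 //; last first.
  by rewrite !inE negb_or eq_sym ends.
rewrite (hypercubeE n_gt0 U0 cU P0i two_neq0) //; last by rewrite !inE negb_or ends.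
rewrite /unit_at UQ.
have eqU x : x \notin Q -> x \notin Q0 -> (x |: Q == x |: Q0) = (Q == Q0).
  by move=> xQ xQ0; apply/eqP/eqP => [E|->//]; rewrite -(setU1K xQ) E setU1K.
rewrite !eqU //; case: andP => [[_ /eqP ->]|]; last by rewrite !mulr0 addr0 mulr0.
by rewrite -PQ0 -/s !mulr1 -mulrA mulrDr ss -mulr2n mulVf.
Qed.

(** The hypercube from [P0] to [Q0] is this unit plus a combination of units at
    positions with [#|P| = #|Q|.+1], which are known to be attained. *)
Lemma attained_diag_unit P0 Q0 : linked P0 Q0 -> #|P0| = #|Q0| ->
  attained (unit_at P0 Q0).
Proof.
move=> /and3P[P0i /andP[Q00 Q0n] _] PQ0; have cU := esym PQ0.
pose beta (p : {set 'I_n.+1} * {set 'I_n.+1}) : k :=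
  hypercube k n_gt0 P0 Q0 p.1 (ord0 |: p.2)
  + (-1) ^+ #|p.2|.+1 * hypercube k n_gt0 P0 Q0 p.1 (ord_max |: p.2).
pose C (p : {set 'I_n.+1} * {set 'I_n.+1}) := linked p.1 p.2 && (#|p.1| == #|p.2|.+1).
have aC : attained (fun b P Q => \sum_(p | C p) beta p * unit_at p.1 p.2 b P Q).
  by apply: attained_sum => p /andP[lp /eqP cp]; apply: attained_arrow_unit.
have := attained_lin (-1) aC (attained_hypercube P0 Q0).
move=> h; apply: (attained_ext h) => b P Q PQ; rewrite (entry_hypercube k n_gt0 Q00 cU b PQ).
have [Pi /andP[Qo Qn] cPQ] := and3P PQ; rewrite mulN1r.
case: eqP => [E|ne].
  rewrite big1 ?oppr0 ?add0r => [|p /andP[_ cp]].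
    by rewrite (hypercubeE n_gt0 Q00 cU P0i two_neq0).
  rewrite /unit_at; case: andP => [[/eqP PP /eqP QQ]|]; last by rewrite mulr0.
  by move: cp; rewrite -PP -QQ E eqn_leq ltnn andbF.
have cPQ' : #|P| == #|Q|.+1 by case/orP: cPQ => // /eqP.
rewrite (bigD1 (P, Q)) /=; last by rewrite /C /= PQ cPQ'.
rewrite {1}/unit_at !eqxx mulr1 big1 ?addr0 => [|p /andP[_ pPQ]]; last first.
  rewrite /unit_at; case: andP => [[/eqP PP /eqP QQ]|]; last by rewrite mulr0.
  by case/eqP: pPQ; rewrite [p]surjective_pairing PP QQ.
rewrite /beta /= addNr /unit_at; case: andP => // -[/eqP PP /eqP QQ].
by case: ne; rewrite PP QQ.
Qed.

Lemma attained_unit P0 Q0 : linked P0 Q0 -> attained (unit_at P0 Q0).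
Proof.
move=> l0; have [_ _ /orP[] /eqP c] := and3P l0.
  exact: attained_diag_unit.
exact: attained_arrow_unit.
Qed.

End Surjectivity.

Section Flip.
Variable n : nat.

Definition flip_fun : transf n := [ffun x : 'I_n => rev_ord x].

Fact flip_reversing : order_reversing flip_fun.
Proof. by apply/order_reversingP => x y xy; rewrite !ffunE leq_sub2l. Qed.
Fact flip_OD : OD_pred flip_fun.
Proof. by rewrite /OD_pred flip_reversing orbT. Qed.
Fact flip_COD : COD_pred (MkOD flip_OD, Z2_opp).
Proof. by rewrite COD_predE /= flip_reversing orbT. Qed.
Definition flip : COD n := MkCOD flip_COD.

Lemma pull_flip (y : 'I_n.+1) : pull flip y = rev_ord y.
Proof.
apply: val_inj => /=; rewrite subSS -[RHS](@card_ltn_ord n) ?leq_subr //.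
apply: eq_card => x; rewrite !inE -!topredE /= /pull_pred /cod_fun /= ffunE /= addbT.
have := ltn_ord x; have := ltn_ord y; lia.
Qed.
End Flip.

Section AllAttained.
Variables (k : fieldType) (n : nat).
Hypothesis n_gt0 : (0 < n)%N.
Hypothesis two_neq0 : (2%:R : k) != 0.
Implicit Types (b : bool) (P Q : {set 'I_n.+1}).

Lemma rev_setK : involutive (fun P => @rev_ord n.+1 @: P).
Proof.
move=> P; rewrite -imset_comp -[RHS]imset_id; apply: eq_imset => y.
exact: rev_ordK.
Qed.

Lemma rev_set_inner P : inner (@rev_ord n.+1 @: P) = inner P.
Proof.
have r0 : rev_ord ord0 = ord_max :> 'I_n.+1 by apply: val_inj; rewrite /= subn1.
have mem y : (y \in @rev_ord n.+1 @: P) = (rev_ord y \in P).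
  by rewrite -{1}[y]rev_ordK mem_imset //; apply: rev_ord_inj.
by rewrite /inner !mem r0 -r0 rev_ordK andbC.
Qed.

Lemma card_rev_set P : #|@rev_ord n.+1 @: P| = #|P|.
Proof. by rewrite card_imset //; apply: rev_ord_inj. Qed.

(** The reversal of ['I_n] acts by a monomial matrix: it preserves the set of inner
    gaps, so [bordered] does not contribute. *)
Lemma entry_flip b P Q : linked P Q ->
  entry k b (flip n) P Q =
  (-1) ^+ (b + 'C(#|P|.+1, 2)) * (P == @rev_ord n.+1 @: Q)%:R.
Proof.
move=> /and3P[Pi Qi PQ].
have actE V : act k b (flip n) P V =
    (-1) ^+ (b + 'C(#|P|.+1, 2)) * (P == @rev_ord n.+1 @: V)%:R.
  rewrite /act /weight /= (eq_imset _ (@pull_flip n)) (inv_eq rev_setK).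
  have [->|_] := eqVneq P; last by rewrite andbF mulr0.
  by rewrite card_rev_set eqxx mulr1.
have Pinner V : inner P -> ~~ inner V -> act k b (flip n) P V = 0.
  rewrite actE => Pi' /negP Vi; case: eqP => [E|_]; last by rewrite mulr0.
  by case: Vi; rewrite -rev_set_inner -E.
rewrite /entry; case: eqP => [_|ne]; first exact: actE.
have Q0 : ~~ inner (ord0 |: Q) by rewrite /inner setU11.
have Qn : ~~ inner (ord_max |: Q) by rewrite /inner setU11 andbF.
rewrite /bordered !Pinner // mulr0 addr0.
case: eqP => [E|_]; last by rewrite mulr0.
by case: ne; rewrite E card_rev_set.
Qed.

(** Order-preserving maps do not distinguish the two characters [b].  Multiplying by
    the reversal brings in the sign [(-1) ^+ b]. *)
Definition twisted_unit P0 Q0 b P Q : k := (-1) ^+ b * unit_at k P0 Q0 b P Q.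

Lemma linked_rev P Q : linked P (@rev_ord n.+1 @: Q) = linked P Q.
Proof. by rewrite /linked rev_set_inner card_rev_set. Qed.

Lemma attained_twisted P0 Q0 : linked P0 Q0 -> attained (twisted_unit P0 Q0).
Proof.
move=> l0; pose Q1 := @rev_ord n.+1 @: Q0.
have l1 : linked P0 Q1 by rewrite linked_rev.
have [a aE] := attained_unit n_gt0 two_neq0 l1.
exists ((-1) ^+ 'C(#|Q0|.+1, 2) *: (a * basis_elt k (flip n))) => b P Q PQ.
rewrite entryAZ entryAM //; have [Pi Qi PQc] := and3P PQ.
have lVQ V : inner V && ((#|V| == #|P|) || (#|V| == #|Q|)) -> linked V Q.
  move=> /andP[Vi c]; rewrite /linked Vi Qi /=.
  by case/orP: c => /eqP ->; rewrite ?eqxx.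
have lPV V : inner V && ((#|V| == #|P|) || (#|V| == #|Q|)) -> linked P V.
  move=> /andP[Vi c]; rewrite /linked Vi Pi /=.
  by case/orP: c => /eqP ->; rewrite ?eqxx.
pose Q' := @rev_ord n.+1 @: Q.
rewrite (bigD1 Q') /=; last by rewrite rev_set_inner Qi card_rev_set eqxx orbT.
rewrite big1 ?addr0 => [|V /andP[cV VQ']]; last first.
  by rewrite entryA_basis entry_flip ?lVQ // (negPf VQ') !mulr0.
rewrite entryA_basis entry_flip ?linked_rev; last first.
  by rewrite lVQ // rev_set_inner Qi card_rev_set eqxx orbT.
rewrite aE ?linked_rev // eqxx mulr1 card_rev_set /twisted_unit /unit_at.
rewrite (inj_eq (inv_inj rev_setK)).
case: andP => [[_ /eqP->]|_]; last by rewrite mul0r !mulr0.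
by rewrite mul1r mulr1 exprD mulrCA -expr2 sqrr_sign mulr1.
Qed.

Lemma attained_unit_on b0 P0 Q0 : linked P0 Q0 ->
  attained (fun b P Q => (b == b0)%:R * unit_at k P0 Q0 b P Q).
Proof.
move=> l0; have a1 := attained_unit n_gt0 two_neq0 l0.
have a2 := attained_twisted l0.
have h := attained_lin (2%:R^-1 * (-1) ^+ b0) a2 (attained_lin (2%:R^-1) a1 (attained0 _ _)).
apply: (attained_ext h) => b P Q _; rewrite addr0 /twisted_unit !mulrA -mulrDl.
congr (_ * _); rewrite -mulrA -{2}[2%:R^-1]mulr1 -mulrDr -signr_addb.
by clear h; case: b; case: b0 => /=; rewrite ?expr0 ?expr1 ?addNr ?mulr0 // -mulr2n mulVf.
Qed.

Theorem attained_all c : @attained k n c.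
Proof.
pose I := (bool * ({set 'I_n.+1} * {set 'I_n.+1}))%type.
have h := @attained_sum k n I (index_enum I) (fun i => linked i.2.1 i.2.2)
  (fun i => c i.1 i.2.1 i.2.2)
  (fun i b P Q => (b == i.1)%:R * unit_at k i.2.1 i.2.2 b P Q)
  (fun i li => attained_unit_on i.1 li).
apply: (attained_ext h) => b P Q PQ.
rewrite (bigD1 (b, (P, Q))) //= /unit_at !eqxx !mulr1 big1 ?addr0 //.
move=> [b' [P' Q']] /andP[_]; rewrite -natrM mulnb !xpair_eqE /= => ne.
by rewrite [b == _]eq_sym [P == _]eq_sym [Q == _]eq_sym (negPf ne) mulr0.
Qed.

End AllAttained.

(** * Counting the elements of the monoid *)

Section Transversal.
Variable n : nat.
Implicit Types f g : 'I_n -> 'I_n.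

Definition fibre_minima f : {set 'I_n} :=
  [set x : 'I_n | [forall z : 'I_n, (z < x)%N ==> (f z != f x)]].

Lemma fibre_minimaP f (x : 'I_n) :
  reflect (forall z : 'I_n, (z < x)%N -> f z <> f x) (x \in fibre_minima f).
Proof.
rewrite inE; apply: (iffP forallP) => [h z zx|h z]; last first.
  by apply/implyP => zx; apply/eqP; apply: h.
by have /implyP/(_ zx)/eqP := h z.
Qed.

Lemma first_exists f (x : 'I_n) : exists2 y, y \in fibre_minima f & (y <= x)%N /\ f y = f x.
Proof.
have [m] := ubnP x; elim: m x => // m IH x; rewrite ltnS => xm.
have [xF|] := boolP (x \in fibre_minima f); first by exists x.
rewrite inE negb_forall => /existsP[z]; rewrite negb_imply negbK => /andP[zx /eqP fzx].
have [y yF [yz fy]] := IH z (leq_trans zx xm).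
by exists y => //; split; [exact: leq_trans yz (ltnW zx)|rewrite fy].
Qed.

Lemma fibre_minima_img f : f @: fibre_minima f = f @: setT.
Proof.
apply/eqP; rewrite eqEsubset imsetS ?subsetT //=; apply/subsetP => _ /imsetP[x _ ->].
by have [y yF [_ <-]] := first_exists f x; apply: imset_f.
Qed.

Lemma fibre_minima_inj f : {in fibre_minima f &, injective f}.
Proof.
move=> x y xF yF E.
have lt_neq (z w : 'I_n) : w \in fibre_minima f -> (z < w)%N -> f z <> f w.
  by move/fibre_minimaP; apply.
apply: ord_inj; case: (ltngtP x y) => // lt.
  by case: (lt_neq _ _ yF lt).
by case: (lt_neq _ _ xF lt).
Qed.

Lemma card_fibre_minima f : #|fibre_minima f| = #|f @: setT|.
Proof. by rewrite -fibre_minima_img card_in_imset //; apply: fibre_minima_inj. Qed.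

(** Induction on the argument: at a leftmost point of a fibre both functions take
    the least value of the image that is still free, elsewhere they repeat an
    earlier value. *)
Lemma homo_fibre_minima_eq f g : {homo f : x y / (x <= y)%N} ->
  {homo g : x y / (x <= y)%N} ->
  fibre_minima f = fibre_minima g -> f @: setT = g @: setT -> f =1 g.
Proof.
move=> fm gm Fs Im x; have [m] := ubnP x; elim: m x => // m IH x; rewrite ltnS => xm.
have half (f' g' : 'I_n -> 'I_n) : {homo f' : x y / (x <= y)%N} ->
    x \in fibre_minima g' -> f' @: setT = g' @: setT ->
    (forall z : 'I_n, (z < x)%N -> f' z = g' z) -> (f' x <= g' x)%N.
  move=> f'm /fibre_minimaP xF Im' IH'; have : g' x \in f' @: setT by rewrite Im' imset_f.
  case/imsetP => w _ E; rewrite E; apply: f'm; rewrite leqNgt; apply/negP => wx.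
  by apply: (xF _ wx); rewrite -IH'.
have {}IH (z : 'I_n) : (z < x)%N -> f z = g z by move=> zx; apply: IH; apply: leq_trans zx xm.
have [xF|xF] := boolP (x \in fibre_minima f).
  apply/ord_inj/eqP; rewrite eqn_leq half -?Fs //= half //.
  by move=> z /IH.
have [y yF [yx fy]] := first_exists f x; have [y' yF' [yx' gy]] := first_exists g x.
have before (h : 'I_n -> 'I_n) (z : 'I_n) : z \in fibre_minima h ->
    (z <= x)%N -> fibre_minima h = fibre_minima f -> (z < x)%N.
  move=> zF; rewrite leq_eqVlt => /orP[/eqP/ord_inj zx|//] E.
  by rewrite -E -zx zF in xF.
have lt := before f y yF yx erefl; have lt' := before g y' yF' yx' (esym Fs).
have between (h : 'I_n -> 'I_n) (z w : 'I_n) : {homo h : x y / (x <= y)%N} ->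
    h z = h x -> (z <= w)%N -> (w < x)%N -> h w = h x.
  move=> hm hz zw wx; apply/ord_inj/eqP.
  by rewrite eqn_leq hm ?(ltnW wx) //= -hz hm.
have [yy'|y'y] := leqP y y'.
  by rewrite -(between f y y') // IH.
by rewrite -(between g y' y) ?(ltnW y'y) // -IH.
Qed.

End Transversal.

Section Injectivity.
Variables (k : fieldType) (n : nat).
Hypothesis n_gt0 : (0 < n)%N.

Definition straighten (m : COD n) (x : 'I_n) : 'I_n :=
  if reversing m then rev_ord (cod_fun m x) else cod_fun m x.

Lemma straighten_mono m : {homo straighten m : x y / (x <= y)%N}.
Proof.
move=> x y /(cod_fun_mono m); rewrite /straighten; case: reversing => //= le.
by rewrite leq_sub2l.
Qed.

Lemma straighten_inj m m' : reversing m = reversing m' ->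
  straighten m =1 straighten m' -> m = m'.
Proof.
move=> rr st; apply: COD_ext => // x; have := st x; rewrite /straighten -rr.
by case: reversing => // /rev_ord_inj.
Qed.

(** The gaps just above the values and just below the leftmost points, without
    the outer ones.  The smallest point is always leftmost, but the largest value
    may be missed: this is why [code_rows] has the size of [code_cols] or one more,
    as [linked] requires. *)
Definition code_rows (m : COD n) : {set 'I_n.+1} :=
  (lift ord0 @: (straighten m @: setT)) :\ ord_max.
Definition code_cols (m : COD n) : {set 'I_n.+1} :=
  (widen_ord (leqnSn n) @: fibre_minima (straighten m)) :\ ord0.

Let wide := widen_ord (leqnSn n).
Let wide_inj : injective wide.
Proof. by move=> x y xy; apply: ord_inj; move: (congr1 val xy). Qed.

Let wide_fibre_minima m : ord0 |: code_cols m = wide @: fibre_minima (straighten m).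
Proof.
apply: setD1K; apply/imsetP; exists (Ordinal n_gt0); last by apply: val_inj.
by apply/fibre_minimaP => z.
Qed.

Let cols0 m : ord0 \notin code_cols m. Proof. by rewrite !inE eqxx. Qed.
Let rowsn m : ord_max \notin code_rows m. Proof. by rewrite !inE eqxx. Qed.

Let card_cols m : #|code_cols m|.+1 = #|straighten m @: setT|.
Proof. by rewrite -card_fibre_minima -(card_imset _ wide_inj) -wide_fibre_minima cardsU1 cols0. Qed.

Let card_rows m : ((ord_max \in lift ord0 @: (straighten m @: setT)) + #|code_rows m|)%N
  = #|straighten m @: setT|.
Proof. by rewrite -[RHS](card_imset _ (@lift_inj _ ord0)) [RHS](cardsD1 ord_max). Qed.

Lemma code_linked m : linked (code_rows m) (code_cols m).
Proof.
apply/and3P; split.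
- rewrite /inner rowsn andbT; apply/negP => /setD1P[_ /imsetP[x _ /(congr1 val)]].
  by [].
- rewrite /inner cols0 /=; apply/negP => /setD1P[_ /imsetP[x _ /(congr1 val)]] /=.
  by move=> xn; have := ltn_ord x; rewrite -xn ltnn.
have := card_rows m; rewrite -card_cols; case: (_ \in _) => /=; rewrite ?add0n ?add1n.
  by case=> ->; rewrite eqxx.
by move=> ->; rewrite eqxx orbT.
Qed.

Definition index_type := (bool * {p : {set 'I_n.+1} * {set 'I_n.+1} | linked p.1 p.2})%type.

Definition code (m : COD n) : index_type :=
  (reversing m, exist _ (code_rows m, code_cols m) (code_linked m)).

Lemma code_inj : injective code.
Proof.
move=> m m' [rr RR CC]; apply: straighten_inj => //.
apply: homo_fibre_minima_eq; try exact: straighten_mono.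
  by apply: (imset_inj wide_inj); rewrite -!wide_fibre_minima CC.
apply: (imset_inj (@lift_inj _ ord0)).
have cc : #|straighten m @: setT| = #|straighten m' @: setT|.
  by rewrite -!card_cols CC.
have := card_rows m; rewrite cc -card_rows RR => /addIn/eqP.
move=> /eqP nn; have {}nn : (ord_max \in lift ord0 @: (straighten m @: setT)) =
  (ord_max \in lift ord0 @: (straighten m' @: setT)).
  by move: nn; do 2 case: (_ \in _).
have [mn|mn] := boolP (ord_max \in lift ord0 @: (straighten m @: setT)).
  by rewrite -(setD1K mn) -[RHS](setD1K (etrans (esym nn) mn)) -/(code_rows m) RR.
have mn' := mn; rewrite nn in mn'.
have D1id (X : {set 'I_n.+1}) : ord_max \notin X -> X :\ ord_max = X.
  by move=> nX; apply/setP => y; rewrite !inE andb_idl // => yX; apply: contraTneq yX => ->.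
by rewrite -(D1id _ mn) -[RHS](D1id _ mn') -/(code_rows m) RR.
Qed.

Local Notation A := (monoid_alg k (COD n)).

Definition entries (a : A) : {ffun index_type -> k^o} :=
  [ffun y => entryA y.1 a (val y.2).1 (val y.2).2].

Fact entries_linear : linear entries.
Proof. by move=> c a a'; apply/ffunP => y; rewrite !ffunE entryA_linear. Qed.

Definition entriesl : {linear A -> {ffun index_type -> k^o}} :=
  HB.pack entries (GRing.isLinear.Build k A _ *:%R _ entries_linear).

(** By [code_inj] there are at least as many positions as elements of [COD n], so
    that the surjection [attained_all] between spaces with these bases is
    injective. *)
Theorem entryA_inj (two_neq0 : (2%:R : k) != 0) (a : A) :
  (forall b P Q, linked P Q -> entryA b a P Q = 0) -> a = 0.
Proof.
have full : limg (linfun entriesl) = fullv.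
  apply/vspaceP => c; rewrite memvf; apply/memv_imgP.
  pose d b P Q : k := if insub (P, Q) is Some p then c (b, p) else 0.
  have [a' aE] := attained_all n_gt0 two_neq0 d.
  exists a'; rewrite ?memvf // lfunE; apply/ffunP => -[b [[P Q] PQ]].
  rewrite ffunE /= aE // /d insubT //; congr (c (_, _)).
have ker : lker (linfun entriesl) = 0%VS.
  apply/eqP; rewrite -dimv_eq0; have := limg_ker_dim (linfun entriesl) fullv.
  rewrite full capfv !dimvf /dim /= !muln1 => E.
  have := leq_card code code_inj; rewrite -E -[X in (_ <= X)%N]add0n leq_add2r.
  by rewrite leqn0.
move=> a0; have : a \in lker (linfun entriesl).
  rewrite memv_ker lfunE; apply/eqP/ffunP => y; rewrite !ffunE.
  exact/a0/(valP y.2).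
by rewrite ker memv0 => /eqP.
Qed.

End Injectivity.

(** * The matrix representation over two lines *)

Section TwoLines.
Variables (k : fieldType) (n : nat).
Hypothesis n_gt0 : (0 < n)%N.

Definition two_lines := quiver_sum (line_quiver n) (line_quiver n).
Local Notation Q := two_lines.
Definition base_vertex : Q := inl (Ordinal n_gt0).
Local Notation B := (sqzero_alg k base_vertex).
Local Notation A := (monoid_alg k (COD n)).
Local Notation J := (bool * {set 'I_n.+1})%type.

Definition line_of (v : Q) : bool := if v is inr _ then true else false.
Definition level_of (v : Q) : nat := match v with inl i | inr i => val i end.
(** The matrices are indexed by a character of the group of signs, which selects
    the line, and by a set of inner gaps, whose size is the level on that line.
    Indices with an outer gap sit at no vertex and get a zero row and column. *)
Definition at_vertex (j : J) (v : Q) : bool :=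
  [&& inner j.2, j.1 == line_of v & #|j.2| == level_of v].

Lemma vertex_inj v w : line_of v = line_of w -> level_of v = level_of w -> v = w.
Proof. by case: v w => i [] j //= _ /ord_inj ->. Qed.

Lemma line_tgt (e : arrow Q) : line_of (tgt e) = line_of (src e).
Proof. by case: e. Qed.

Lemma level_tgt (e : arrow Q) : level_of (tgt e) = (level_of (src e)).+1.
Proof. by case: e => -[[i j] /= /eqP]. Qed.

Lemma arrow_inj (e f : arrow Q) : src e = src f -> e = f.
Proof.
move=> sef; have tef : tgt e = tgt f.
  by apply: vertex_inj; rewrite ?line_tgt ?level_tgt sef.
case: e f sef tef => -[[i j] h] [] [[i' j'] h'] //= [ii] [jj]; congr (_ _);
  by apply: val_inj; rewrite /= ii jj.
Qed.

(** With [n.+1] gaps, two of them outer, the levels [0 .. n.-1] are those of a line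
    with [n] vertices. *)
Lemma card_inner (P : {set 'I_n.+1}) : inner P -> (#|P| < n)%N.
Proof.
move=> /andP[P0 Pn]; rewrite -ltnS -[X in (_ < X)%N]card_ord -cardsT.
have ends : ord0 != ord_max :> 'I_n.+1 by rewrite -val_eqE /= eq_sym -lt0n.
have := max_card (mem (ord0 |: (ord_max |: P))).
by rewrite !cardsU1 Pn !inE negb_or ends P0 cardsT !card_ord.
Qed.

Definition vertex_at (b : bool) (d : 'I_n) : Q := if b then inr d else inl d.

Lemma line_vertex_at b d : line_of (vertex_at b d) = b.
Proof. by case: b. Qed.
Lemma level_vertex_at b d : level_of (vertex_at b d) = d.
Proof. by case: b. Qed.

Lemma vertex_exists b P : inner P -> exists v, at_vertex (b, P) v.
Proof.
move=> Pi; exists (vertex_at b (Ordinal (card_inner Pi))).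
by rewrite /at_vertex /= Pi line_vertex_at level_vertex_at !eqxx.
Qed.

Lemma arrow_exists b P P' : inner P -> inner P' -> #|P| = #|P'|.+1 ->
  exists e : arrow Q, at_vertex (b, P') (src e) && at_vertex (b, P) (tgt e).
Proof.
move=> Pi P'i PP'.
have h : Ordinal (card_inner Pi) == (Ordinal (card_inner P'i)).+1 :> nat by rewrite /= PP'.
pose a : arrow (line_quiver n) :=
  exist _ (Ordinal (card_inner P'i), Ordinal (card_inner Pi)) h.
exists (if b then inr a else inl a).
by rewrite /at_vertex /= Pi P'i; case: b; rewrite /= !eqxx.
Qed.

Lemma at_vertex_uniq j v w : at_vertex j v -> at_vertex j w -> v = w.
Proof.
move=> /and3P[_ /eqP l /eqP d] /and3P[_ /eqP l' /eqP d'].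
by apply: vertex_inj; rewrite -?l -?l' -?d -?d'.
Qed.

Lemma sum_at_vertex (v : Q) (F : J -> k) :
  \sum_(j | at_vertex j v) F j =
  \sum_(V : {set 'I_n.+1} | inner V && (#|V| == level_of v)) F (line_of v, V).
Proof.
transitivity (\sum_(b | b == line_of v)
    \sum_(V : {set 'I_n.+1} | inner V && (#|V| == level_of v)) F (b, V)).
  rewrite pair_big /=; apply: eq_big => [[b V]|[]] //.
  by rewrite /at_vertex /= andbCA.
by rewrite big_pred1_eq.
Qed.

(** At most one coefficient of [mat_entry a i j] is nonzero: the one at the path of
    length at most one from the vertex of [j] to that of [i]. *)
Definition mat_entry (a : A) (i j : J) : B :=
  ([ffun v => if at_vertex i v && at_vertex j v then entryA j.1 a i.2 j.2 else 0],
   [ffun e => if at_vertex j (src e) && at_vertex i (tgt e)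
              then entryA j.1 a i.2 j.2 else 0]).

Lemma mat_entry1 a i j v : (mat_entry a i j).1 v =
  if at_vertex i v && at_vertex j v then entryA j.1 a i.2 j.2 else 0.
Proof. by rewrite ffunE. Qed.
Lemma mat_entry2 a i j e : (mat_entry a i j).2 e =
  if at_vertex j (src e) && at_vertex i (tgt e) then entryA j.1 a i.2 j.2 else 0.
Proof. by rewrite ffunE. Qed.

Lemma mat_entry_linear i j : linear (fun a => mat_entry a i j).
Proof.
move=> c a b; apply: sqzeroP => x; rewrite !sqzeroE ?mat_entry1 ?mat_entry2;
  by case: ifP; rewrite ?mulr0 ?addr0 // entryAD entryAZ.
Qed.

Lemma linked_loop i j v : at_vertex i v -> at_vertex j v ->
  i.1 = j.1 /\ #|i.2| = #|j.2| /\ linked i.2 j.2.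
Proof.
move=> /and3P[ii /eqP il /eqP id] /and3P[ji /eqP jl /eqP jd].
by rewrite /linked ii ji id jd il jl eqxx.
Qed.

Lemma linked_arrow i j e : at_vertex j (src e) -> at_vertex i (tgt e) ->
  i.1 = j.1 /\ #|i.2| = #|j.2|.+1 /\ linked i.2 j.2.
Proof.
move=> /and3P[ji /eqP jl /eqP jd] /and3P[ii /eqP il /eqP id].
by rewrite /linked ii ji id jd il jl line_tgt level_tgt eqxx orbT.
Qed.

Lemma mat_entryM a b i j :
  mat_entry (a * b) i j = \sum_l mat_entry a i l * mat_entry b l j.
Proof.
apply: sqzeroP => [v|e].
  rewrite sqzero_sum1 mat_entry1; case: ifP => [/andP[iv jv]|nij]; last first.
    rewrite big1 // => l _; rewrite sqzeroM1 !mat_entry1.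
    by move: nij; case: (at_vertex i v) => /= [->|_]; rewrite ?andbF ?mulr0 ?mul0r.
  have [ij [cij lij]] := linked_loop iv jv; rewrite entryAM //.
  transitivity (\sum_(l | at_vertex l v) entryA l.1 a i.2 l.2 * entryA j.1 b l.2 j.2).
    rewrite sum_at_vertex; have /and3P[_ /eqP <- /eqP <-] := jv.
    by apply: eq_bigl => V; rewrite cij orbb.
  rewrite big_mkcond; apply: eq_bigr => l _; rewrite sqzeroM1 !mat_entry1 iv jv andbT /=.
  by case: ifP; rewrite ?mul0r.
rewrite sqzero_sum2 mat_entry2; case: ifP => [/andP[js it]|nij]; last first.
  rewrite big1 // => l _; rewrite sqzeroM2 !mat_entry1 !mat_entry2.
  move: nij; case: (at_vertex j (src e)) => /= [->|_].
    by rewrite andbF mul0r add0r mul0r.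
  by rewrite andbF !mulr0 addr0.
have [ij [cij lij]] := linked_arrow js it; rewrite entryAM //.
pose F (l : J) := entryA l.1 a i.2 l.2 * entryA j.1 b l.2 j.2.
transitivity (\sum_(l | at_vertex l (tgt e)) F l + \sum_(l | at_vertex l (src e)) F l).
  rewrite !sum_at_vertex line_tgt level_tgt; have /and3P[_ /eqP <- /eqP <-] := js.
  rewrite [\sum_(V | inner V && (#|V| == #|j.2|.+1)) _]big_mkcond.
  rewrite [\sum_(V | inner V && (#|V| == #|j.2|)) _]big_mkcond -big_split big_mkcond.
  apply: eq_bigr => V _; rewrite cij; case: (inner V) => /=; last by rewrite addr0.
  have [->|_] := eqVneq #|V| #|j.2|.+1; last by rewrite add0r.
  by rewrite eqn_leq ltnn /= addr0.
rewrite big_mkcond [X in _ + X]big_mkcond -big_split; apply: eq_bigr => l _.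
rewrite sqzeroM2 !mat_entry1 !mat_entry2 js it !andbT.
by congr (_ + _); case: ifP; rewrite ?mul0r.
Qed.

Definition corner_idem (i : J) : B := ([ffun v => (at_vertex i v)%:R], 0).

Definition mat_hom : mxhom A B J :=
  @MxHom k A B J mat_entry mat_entry_linear mat_entryM.

Lemma mat_hom1 i j : mat_entry 1 i j = if i == j then corner_idem i else 0.
Proof.
apply: sqzeroP => [v|e]; rewrite ?mat_entry1 ?mat_entry2 monoid_alg_oneE entryA_basis.
  have [<-|ne] := eqVneq i j.
    rewrite andbb ffunE; case: ifP => // iv.
    have [_ [_ l]] := linked_loop iv iv.
    by rewrite entry1 // eqxx.
  rewrite sqzero01; case: ifP => // /andP[iv jv].
  have [ij [_ l]] := linked_loop iv jv; rewrite entry1 //.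
  case: eqP => // E; case/eqP: ne.
  by rewrite [i]surjective_pairing [j]surjective_pairing ij E.
rewrite (_ : (if i == j then _ else _ : B).2 e = 0); last first.
  by case: ifP; rewrite ffunE.
case: ifP => // /andP[js it]; have [_ [c l]] := linked_arrow js it.
rewrite entry1 //; case: eqP => // E.
by move: c; rewrite E => /eqP; rewrite eqn_leq ltnn andbF.
Qed.

Hypothesis two_neq0 : (2%:R : k) != 0.

Lemma mat_entry_inj a b : (forall i j, mat_entry a i j = mat_entry b i j) -> a = b.
Proof.
move=> ab; apply/eqP; rewrite -subr_eq0; apply/eqP.
apply: (entryA_inj n_gt0 two_neq0) => l P P' PP'; have [Pi P'i c] := and3P PP'.
have -> : entryA l (a - b) P P' = entryA l a P P' - entryA l b P P'.
  by rewrite -scaleN1r entryAD entryAZ mulN1r.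
apply/eqP; rewrite subr_eq0; apply/eqP; have E := ab (l, P) (l, P').
case/orP: c => /eqP c.
  have [v v'] := vertex_exists l P'i.
  have Pv : at_vertex (l, P) v by move: v'; rewrite /at_vertex /= Pi P'i c.
  by move/(congr1 (fun f : B => f.1 v)): E; rewrite !mat_entry1 Pv v'.
have [e he] := arrow_exists l Pi P'i c.
by move/(congr1 (fun f : B => f.2 e)): E; rewrite !mat_entry2 he.
Qed.

Lemma mat_entry_surj (X : J -> J -> B) :
  (forall i j, corner_idem i * X i j * corner_idem j = X i j) ->
  exists a, forall i j, mat_entry a i j = X i j.
Proof.
move=> cX.
pose c (b : bool) (P P' : {set 'I_n.+1}) : k :=
  if #|P| == #|P'| then \sum_(v | at_vertex (b, P') v) (X (b, P) (b, P')).1 v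
  else \sum_(e | at_vertex (b, P') (src e) && at_vertex (b, P) (tgt e))
         (X (b, P) (b, P')).2 e.
have [a aE] := attained_all n_gt0 two_neq0 c.
exists a => -[b P] [b' P']; rewrite -cX; apply: sqzeroP => [v|e].
  rewrite mat_entry1 !sqzeroM1 !ffunE; case: ifP => [/andP[iv jv]|nij]; last first.
    by move: nij; case: at_vertex => /= [->|_]; rewrite ?mulr0 ?mul0r.
  have [/= bb [cPP l]] := linked_loop iv jv.
  rewrite iv jv mul1r mulr1 aE // /c cPP eqxx -bb (big_pred1 v) // => w.
  apply/idP/eqP => [jw|-> //]; last by rewrite bb.
  by apply: (at_vertex_uniq _ jv); rewrite -bb.
rewrite mat_entry2 !sqzeroM2 !ffunE /= !mul0r !mulr0 ?add0r ?addr0.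
case: ifP => [/andP[js it]|nij]; last first.
  by move: nij; case: at_vertex => /= [->|_]; rewrite ?mulr0 ?mul0r.
have [/= bb [cPP l]] := linked_arrow js it.
rewrite js it mul1r mulr1 aE // /c cPP eqn_leq ltnn /= -bb (big_pred1 e) // => f.
apply/andP/eqP => [[fs ft]|->]; last by split; first by rewrite bb.
by apply/arrow_inj/(at_vertex_uniq _ js); rewrite -bb.
Qed.

Definition first_gaps (d : nat) : {set 'I_n.+1} := [set y : 'I_n.+1 | (0 < y <= d)%N].

Lemma card_first_gaps d : (d <= n)%N -> #|first_gaps d| = d.
Proof.
move=> dn; apply/eqP; rewrite -eqSS -[X in X == _]add1n.
have -> : (1 + #|first_gaps d|)%N = #|ord0 |: first_gaps d| by rewrite cardsU1 !inE.
rewrite -[X in _ == X](@card_ltn_ord n.+1) //; apply/eqP/eq_card => y.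
by rewrite !inE -val_eqE /= ltnS; case: (val y).
Qed.

(** One index at each vertex suffices to see that the corner is full. *)
Definition repr_of (v : Q) : J := (line_of v, first_gaps (level_of v)).

Lemma at_repr_of v : at_vertex (repr_of v) v.
Proof.
have lt : (level_of v < n)%N by case: v => i; apply: ltn_ord.
rewrite /at_vertex /= eqxx (card_first_gaps (ltnW lt)) eqxx andbT.
by rewrite /inner !inE /= n_gt0 /= -ltnNge lt.
Qed.

Definition repr_idem (j : J) : B := ([ffun v => (j == repr_of v)%:R], 0).

Lemma repr_idemM j (i : J) : repr_idem j * corner_idem j = repr_idem j.
Proof.
apply: sqzeroP => x; rewrite ?sqzeroM1 ?sqzeroM2 !ffunE; last by rewrite mulr0 mul0r addr0.
by case: eqP => [->|_]; rewrite ?mul0r // at_repr_of mulr1.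
Qed.

Lemma idem_reprM j : corner_idem j * repr_idem j = repr_idem j.
Proof.
apply: sqzeroP => x; rewrite ?sqzeroM1 ?sqzeroM2 !ffunE; last by rewrite mulr0 mul0r addr0.
by case: eqP => [->|_]; rewrite ?mulr0 // at_repr_of mulr1.
Qed.

Lemma repr_idem_sum : \sum_j repr_idem j * repr_idem j = 1.
Proof.
apply: sqzeroP => x; last first.
  rewrite sqzero_sum2 sqzero12 big1 // => j _.
  by rewrite sqzeroM2 !ffunE mulr0 mul0r addr0.
rewrite sqzero_sum1 sqzero11 (bigD1 (repr_of x)) // sqzeroM1 !ffunE eqxx mulr1.
rewrite big1 => [|j /andP[_ /negPf ne]]; first exact: addr0.
by rewrite sqzeroM1 !ffunE ne mul0r.
Qed.

Lemma morita_two_lines : morita_equivalent A B.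
Proof.
apply: (@morita_full_corner k A B J mat_hom corner_idem repr_idem repr_idem).
- exact: mat_hom1.
- exact: mat_entry_inj.
- exact: mat_entry_surj.
- exact: repr_idem_sum.
- by move=> j; apply: repr_idemM.
- exact: idem_reprM.
Qed.

End TwoLines.

Theorem corollary4p15 (k : fieldType) (n : nat) (n_ge1 : (1 <= n)%N)
    (char_not2 : 2%N \notin [pchar k]) :
  is_quiver_of (monoid_alg k (COD n))
    (quiver_sum (line_quiver n) (line_quiver n)) /\
  is_presentation_of (monoid_alg k (COD n))
    (@consecutive_zero k (quiver_sum (line_quiver n) (line_quiver n))).
Proof.
have two_neq0 : (2%:R : k) != 0 by move: char_not2; rewrite inE.
have morita := morita_two_lines n_ge1 two_neq0.
pose v0 := base_vertex n_ge1; have ce := vertex_idem_complete k v0.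
split; exists (sqzero_alg k v0); split=> //; try exact: sqzero_split_basic.
  exists (@vertex_idem k _ v0); split=> //; exact: sqzero_quiver_wrt.
exists (@vertex_idem k _ v0), (vertex_idem_complete k v0); split.
  exact: sqzero_quiver_wrt.
exact: sqzero_presentation.
Qed.
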